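(* Fix $0<\varepsilon<\frac12$ and put \[ c=(1-\varepsilon)^{1/h}\,\frac{(b_1\cdots b_h)^{1/h^2}}{\Gamma(1/h)}. \] Define the random set $\mathscr{A}\subseteq\mathbb{Z}_{\ge0}$ as follows: $0\in\mathscr{A}$ always, and the events $\{n\in\mathscr{A}\}$ for $n\ge1$ are mutually independent with \[ \Pr(n\in\mathscr{A})=\min\Big\{c\,\frac{(n\log n)^{1/h}}{n},\,1\Big\}. \] Then $\mathbb{E}(r_{\mathscr{A},h}(n))\sim(1-\varepsilon)\log n$ as $n\to\infty$. Moreover, \[ \Pr\big(r_{\mathscr{A},h}(n)=0\text{ for infinitely many } n\big)=1. \]
   Context: Fix an integer $h\ge 2$ and positive integers $b_1,\dots,b_h$, not necessarily distinct, with $\gcd(b_1,\dots,b_h)=1$. For $A\subseteq\mathbb{Z}_{\ge 0}$, $1\le\ell\le h$ and an integer $n\ge 0$, let $r_{A,\ell}(n)$ be the number of $\ell$-tuples $(k_1,\dots,k_\ell)\in A^\ell$ with $b_1k_1+\cdots+b_\ell k_\ell=n$. *)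

(* Defs.v *)
From HB Require Import structures.
From mathcomp Require Import all_boot all_order all_algebra.
From mathcomp Require Import all_classical all_reals all_analysis.
Set Implicit Arguments. Unset Strict Implicit. Unset Printing Implicit Defensive.
Import Order.TTheory GRing.Theory Num.Theory.
Import numFieldNormedType.Exports.
Local Open Scope classical_set_scope.
Local Open Scope ring_scope.

Definition Gamma (R : realType) (s : R) : R :=
  fine (\int[@lebesgue_measure R]_(x in `]0%R, +oo[) ((x `^ (s - 1)) * expR (- x))%:E)%E.

Definition mutually_independent_pos {d : measure_display} {T : measurableType d}
  {R : realType} (P : probability T R) (E : nat -> set T) : Prop :=
  forall s : seq nat, uniq s -> all (fun n => 0 < n)%N s ->
    P (\big[setI/setT]_(n <- s) E n) = (\prod_(n <- s) P (E n))%E.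

Definition inA {T : Type} (E : nat -> set T) (w : T) (n : nat) : bool :=
  (n == 0)%N || (w \in E n).

(* r_{A,l}(n): number of l-tuples (k_1..k_l) in A^l with b_1 k_1 + ... + b_l k_l = n.
   Since all b_i >= 1, every k_i <= n, so tuples range over 'I_n.+1. *)
Definition rA {T : Type} (l : nat) (b : nat -> nat) (E : nat -> set T) (w : T)
  (n : nat) : nat :=
  #|[set k : {ffun 'I_l -> 'I_n.+1} |
      [forall i, inA E w (k i)] && ((\sum_(i < l) b i * k i)%N == n)]|.

(* Main.v *)
Require Import Defs.
From HB Require Import structures.
From mathcomp Require Import all_boot all_order all_algebra.
From mathcomp Require Import all_classical all_reals all_analysis.
From mathcomp Require Import measurable_realfun ring lra zify.
Set Implicit Arguments.
Unset Strict Implicit.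
Unset Printing Implicit Defensive.
Import Order.TTheory GRing.Theory Num.Theory.
Import numFieldNormedType.Exports.
Local Open Scope ring_scope.

(** Expectation. With [w(k)] the integral of [x^(1/h-1)] over [[k-1, k]], let [v(n)]
    be the sum of [w(k_1) ... w(k_h)] over the solutions of [b . k = n]. Cutting
    unit cells into [q] pieces compares the summatory function [F] of [v] at [x]
    and at [q x], so that [F(x) = V x + O(1)]. Since [gcd b = 1], translating by a
    Bezout vector shows that [v] oscillates slowly, hence [v(n) --> V]. Finally
    the generating function of [v] is the product over [i] of those of [w], which
    are Riemann sums for the Gamma integral; this gives
    [V = Gamma(1/h)^h / (b_1 ... b_h)^(1/h)]. The expectation is [c^h v(n) log n] up to
    the contribution of tuples with a small or a repeated entry, which is
    negligible.

    Gaps. Let [X] be the number of [n] in [(N, 2N]] with [r(n) = 0]. Harris'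
    inequality gives [P(r(n) = 0) >= n^(-1 + eps/2)], so [E X --> +oo]. Janson's
    inequality gives [P(r(n) = r(m) = 0) <= (1 + o(1)) P(r(n) = 0) P(r(m) = 0)] for
    [n <> m], because pairs of distinct overlapping representations contribute
    only a negative power of [N]. By Chebyshev's inequality [P(X = 0) --> 0]. *)

(** * Harris' and Janson's inequalities for independent coins *)

(** Weights are integrals over unit cells, not the values [k^(1/h-1)], because integrals are
    homogeneous: cutting cells into [q] pieces is exact up to a factor, and comparing the two scales
    costs only the rounding of entries. All error terms rest on one device. Some entry of a solution
    of an equation with value [t] is at least a constant times [t]; it weighs [O(t^(1/h-1))] and is
    recovered from the others. With [r] free entries this gives [O(t^(r/h-1))], so a free entry lost
    to a coincidence or to a second equation saves [t^(-1/h)]. Overlapping representations are the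
    obstacle: once the shared entries are moved to the right-hand side, the remaining value may be
    tiny, and its size then saves nothing. In that case the first tuple satisfies a second linear
    equation, which has to be independent of [b . k = n]; this fails only if both tuples have the
    same sum and the same set of entries. The constant [c] satisfies [c^h V = 1 - eps], so at most
    [(1 - eps + o(1)) log n] sets are expected to represent [n], which keeps the probability of a
    gap above [1/n] by a power of [n]. *)

Section coins.
Variables (R : realType) (p : nat -> R).
Implicit Types (A : nat -> bool) (f g : (nat -> bool) -> R).

Definition upd A (m : nat) (v : bool) : nat -> bool :=
  fun n => if n == m then v else A n.

(** Expectation over independent coins [0, ..., M-1], written as an iterated average so that
    inequalities follow by induction on the number of coins; the coins from [M] on show [false]. *)
Fixpoint Ex (M : nat) f : R :=
  if M is m.+1 then
    p m * Ex m (fun A => f (upd A m true))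
    + (1 - p m) * Ex m (fun A => f (upd A m false))
  else f (fun=> false).

Lemma eq_Ex M f g : f =1 g -> Ex M f = Ex M g.
Proof.
elim: M f g => [|m IH] f g fg /=; first exact: fg.
by congr (_ * _ + _ * _); apply: IH => A; apply: fg.
Qed.

Lemma ExD M f g : Ex M (fun A => f A + g A) = Ex M f + Ex M g.
Proof. by elim: M f g => [//|m IH] f g /=; rewrite !IH; ring. Qed.

Lemma ExZ M a f : Ex M (fun A => a * f A) = a * Ex M f.
Proof. by elim: M f => [//|m IH] f /=; rewrite !IH; ring. Qed.

Lemma ExB M f g : Ex M (fun A => f A - g A) = Ex M f - Ex M g.
Proof. by elim: M f g => [//|m IH] f g /=; rewrite !IH; ring. Qed.

Lemma Ex_cst M a : Ex M (fun=> a) = a.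
Proof. by elim: M => [//|m IH] /=; rewrite !IH; ring. Qed.

Lemma Ex_sum (I : Type) M (s : seq I) (F : I -> (nat -> bool) -> R) :
  Ex M (fun A => \sum_(i <- s) F i A) = \sum_(i <- s) Ex M (F i).
Proof.
elim: s => [|i s IH].
  by rewrite big_nil -[RHS](Ex_cst M); apply: eq_Ex => A; rewrite big_nil.
by rewrite big_cons -IH -ExD; apply: eq_Ex => A; rewrite big_cons.
Qed.

(** The last coin is seen by only one of [f] and [g]; for the other one both conditional averages
    coincide and factor out. *)
Lemma Ex_prod_indep M f g (Z : pred nat) :
  (forall A A', (forall n, Z n -> A n = A' n) -> f A = f A') ->
  (forall A A', (forall n, ~~ Z n -> A n = A' n) -> g A = g A') ->
  Ex M (fun A => f A * g A) = Ex M f * Ex M g.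
Proof.
elim: M f g => [//|m IH] f g fZ gZ /=.
have fupd v : forall A A', (forall n, Z n -> A n = A' n) ->
    f (upd A m v) = f (upd A' m v).
  by move=> A A' AA'; apply: fZ => n Zn; rewrite /upd; case: ifP => // _; exact: AA'.
have gupd v : forall A A', (forall n, ~~ Z n -> A n = A' n) ->
    g (upd A m v) = g (upd A' m v).
  by move=> A A' AA'; apply: gZ => n Zn; rewrite /upd; case: ifP => // _; exact: AA'.
rewrite (IH _ _ (fupd true) (gupd true)) (IH _ _ (fupd false) (gupd false)).
have [Zm|Zm] := boolP (Z m).
  have -> : Ex m (fun A => g (upd A m true)) = Ex m (fun A => g (upd A m false)).
    apply: eq_Ex => A; apply: gZ => n Zn; rewrite /upd.
    by case: eqP => // nm; rewrite nm Zm in Zn.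
  by ring.
have -> : Ex m (fun A => f (upd A m true)) = Ex m (fun A => f (upd A m false)).
  apply: eq_Ex => A; apply: fZ => n Zn; rewrite /upd.
  by case: eqP => // nm; rewrite -nm Zn in Zm.
by ring.
Qed.

Lemma Ex_prod_coins M (Y : pred nat) :
  Ex M (fun A => \prod_(i < M | Y i) (A i)%:R) = \prod_(i < M | Y i) p i.
Proof.
elim: M => [|m IH] /=; first by rewrite !big_ord0.
have updE A v : \prod_(i < m.+1 | Y i) (upd A m v i)%:R =
    (if Y m then v%:R else 1) * \prod_(i < m | Y i) (A i)%:R :> R.
  rewrite big_mkcond big_ord_recr /= /upd eqxx mulrC; congr (_ * _).
  rewrite [RHS]big_mkcond; apply: eq_bigr => i _ /=.
  by rewrite ltn_eqF //.
rewrite (eq_Ex _ (fun A => updE A true)) (eq_Ex _ (fun A => updE A false)) !ExZ IH.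
rewrite [RHS]big_mkcond big_ord_recr /= -big_mkcond /=.
by case: ifP => _ /=; ring.
Qed.

Hypothesis p01 : forall n, 0 <= p n <= 1.

Lemma Ex_le M f g : (forall A, f A <= g A) -> Ex M f <= Ex M g.
Proof.
elim: M f g => [|m IH] f g fg /=; first exact: fg.
have /andP[p0 p1] := p01 m.
by apply: lerD; apply: ler_wpM2l; rewrite ?subr_ge0 //; apply: IH => A; exact: fg.
Qed.

Lemma Ex_ge0 M f : (forall A, 0 <= f A) -> 0 <= Ex M f.
Proof. by move=> f0; rewrite -(Ex_cst M 0); exact: Ex_le. Qed.

Definition antitone f :=
  forall A A', (forall n, A n -> A' n) -> f A' <= f A.

Lemma antitone_upd f m v : antitone f -> antitone (fun A => f (upd A m v)).
Proof.
move=> af A A' AA'; apply: af => n; rewrite /upd.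
by case: ifP => // _; exact: AA'.
Qed.

(** Conditioning on the last coin [m], with averages [a1, a0] of [f] and [b1, b0] of [g], the
    induction leaves the nonnegative excess [p m (1 - p m) (a0 - a1) (b0 - b1)]. *)
Lemma harris M f g : antitone f -> antitone g ->
  Ex M f * Ex M g <= Ex M (fun A => f A * g A).
Proof.
elim: M f g => [//|m IH] f g af ag /=.
have /andP[p0 p1] := p01 m.
have step k : antitone k ->
    Ex m (fun A => k (upd A m true)) <= Ex m (fun A => k (upd A m false)).
  move=> ak; apply: Ex_le => A; apply: ak => n; rewrite /upd.
  by case: ifP.
have H1 := IH _ _ (@antitone_upd _ m true af) (@antitone_upd _ m true ag).
have H0 := IH _ _ (@antitone_upd _ m false af) (@antitone_upd _ m false ag).
have Hf := step _ af; have Hg := step _ ag.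
set a1 := Ex m (fun A => f _) in H1 Hf *; set b1 := Ex m (fun A => g _) in H1 Hg *.
set a0 := Ex m (fun A => f _) in H0 Hf *; set b0 := Ex m (fun A => g _) in H0 Hg *.
set c1 := Ex m (fun A => _ * _) in H1 *; set c0 := Ex m (fun A => _ * _) in H0 *.
have q0 : 0 <= 1 - p m by rewrite subr_ge0.
have K1 := ler_wpM2l p0 H1; have K0 := ler_wpM2l q0 H0.
have K2 : 0 <= p m * (1 - p m) * ((a0 - a1) * (b0 - b1)).
  by rewrite mulr_ge0 ?mulr_ge0 // subr_ge0.
apply: le_trans (lerD K1 K0); rewrite -subr_ge0; apply: le_trans K2 _.
by rewrite le_eqVlt; apply/orP; left; apply/eqP; ring.
Qed.

Lemma harris_neg M f g : antitone f -> antitone (fun A => - g A) ->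
  Ex M (fun A => g A * f A) <= Ex M g * Ex M f.
Proof.
move=> af ag; have := harris M ag af.
have -> : Ex M (fun A => - g A) = - Ex M g.
  by rewrite -mulN1r -ExZ; apply: eq_Ex => A; rewrite mulN1r.
have -> : Ex M (fun A => - g A * f A) = - Ex M (fun A => g A * f A).
  by rewrite -mulN1r -ExZ; apply: eq_Ex => A; rewrite mulN1r mulNr.
by rewrite mulNr lerN2.
Qed.

(** * Families of sets of coins that must not be contained in the random set *)

Section families.
Variable M : nat.
Implicit Types (X Y : {set 'I_M}) (F : seq {set 'I_M}).

Definition ind X A : R := [forall i in X, A i]%:R.
Definition avoid F A : R := \prod_(X <- F) (1 - ind X A).
Definition wt X : R := \prod_(i in X) p i.

Lemma indE X A : ind X A = \prod_(i in X) (A i)%:R.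
Proof.
rewrite /ind; case: forallP => /= [H|H].
  by rewrite big1 // => i iX; move: (implyP (H i) iX) => ->.
apply/esym/eqP/prodf_eq0; apply: contrapT => H'; apply: H => i.
apply/implyP => iX; apply: contrapT => Ai; apply: H'; exists i => //.
by case: (A i) Ai.
Qed.

Lemma ind01 X A : 0 <= ind X A <= 1.
Proof. by rewrite /ind; case: [forall _ in _, _]; rewrite ?lexx ler01. Qed.

Lemma ind_ge0 X A : 0 <= ind X A. Proof. by have /andP[] := ind01 X A. Qed.

Lemma ind_le1 X A : ind X A <= 1. Proof. by have /andP[] := ind01 X A. Qed.

Lemma indU X Y A : ind (X :|: Y) A = ind X A * ind Y A.
Proof.
rewrite /ind -natrM mulnb; congr (nat_of_bool _)%:R.
apply/forall_inP/andP => [H|[/forall_inP HX /forall_inP HY] i].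
  by split; apply/forall_inP => i iX; apply: H; rewrite inE iX ?orbT.
by rewrite inE => /orP[/HX|/HY].
Qed.

Lemma ind_mono X A A' : (forall n, A n -> A' n) -> ind X A <= ind X A'.
Proof.
move=> AA'; rewrite /ind ler_nat.
case: (boolP [forall i in X, A i]) => // /forall_inP H.
by rewrite (_ : [forall i in X, A' i]) //; apply/forall_inP => i /H /AA'.
Qed.

Lemma Ex_ind X : Ex M (ind X) = wt X.
Proof.
rewrite /wt; pose Y n := if insub n is Some i then i \in X else false.
have YE (i : 'I_M) : Y i = (i \in X) by rewrite /Y valK.
under [RHS]eq_bigl do rewrite -YE.
rewrite -Ex_prod_coins; apply: eq_Ex => A; rewrite indE.
by under eq_bigl do rewrite -YE.
Qed.

Lemma wt_ge0 X : 0 <= wt X.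
Proof. by apply: prodr_ge0 => i _; have /andP[] := p01 i. Qed.

Lemma wt_le1 X : wt X <= 1.
Proof. by rewrite -Ex_ind -(Ex_cst M 1); apply: Ex_le => A; exact: ind_le1. Qed.

Lemma avoid01 F A : 0 <= avoid F A <= 1.
Proof.
apply/andP; split; first by apply: prodr_ge0 => X _; rewrite subr_ge0 ind_le1.
by apply: numdomain.Num.Theory.prodr_ile1 => X _; rewrite subr_ge0 ind_le1 lerBlDr lerDl ind_ge0.
Qed.

Lemma avoid_ge0 F A : 0 <= avoid F A. Proof. by have /andP[] := avoid01 F A. Qed.

Lemma avoid_antitone F : antitone (avoid F).
Proof.
move=> A A' AA'; apply: ler_prod => X _.
by rewrite subr_ge0 ind_le1 lerB // ind_mono.
Qed.

Lemma avoid_cons X F A : avoid (X :: F) A = (1 - ind X A) * avoid F A.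
Proof. by rewrite /avoid big_cons. Qed.

Lemma harris_avoid F : \prod_(X <- F) (1 - wt X) <= Ex M (avoid F).
Proof.
elim: F => [|X F IH].
  by rewrite big_nil (@eq_Ex _ _ (fun=> 1)) ?Ex_cst // => A; rewrite /avoid big_nil.
rewrite big_cons (eq_Ex _ (avoid_cons X F)).
have := @harris M (fun A => 1 - ind X A) (avoid F).
rewrite ExB Ex_cst Ex_ind => H; apply: le_trans (H _ _); last first.
- exact: avoid_antitone.
- by move=> A A' AA'; rewrite lerB // ind_mono.
- by rewrite ler_wpM2l // subr_ge0 wt_le1.
Qed.

Lemma avoid_ge F A : 1 - \sum_(X <- F) ind X A <= avoid F A.
Proof.
elim: F => [|X F IH]; first by rewrite /avoid !big_nil subr0.
rewrite avoid_cons big_cons mulrBl mul1r opprD addrCA addrC.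
apply: lerD => //; rewrite lerN2 -[leRHS]mulr1.
by apply: ler_wpM2l; [exact: ind_ge0 | have /andP[] := avoid01 F A].
Qed.

(* Boppana and Spencer's argument: the sets disjoint from [X] are independent of
   [X], and Harris' inequality handles the union bound over the other ones. *)
Lemma Ex_ind_avoid X F :
  (wt X - \sum_(Y <- F | ~~ [disjoint X & Y]%B) wt (X :|: Y)) * Ex M (avoid F) <=
  Ex M (fun A => ind X A * avoid F A).
Proof.
set d := \sum_(_ <- _ | _) _.
have [dX|dX] := leP (wt X - d) 0.
  apply: (@le_trans _ _ 0); last by apply: Ex_ge0 => A; rewrite mulr_ge0 ?ind_ge0 ?avoid_ge0.
  by rewrite mulr_le0_ge0 //; apply: Ex_ge0 => A; exact: avoid_ge0.
pose F1 := [seq Y : {set 'I_M} <- F | ~~ [disjoint X & Y]%B].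
pose F0 := [seq Y : {set 'I_M} <- F | [disjoint X & Y]%B].
have avE A : avoid F A = avoid F0 A * avoid F1 A.
  by rewrite /avoid !big_filter (bigID (fun Y : {set 'I_M} => [disjoint X & Y]%B)) /=.
have le0 : Ex M (avoid F) <= Ex M (avoid F0).
  apply: Ex_le => A; rewrite avE -[leRHS]mulr1 ler_wpM2l ?avoid_ge0 //.
  by have /andP[] := avoid01 F1 A.
apply: le_trans (ler_wpM2l (ltW dX) le0) _.
have le1 : Ex M (fun A => ind X A * avoid F0 A -
     \sum_(Y <- F1) ind (X :|: Y) A * avoid F0 A) <=
    Ex M (fun A => ind X A * avoid F A).
  apply: Ex_le => A; rewrite avE mulrA.
  apply: le_trans (ler_wpM2l _ (avoid_ge F1 A)); last by rewrite mulr_ge0 ?ind_ge0 ?avoid_ge0.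
  rewrite mulrBr mulr1 lerB // mulr_sumr le_eqVlt; apply/orP; left; apply/eqP.
  by apply: eq_bigr => Y _; rewrite indU; ring.
apply: le_trans le1; rewrite ExB Ex_sum.
have -> : Ex M (fun A => ind X A * avoid F0 A) = wt X * Ex M (avoid F0).
  rewrite -Ex_ind.
  pose Z n := if insub n is Some i then i \in X else false.
  have ZE (i : 'I_M) : Z i = (i \in X) by rewrite /Z valK.
  apply: (@Ex_prod_indep _ _ _ Z) => A A' AA'.
    by rewrite !indE; apply: eq_bigr => i iX; rewrite AA' // ZE.
  apply: eq_big_seq => Y; rewrite mem_filter => /andP[XY _].
  congr (1 - _); rewrite !indE; apply: eq_bigr => i iY; rewrite AA' // ZE.
  by rewrite (disjointFl XY).
have -> : d = \sum_(Y <- F1) wt (X :|: Y) by rewrite /d /F1 big_filter.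
rewrite mulrBl lerB // mulr_suml; apply: ler_sum => Y _.
rewrite -Ex_ind; apply: harris_neg; first exact: avoid_antitone.
by move=> A A' AA'; rewrite lerN2 ind_mono.
Qed.

(** Adding a set [X] to the family multiplies the probability by at most
    [1 - wt X + d <= expR (- wt X + d)], where [d] collects the sets that meet [X]. Summing over
    ordered pairs counts each overlapping pair twice, a harmless loss. *)
Lemma janson F : uniq F ->
  Ex M (avoid F) <= expR (- \sum_(X <- F) wt X +
    \sum_(X <- F) \sum_(Y <- F | (Y != X) && (~~ [disjoint X & Y]%B)) wt (X :|: Y)).
Proof.
elim: F => [_|X F IH /= /andP[XF uF]].
  by rewrite !big_nil oppr0 addr0 expR0 (@eq_Ex _ _ (fun=> 1)) ?Ex_cst // => A; rewrite /avoid big_nil.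
set d := \sum_(Y <- F | ~~ [disjoint X & Y]%B) wt (X :|: Y).
have H : Ex M (avoid (X :: F)) <= (1 - wt X + d) * Ex M (avoid F).
  rewrite (@eq_Ex _ _ (fun A => avoid F A - ind X A * avoid F A)); last first.
    by move=> A; rewrite avoid_cons mulrBl mul1r.
  by rewrite ExB; have := Ex_ind_avoid X F; rewrite -/d; lra.
apply: le_trans H _.
have E0 : 0 <= Ex M (avoid F) by apply: Ex_ge0 => A; exact: avoid_ge0.
have e1 : 1 - wt X + d <= expR (- wt X + d) by rewrite -addrA expR_ge1Dx.
apply: le_trans (ler_wpM2r E0 e1) _.
apply: le_trans (ler_wpM2l (expR_ge0 _) (IH uF)) _.
rewrite -expRD ler_expR !big_cons eqxx /=.
set S := \sum_(j <- F) \sum_(_ <- _ | _) _.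
(* By uniqueness [X] does not occur in [F], so the condition [Y != X] removes nothing. *)
have -> : \sum_(Y <- F | (Y != X) && (~~ [disjoint X & Y]%B)) wt (X :|: Y) = d.
  rewrite /d big_seq_cond [RHS]big_seq_cond; apply: eq_bigl => Y.
  by case: eqP => // ->; rewrite (negbTE XF).
set S' := \sum_(j <- F) \sum_(_ <- _ | _) _.
suff : S <= S' by lra.
apply: ler_sum => Y _; rewrite big_cons.
by case: ifP => // _; rewrite lerDr wt_ge0.
Qed.

End families.
End coins.

Arguments Ex : simpl never.

(** * The weights *)

Section weights.
Variables (R : realType) (h : nat).
Hypothesis h2 : (2 <= h)%N.

Definition hroot (x : R) : R := x `^ h%:R^-1.

Lemma hR_gt0 : 0 < h%:R :> R. Proof. by rewrite ltr0n; lia. Qed.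

Lemma hroot_ge0 x : 0 <= hroot x. Proof. exact: powR_ge0. Qed.

Lemma hroot_gt0 x : 0 < x -> 0 < hroot x. Proof. exact: powR_gt0. Qed.

Lemma hroot0 : hroot 0 = 0.
Proof. by rewrite /hroot powR0 // invr_eq0 gt_eqF // hR_gt0. Qed.

Lemma hroot1 : hroot 1 = 1. Proof. by rewrite /hroot powR1. Qed.

Lemma hrootM x y : 0 <= x -> 0 <= y -> hroot (x * y) = hroot x * hroot y.
Proof. exact: powRM. Qed.

Lemma hroot_exp x : 0 <= x -> hroot x ^+ h = x.
Proof.
move=> x0; rewrite -powR_mulrn ?hroot_ge0 // /hroot -powRrM mulVf ?powRr1 //.
by rewrite gt_eqF ?hR_gt0.
Qed.

Lemma le_hroot x y : 0 <= x -> x <= y -> hroot x <= hroot y.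
Proof.
move=> x0 xy; apply: ge0_ler_powR => //; rewrite ?invr_ge0 ?(ltW hR_gt0) //.
by rewrite nnegrE (le_trans x0).
Qed.

Lemma hroot_le_exp x y : 0 <= x -> 0 <= y -> x <= y ^+ h -> hroot x <= y.
Proof.
move=> x0 y0 H; rewrite -(@ler_pXn2r _ h) ?nnegrE ?hroot_ge0 //; last by lia.
by rewrite hroot_exp.
Qed.

Lemma hroot_ge1 x : 1 <= x -> 1 <= hroot x.
Proof. by move=> x1; rewrite -hroot1 le_hroot. Qed.

Lemma hroot_le x : 1 <= x -> hroot x <= x.
Proof.
move=> x1; apply: ler1_powR => //; rewrite invf_le1 ?hR_gt0 // ler1n; lia.
Qed.

Lemma hroot_ge x : 0 <= x <= 1 -> x <= hroot x.
Proof.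
move=> /andP[x0 x1]; rewrite -{1}(hroot_exp x0) -[leRHS]expr1.
apply: ler_wiXn2l; rewrite ?hroot_ge0 //; last by lia.
by rewrite -hroot1 le_hroot.
Qed.

Lemma bernoulli_ineq n (y : R) : -1 <= y -> 1 + n%:R * y <= (1 + y) ^+ n.
Proof.
move=> y1; elim: n => [|n IH]; first by rewrite mul0r addr0 expr0.
rewrite exprS; have y2 : 0 <= 1 + y by lra.
apply: le_trans (ler_wpM2l y2 IH); rewrite -natr1.
have : 0 <= n%:R * y ^+ 2 by rewrite mulr_ge0 // sqr_ge0.
by rewrite expr2; lra.
Qed.

Lemma hroot_bernoulli x : -1 <= x -> hroot (1 + x) <= 1 + x / h%:R.
Proof.
move=> x1; have h0 := hR_gt0.
have h1 : 1 <= h%:R :> R by rewrite ler1n; lia.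
have xh : -1 <= x / h%:R by rewrite ler_pdivlMr //; lra.
apply: hroot_le_exp; [lra | lra|].
apply: le_trans (bernoulli_ineq h xh); rewrite mulrCA divff ?mulr1 ?lexx //.
by rewrite gt_eqF.
Qed.

Definition rho x : R := hroot x / x.

Lemma rho_ge0 x : 0 <= x -> 0 <= rho x.
Proof. by move=> x0; rewrite divr_ge0 ?hroot_ge0. Qed.

Lemma rhoM x y : 0 < x -> 0 < y -> rho (x * y) = rho x * rho y.
Proof.
move=> x0 y0; rewrite /rho hrootM ?ltW //; by field; rewrite !gt_eqF.
Qed.

Lemma rho_le1 x : 1 <= x -> rho x <= 1.
Proof. by move=> x1; rewrite ler_pdivrMr ?mul1r ?hroot_le //; lra. Qed.

Lemma le_rho x y : 0 < x -> x <= y -> rho y <= rho x.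
Proof.
move=> x0 xy; have y0 := lt_le_trans x0 xy.
have yx : 1 <= y / x by rewrite ler_pdivlMr // mul1r.
have -> : y = x * (y / x) by rewrite mulrCA divff ?mulr1 // gt_eqF.
rewrite rhoM ?divr_gt0 // -[leRHS]mulr1; apply: ler_wpM2l (rho_le1 yx).
by rewrite rho_ge0 // ltW.
Qed.

Lemma rho_scale x c : 0 < x -> 1 <= c -> rho (x / c) <= c * rho x.
Proof.
move=> x0 c1; have c0 : 0 < c by lra.
rewrite /rho; have -> : hroot (x / c) / (x / c) = c * (hroot (x / c) / x).
  by field; rewrite !gt_eqF.
apply: ler_wpM2l; first exact: ltW.
apply: ler_wpM2r; first by rewrite invr_ge0 ltW.
apply: le_hroot; first by rewrite divr_ge0 // ltW.
by rewrite ler_pdivrMr // ler_peMr // ltW.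
Qed.

(* [wgt k] is the integral of [x^(1/h - 1)] over [[k - 1, k]]: up to a factor
   [1 + O(1/k)] it is [k^(1/h - 1)], its partial sums are exact, and
   [wgt 0 = 0] since [0.-1 = 0]. *)
Definition wgt (k : nat) : R := h%:R * (hroot k%:R - hroot k.-1%:R).
(** The element 0 is always in the random set although [wgt 0 = 0]; giving it weight 1 makes [wgt1]
    a majorant of the probabilities, up to a logarithmic factor. *)
Definition wgt1 (k : nat) : R := wgt k + (k == 0%N)%:R.

Lemma wgt0 : wgt 0 = 0. Proof. by rewrite /wgt subrr mulr0. Qed.

(** The decreasing function [x^(1/h-1)] has an integral over a unit cell between its values at the
    two ends; here this is Bernoulli's inequality for the [h]-th root. The other half is
    [wgt_le_pred]. *)
Lemma wgt_ge k : (0 < k)%N -> rho k%:R <= wgt k.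
Proof.
case: k => // k _; rewrite /wgt /rho /=.
set x : R := k.+1%:R; have x0 : 0 < x by rewrite ltr0n.
have x1 : 1 <= x by rewrite ler1n.
have -> : k%:R = x * (1 - x^-1) :> R.
  by rewrite mulrBr mulr1 divff ?gt_eqF // /x -natr1 addrK.
clearbody x.
have xi : x^-1 <= 1 by rewrite invf_le1.
rewrite hrootM ?subr_ge0 ?(ltW x0) //.
have := @hroot_bernoulli (- x^-1); rewrite lerN2 => /(_ xi).
rewrite mulNr => H; have h0 := hR_gt0.
have := ler_wpM2l (mulr_ge0 (ltW h0) (hroot_ge0 x)) H.
rewrite mulrBr mulr1 mulrBr -!mulrA => H2.
have -> : hroot x / x = h%:R * (hroot x * (x^-1 / h%:R)).
  by field; rewrite !gt_eqF.
by rewrite lerBrDr addrC -lerBrDr.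
Qed.

(** The left end of the first cell is a pole, so a bound by the value at [k] itself, uniform in
    [k >= 1], costs the factor [h]; it is attained at [k = 1]. *)
Lemma wgt_le k : (0 < k)%N -> wgt k <= h%:R * rho k%:R.
Proof.
case: k => // k _; rewrite /wgt /rho /= ler_wpM2l ?(ltW hR_gt0) //.
set x : R := k.+1%:R; have x0 : 0 < x by rewrite ltr0n.
have x1 : 1 <= x by rewrite ler1n.
have -> : k%:R = x * (1 - x^-1) :> R.
  by rewrite mulrBr mulr1 divff ?gt_eqF // /x -natr1 addrK.
clearbody x.
have xi : x^-1 <= 1 by rewrite invf_le1.
have xi0 : 0 < x^-1 by rewrite invr_gt0.
rewrite hrootM ?subr_ge0 ?(ltW x0) //.
have xx : 0 <= 1 - x^-1 <= 1 by lra.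
have := ler_wpM2l (hroot_ge0 x) (hroot_ge xx); lra.
Qed.

Lemma wgt_le_pred k : (0 < k)%N -> wgt k.+1 <= rho k%:R.
Proof.
move=> k0; rewrite /wgt /rho /=.
set x : R := k%:R; have x0 : 0 < x by rewrite ltr0n.
have xi0 : 0 < x^-1 by rewrite invr_gt0.
have -> : k.+1%:R = x * (1 + x^-1) :> R.
  by rewrite mulrDr mulr1 divff ?gt_eqF // /x natr1.
clearbody x.
rewrite hrootM ?(ltW x0) //; last by rewrite addr_ge0 // ltW.
have h0 := hR_gt0.
have H := @hroot_bernoulli (x^-1) _.
have := ler_wpM2l (mulr_ge0 (ltW h0) (hroot_ge0 x)) (H _) => H2.
have -> : hroot x / x = h%:R * (hroot x * (x^-1 / h%:R)).
  by field; rewrite !gt_eqF.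
have : -1 <= x^-1 by lra.
move=> /H2; rewrite mulrDr mulr1 mulrBr -!mulrA; lra.
Qed.

Lemma wgt_ge0 k : 0 <= wgt k.
Proof.
by rewrite mulr_ge0 // ?(ltW hR_gt0) // subr_ge0 le_hroot // ler_nat; lia.
Qed.

Lemma wgt1_ge0 k : 0 <= wgt1 k. Proof. by rewrite addr_ge0 ?wgt_ge0. Qed.

Lemma wgt1E k : (0 < k)%N -> wgt1 k = wgt k.
Proof. by case: k => // k _; rewrite /wgt1 /= addr0. Qed.

Lemma wgt_le_wgt1 k : wgt k <= wgt1 k. Proof. by rewrite lerDl. Qed.

Lemma wgt1_le k : wgt1 k <= h%:R.
Proof.
case: k => [|k]; first by rewrite /wgt1 wgt0 add0r ler1n; lia.
rewrite wgt1E //; apply: le_trans (wgt_le _) _ => //.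
rewrite ler_piMr ?(ltW hR_gt0) // /rho ler_pdivrMr ?ltr0n // mul1r hroot_le //.
by rewrite ler1n.
Qed.

Lemma wgt1_le_rho (t y L : nat) : (0 < t)%N -> (t <= L * y)%N ->
  wgt1 y <= h%:R * L%:R * rho t%:R.
Proof.
move=> t0 tLy; have y0 : (0 < y)%N by case: y tLy => //; lia.
have L0 : (0 < L)%N by case: L tLy => //; lia.
rewrite wgt1E //; apply: le_trans (wgt_le y0) _.
rewrite -mulrA ler_wpM2l ?(ltW hR_gt0) //.
have H : t%:R / L%:R <= y%:R :> R.
  by rewrite ler_pdivrMr ?ltr0n // -natrM ler_nat mulnC.
apply: le_trans (le_rho _ H) _; first by rewrite divr_gt0 ?ltr0n.
by apply: rho_scale; rewrite ?ltr0n ?ler1n.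
Qed.

Lemma sum_wgt_cut M t :
  \sum_(x < M.+1 | (x <= t)%N) wgt x = h%:R * hroot (minn M t)%:R.
Proof.
pose f x := h%:R * hroot (minn x.-1 t)%:R.
rewrite big_mkcond /= -(big_mkord xpredT (fun x => if (x <= t)%N then wgt x else 0)).
rewrite (@telescope_sumr_eq _ 0 M.+1 f); last first.
- move=> x _; rewrite /f /wgt /=; case: leqP => xt; rewrite -mulrBr.
    by have -> : minn x.-1 t = x.-1 by lia.
  have -> : minn x.-1 t = t by lia.
  by rewrite subrr mulr0.
- by [].
by rewrite /f /= min0n hroot0 mulr0 subr0.
Qed.

Lemma sum_wgt M : \sum_(x < M.+1) wgt x = h%:R * hroot M%:R.
Proof.
have := sum_wgt_cut M M; rewrite minnn => <-; apply: eq_bigl => x.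
by rewrite -ltnS ltn_ord.
Qed.

Lemma sum_wgt1_cut M t : (0 < t)%N ->
  \sum_(x < M.+1) (if (x <= t)%N then wgt1 x else 0) <= (1 + h%:R) * hroot t%:R.
Proof.
move=> t0; rewrite -big_mkcond /= big_split /= sum_wgt_cut.
rewrite addrC mulrDl mul1r; apply: lerD.
  rewrite big_mkcond big_ord_recl /= big1 ?addr0.
    by apply: hroot_ge1; rewrite ler1n.
  by move=> i _; case: ifP.
by rewrite ler_wpM2l ?(ltW hR_gt0) // le_hroot // ler_nat geq_minr.
Qed.

End weights.

(** * Weighted sums over solutions of linear equations *)

Section tuple_sums.
Variable R : realType.

(** Expanding the product of sums gives a sum over all assignments of the coordinates in [J].
    Elements of [D] inject into these by forgetting the other coordinates, which are reset to
    [v0]. *)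
Lemma sum_determined_le (I V : finType) (v0 : V) (D : pred {ffun I -> V})
    (J : pred I) (g : I -> V -> R) :
  (forall i x, 0 <= g i x) ->
  (forall k k', D k -> D k' -> (forall i, J i -> k i = k' i) -> k = k') ->
  \sum_(k | D k) \prod_(i | J i) g i (k i) <= \prod_(i | J i) \sum_x g i x.
Proof.
move=> g0 inj; rewrite (big_distr_big v0) /=.
pose phi (k : {ffun I -> V}) : {ffun I -> V} := [ffun i => if J i then k i else v0].
have phiE (k : {ffun I -> V}) : \prod_(i | J i) g i (k i) = \prod_(i | J i) g i (phi k i).
  by apply: eq_bigr => i Ji; rewrite ffunE Ji.
rewrite (eq_bigr _ (fun k _ => phiE k)).
have phi_inj : {in D &, injective phi}.
  move=> k k' Dk Dk' e; apply: inj => // i Ji.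
  by have /ffunP/(_ i) := e; rewrite !ffunE Ji.
rewrite -(big_imset (fun f : {ffun I -> V} => \prod_(i | J i) g i (f i)) phi_inj) /=.
rewrite big_mkcond [leRHS]big_mkcond; apply: ler_sum => f _.
case: ifP => [/imsetP[k Dk ->]|_]; last first.
  by case: ifP => // _; apply: prodr_ge0 => i _; exact: g0.
rewrite ifT //; apply/pffun_onP; split => [|x].
  by apply/supportP => i; rewrite ffunE => /negbTE; rewrite /in_mem /= => ->.
by move=> _.
Qed.

(* Some entry of a solution of [sum beta_i k_i = t] is at least [t / L]; in the
   sums below it is bounded through its size and recovered from the others. *)
Lemma sum_le_sum_max (I : finType) (M : nat) (D : pred {ffun I -> 'I_M.+1})
    (J : {set I}) (beta : I -> nat) (Bm L t : nat)
    (G : {ffun I -> 'I_M.+1} -> R) :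
  (0 < t)%N -> (forall i, i \in J -> (beta i <= Bm)%N) -> (#|J| * Bm <= L)%N ->
  (forall k, 0 <= G k) ->
  (forall k, D k -> (\sum_(i in J) beta i * k i)%N = t) ->
  \sum_(k | D k) G k <= \sum_(i in J) \sum_(k | D k && (t <= L * k i)%N) G k.
Proof.
move=> t0 betaB JL G0 Dt.
rewrite (eq_bigr _ (fun i _ => big_mkcondr _ _ _ _ _)) exchange_big /=.
apply: ler_sum => k Dk.
have [i iJ ti] : exists2 i, i \in J & (t <= L * k i)%N.
  apply: contrapT => H.
  have lt i : i \in J -> (L * k i < t)%N.
    by move=> iJ; rewrite ltnNge; apply/negP => ti; apply: H; exists i.
  have J0 : (0 < #|J|)%N.
    rewrite lt0n; apply/negP => /eqP/cards0_eq J0.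
    by have := Dt _ Dk; rewrite J0 big_set0; lia.
  have : (\sum_(i in J) L * (beta i * k i) <= \sum_(i in J) Bm * t.-1)%N.
    apply: leq_sum => i iJ; rewrite mulnCA leq_mul ?betaB //.
    by have := lt _ iJ; lia.
  rewrite -big_distrr /= (Dt _ Dk) sum_nat_const => H1.
  have L0 : (0 < L)%N.
    rewrite lt0n; apply/negP => /eqP L0.
    have Bm0 : Bm = 0%N by nia.
    have := Dt _ Dk; rewrite big1 => [t0'|i /betaB]; first by lia.
    by rewrite Bm0 leqn0 => /eqP ->.
  have : (#|J| * (Bm * t.-1) <= L * t.-1)%N by rewrite mulnA leq_mul2r JL orbT.
  by move=> /(leq_trans H1); rewrite leq_mul2l; lia.
rewrite (bigD1 i) //= ti lerDl; apply: sumr_ge0 => j _.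
by case: ifP.
Qed.

Variable h : nat.
Hypothesis h2 : (2 <= h)%N.
Local Notation hroot := (@hroot R h).
Local Notation rho := (@rho R h).
Local Notation wgt := (@wgt R h).
Local Notation wgt1 := (@wgt1 R h).

(** The entry of size at least [t / L] contributes [h L t^(1/h-1)] and is determined by the others;
    each of these is at most [t], so its weights sum to at most [(1 + h) t^(1/h)]. *)
Lemma sum_wgt1_le_max (I : finType) (M : nat) (D : pred {ffun I -> 'I_M.+1})
    (J : {set I}) (beta : I -> nat) (Bm L t : nat) :
  (0 < t)%N -> (forall i, i \in J -> (0 < beta i <= Bm)%N) -> (#|J| * Bm <= L)%N ->
  (forall k, D k -> (\sum_(i in J) beta i * k i)%N = t) ->
  (forall k k', D k -> D k' -> {in J, k =1 k'} -> k = k') ->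
  \sum_(k | D k) \prod_(i in J) wgt1 (k i) <=
  #|J|%:R * (h%:R * L%:R * rho t%:R * ((1 + h%:R) * hroot t%:R) ^+ #|J|.-1).
Proof.
move=> t0 betaB JL Dt inj.
have betaB' i : i \in J -> (beta i <= Bm)%N by move=> /betaB /andP[].
have G0 (k : {ffun I -> 'I_M.+1}) : 0 <= \prod_(i in J) wgt1 (k i).
  by apply: prodr_ge0 => i _; exact: wgt1_ge0.
apply: le_trans (sum_le_sum_max t0 betaB' JL G0 Dt) _.
rewrite mulr_natl -sumr_const; apply: ler_sum => i iJ.
have rt0 : 0 <= h%:R * L%:R * rho t%:R by rewrite mulr_ge0 // rho_ge0.
pose g (_ : I) (x : 'I_M.+1) : R := if (x <= t)%N then wgt1 x else 0.
have g0 j x : 0 <= g j x by rewrite /g; case: ifP => // _; exact: wgt1_ge0.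
apply: (@le_trans _ _ (\sum_(k | D k && (t <= L * k i)%N)
   h%:R * L%:R * rho t%:R * \prod_(j in J :\ i) g j (k j))).
  apply: ler_sum => k /andP[Dk tk]; rewrite (big_setD1 i) //=.
  apply: ler_pM; rewrite ?wgt1_ge0 ?wgt1_le_rho //.
    by apply: prodr_ge0 => j _; exact: wgt1_ge0.
  apply: ler_prod => j; rewrite !inE => /andP[_ jJ]; rewrite wgt1_ge0 //=.
  rewrite /g ifT //; rewrite -(Dt _ Dk) (bigD1 j) //=.
  by have /andP[b0 _] := betaB _ jJ; nia.
rewrite -mulr_sumr ler_wpM2l //.
apply: le_trans (@sum_determined_le _ _ ord0 _ _ g g0 _) _.
  move=> k k' /andP[Dk _] /andP[Dk' _] kk'; apply: inj => // j jJ.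
  have [->|ji] := eqVneq j i; last by apply: kk'; rewrite !inE ji.
  have := Dt _ Dk; rewrite -(Dt _ Dk') !(big_setD1 i iJ) /=.
  rewrite (eq_bigr (fun l => beta l * k' l)%N); last by move=> l lJ; rewrite kk'.
  move=> /addIn/eqP; have /andP[b0 _] := betaB _ iJ.
  by rewrite eqn_pmul2l // => /eqP; exact: val_inj.
rewrite (cardsD1 i J) iJ /= -prodr_const; apply: ler_prod => j _.
by rewrite sumr_ge0 // sum_wgt1_cut.
Qed.

(** The maximum with 1 lets bounds of the form [1 / t^(1/h)] include the value [t = 0]. *)
Definition hrootm (t : nat) : R := hroot (maxn 1 t)%:R.

Lemma hrootm_ge1 t : 1 <= hrootm t.
Proof. by rewrite hroot_ge1 // ler1n leq_maxl. Qed.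

Lemma hrootm_gt0 t : 0 < hrootm t.
Proof. exact: lt_le_trans (hrootm_ge1 t). Qed.

Lemma hrootmE t : (0 < t)%N -> hrootm t = hroot t%:R.
Proof. by move=> t0; rewrite /hrootm (maxn_idPr _). Qed.

Definition K1 (L : nat) : R := h%:R * (h%:R * L%:R * (1 + h%:R) ^+ h).

Lemma K1_ge1 L : (0 < L)%N -> 1 <= K1 L.
Proof.
move=> L0; have h1 : 1 <= h%:R :> R by rewrite ler1n; lia.
have L1 : 1 <= L%:R :> R by rewrite ler1n.
by rewrite !mulr_ege1 // exprn_ege1 // lerDl.
Qed.

Lemma exp_hroot (t : nat) : (0 < t)%N -> hroot t%:R ^+ h.-1 / t%:R = (hroot t%:R)^-1.
Proof.
move=> t0; have r0 : 0 < hroot t%:R by rewrite hroot_gt0 // ltr0n.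
have E : t%:R = hroot t%:R * hroot t%:R ^+ h.-1.
  by rewrite -exprS prednK ?hroot_exp //; lia.
by rewrite [X in _ / X]E invfM mulrCA divff ?mulr1 // expf_neq0 // gt_eqF.
Qed.

(** With [r] free entries the bound is a multiple of [t^(r/h-1)]: bounded for [r = h], and at most
    [t^(-1/h)] as soon as one free entry is missing. *)
Lemma sum_wgt1_le (I : finType) (M : nat) (D : pred {ffun I -> 'I_M.+1})
    (J : {set I}) (beta : I -> nat) (Bm L t : nat) :
  (0 < L)%N ->
  (forall i, i \in J -> (0 < beta i <= Bm)%N) -> (#|J| * Bm <= L)%N ->
  (forall k, D k -> (\sum_(i in J) beta i * k i)%N = t) ->
  (forall k k', D k -> D k' -> {in J, k =1 k'} -> k = k') ->
  (#|J| <= h)%N ->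
  \sum_(k | D k) \prod_(i in J) wgt1 (k i) <=
  (if (#|J| < h)%N then K1 L / hrootm t else K1 L).
Proof.
move=> L0 betaB JL Dt inj Jh; have K11 := K1_ge1 L0.
(* For [t = 0] all entries in [J] vanish, so at most one tuple remains, of weight [wgt1 0 = 1] per
   entry. *)
have [t0|t0] := posnP t.
  have rhs : 1 <= (if (#|J| < h)%N then K1 L / hrootm t else K1 L).
    by rewrite t0 /hrootm hroot1 invr1 mulr1 if_same.
  apply: le_trans rhs.
  have z k : D k -> forall i, i \in J -> k i = ord0.
    move=> Dk i iJ; have := Dt _ Dk; rewrite t0 => /eqP.
    rewrite sum_nat_eq0 => /forall_inP/(_ _ iJ); rewrite muln_eq0.
    by have /andP[b0 _] := betaB _ iJ; rewrite -leqn0 leqNgt b0 /= => /eqP ki; apply: val_inj.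
  have [k0 Dk0|D0] := pickP D; last by rewrite big_pred0 // ler01.
  rewrite (big_pred1 k0) => [|k].
    rewrite big1 // => i iJ; rewrite (z _ Dk0) // /wgt1 wgt0 add0r //.
  apply/idP/eqP => [Dk|-> //]; apply: inj => // i iJ.
  by rewrite (z _ Dk0) // (z _ Dk).
have r1 : 1 <= hroot t%:R by rewrite hroot_ge1 // ler1n.
have r0 : 0 < hroot t%:R by lra.
have tR : 0 < t%:R :> R by rewrite ltr0n.
apply: le_trans (sum_wgt1_le_max t0 betaB JL Dt inj) _.
set r := #|J| in Jh *; have [->|r_gt0] := posnP r.
  rewrite mul0r; case: ifP => _; first by rewrite divr_ge0 ?(ltW (hrootm_gt0 _)) // (le_trans ler01).
  by rewrite (le_trans ler01).
apply: (@le_trans _ _ (K1 L * (hroot t%:R ^+ r / t%:R))).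
  have -> : r%:R * (h%:R * L%:R * rho t%:R * ((1 + h%:R) * hroot t%:R) ^+ r.-1) =
      r%:R * (h%:R * L%:R * (1 + h%:R) ^+ r.-1) * (hroot t%:R ^+ r / t%:R) :> R.
    have E : hroot t%:R ^+ r = hroot t%:R * hroot t%:R ^+ r.-1.
      by rewrite -exprS prednK.
    by rewrite exprMn /rho E; ring.
  apply: ler_wpM2r; first by rewrite divr_ge0 ?exprn_ge0 ?hroot_ge0 ?ler0n.
  apply: ler_pM; rewrite ?ler0n ?ler_nat //.
  apply: ler_wpM2l; first by rewrite mulr_ge0.
  by rewrite ler_weXn2l ?lerDl //; lia.
rewrite hrootmE //; case: ltnP => rh.
  rewrite -exp_hroot // ler_wpM2l ?(le_trans ler01) // ler_wpM2r ?invr_ge0 ?(ltW tR) //.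
  by rewrite ler_weXn2l //; lia.
rewrite -[leRHS]mulr1 ler_wpM2l ?(le_trans ler01) // ler_pdivrMr // mul1r.
by rewrite -[leRHS](hroot_exp h2 (ltW tR)) ler_weXn2l.
Qed.

End tuple_sums.

(** This is [(x - y) (u - v) = 0] without subtraction; it is the cancellation step of Cramer's rule
    over the natural numbers. *)
Lemma nat_cross (x y u v : nat) : x != y -> (x * u + y * v = x * v + y * u)%N -> u = v.
Proof.
wlog lt_xy : x y u v / (x < y)%N => [H xy E|_].
  by case: (ltngtP x y) xy => // lt _; [apply: (H x y) | apply/esym/(H y x)]; lia.
rewrite -(subnKC (ltnW lt_xy)) !mulnDl => E.
have /eqP : ((y - x) * v = (y - x) * u)%N by lia.
by rewrite eqn_pmul2l ?subn_gt0 // => /eqP.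
Qed.

(** * Solutions of [b . k = n] with a small entry or with a second equation *)

Section linear_forms.
Variables (R : realType) (h : nat) (b : nat -> nat).
Hypothesis h2 : (2 <= h)%N.
Hypothesis b0 : forall i, (i < h)%N -> (0 < b i)%N.
Local Notation hroot := (@hroot R h).
Local Notation hrootm := (@hrootm R h).
Local Notation rho := (@rho R h).
Local Notation wgt := (@wgt R h).
Local Notation wgt1 := (@wgt1 R h).

Definition bsum : nat := (\sum_(i < h) b i)%N.
Definition dot (M : nat) (k : {ffun 'I_h -> 'I_M}) : nat := (\sum_(i < h) b i * k i)%N.
(** A solution of [b . k = n] with [n > 0] has an entry at least [n / Lc]. *)
Definition Lc : nat := (h * bsum)%N.

Lemma b_gt0 (i : 'I_h) : (0 < b i)%N. Proof. exact: b0. Qed.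

Lemma b_le_bsum (i : 'I_h) : (b i <= bsum)%N.
Proof. by rewrite /bsum (bigD1 i) //= leq_addr. Qed.

Lemma lin_split1 M (beta : 'I_h -> nat) (k : {ffun 'I_h -> 'I_M}) i :
  (\sum_l beta l * k l = beta i * k i + \sum_(l | l != i) beta l * k l)%N.
Proof. exact: bigD1. Qed.

Lemma lin_split2 M (beta : 'I_h -> nat) (k : {ffun 'I_h -> 'I_M}) i j : j != i ->
  (\sum_l beta l * k l = beta i * k i + beta j * k j +
     \sum_(l | (l != i) && (l != j)) beta l * k l)%N.
Proof. by move=> ji; rewrite (bigD1 i) //= (bigD1 j) //= addnA. Qed.

Lemma Lc_gt0 : (0 < Lc)%N.
Proof.
have h0 : (0 < h)%N by lia.
by have := b_le_bsum (Ordinal h0); have := b_gt0 (Ordinal h0); rewrite /Lc; nia.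
Qed.

Lemma le_dot M (k : {ffun 'I_h -> 'I_M}) i : (k i <= dot k)%N.
Proof. by rewrite /dot (bigD1 i) //=; have := b_gt0 i; nia. Qed.

Lemma sum_le_dot_max M (D : pred {ffun 'I_h -> 'I_M.+1}) n (G : {ffun 'I_h -> 'I_M.+1} -> R) :
  (0 < n)%N -> (forall k, 0 <= G k) -> (forall k, D k -> dot k = n) ->
  \sum_(k | D k) G k <= \sum_i \sum_(k | D k && (n <= Lc * k i)%N) G k.
Proof.
move=> n0 G0 Dn.
have := @sum_le_sum_max R 'I_h M D [set: 'I_h]%SET b bsum Lc n G n0.
move=> /(_ (fun i _ => b_le_bsum i)); rewrite cardsT card_ord => /(_ (leqnn _) G0) H.
apply: le_trans (H _) _.
  by move=> k /Dn <-; apply: eq_bigl => i; rewrite inE.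
by rewrite le_eqVlt; apply/orP; left; apply/eqP; apply: eq_bigl => i; rewrite inE.
Qed.

Definition K2 : R := h%:R * (h%:R * Lc%:R * Lc%:R * (1 + h%:R) ^+ h).

Lemma K2_ge0 : 0 <= K2.
Proof. by rewrite !mulr_ge0 // exprn_ge0 // addr_ge0. Qed.

(** The entry [i0] sums to [O(y^(1/h))] in place of [O(n^(1/h))], while all other entries behave as
    in the unrestricted count, which is bounded. *)
Lemma sum_cut_le M n y (i0 : 'I_h) : (0 < n)%N -> (0 < y)%N ->
  \sum_(k : {ffun 'I_h -> 'I_M.+1} | (dot k == n) && (k i0 <= y)%N)
     \prod_i wgt1 (k i) <= K2 * hroot y%:R / hroot n%:R.
Proof.
move=> n0 y0.
have rn0 : 0 < hroot n%:R by rewrite hroot_gt0 // ltr0n.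
have ry0 : 0 < hroot y%:R by rewrite hroot_gt0 // ltr0n.
have Lc1 : 1 <= Lc%:R :> R by rewrite ler1n Lc_gt0.
have G0 (k : {ffun 'I_h -> 'I_M.+1}) : 0 <= \prod_i wgt1 (k i).
  by apply: prodr_ge0 => i _; exact: wgt1_ge0.
apply: le_trans (sum_le_dot_max n0 G0 _) _; first by move=> k /andP[/eqP].
rewrite /K2 -!mulrA mulr_natl -[X in _ *+ X](card_ord h) -sumr_const.
apply: ler_sum => i _.
pose cut (j : 'I_h) := if j == i0 then y else n.
have cut0 j : (0 < cut j)%N by rewrite /cut; case: ifP.
pose g (j : 'I_h) (x : 'I_M.+1) : R := if (x <= cut j)%N then wgt1 x else 0.
have g0 j x : 0 <= g j x by rewrite /g; case: ifP => // _; exact: wgt1_ge0.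
(* If the large entry is [i0] itself and [Lc y < n], the two size conditions contradict each other
   and the sum is empty. *)
have [nLy|nLy] := boolP ((i == i0) && (Lc * y < n)%N).
  rewrite big_pred0 ?mulr_ge0 ?invr_ge0 ?exprn_ge0 ?addr_ge0 ?hroot_ge0 //.
  move=> k; apply/negbTE/negP => /andP[/andP[_ ky]].
  case/andP: nLy => /eqP -> lt le.
  by have := leq_trans lt (leq_trans le (leq_mul (leqnn Lc) ky)); rewrite ltnn.
have rt0 : 0 <= h%:R * Lc%:R * rho n%:R by rewrite mulr_ge0 // rho_ge0.
apply: (@le_trans _ _ (\sum_(k : {ffun 'I_h -> 'I_M.+1} | (dot k == n) && (k i0 <= y)%N && (n <= Lc * k i)%N)
   h%:R * Lc%:R * rho n%:R * \prod_(j | j != i) g j (k j))).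
  apply: ler_sum => k /andP[/andP[/eqP kn ky] nk]; rewrite (bigD1 i) //=.
  apply: ler_pM; rewrite ?wgt1_ge0 ?wgt1_le_rho //.
    by apply: prodr_ge0 => j _; exact: wgt1_ge0.
  apply: ler_prod => j _; rewrite wgt1_ge0 //= /g /cut.
  by case: eqP => [->|_]; rewrite ifT // -kn le_dot.
rewrite -mulr_sumr.
have H : \sum_(k : {ffun 'I_h -> 'I_M.+1} | (dot k == n) && (k i0 <= y)%N && (n <= Lc * k i)%N)
      \prod_(j | j != i) g j (k j) <= \prod_(j | j != i) ((1 + h%:R) * hroot (cut j)%:R).
  apply: le_trans (@sum_determined_le _ _ _ ord0 _ _ g g0 _) _.
    move=> k k' /andP[/andP[/eqP kn _] _] /andP[/andP[/eqP kn' _] _] kk'.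
    apply/ffunP => j; have [->|ji] := eqVneq j i; last exact: kk'.
    move: kn; rewrite -kn' /dot !(lin_split1 _ _ i).
    rewrite (eq_bigr (fun l : 'I_h => b l * k' l)%N); last by move=> l lJ; rewrite kk'.
    move=> /addIn/eqP.
    by rewrite eqn_pmul2l ?b_gt0 // => /eqP; exact: val_inj.
  apply: ler_prod => j _; rewrite sumr_ge0 //=.
  exact: sum_wgt1_cut.
apply: le_trans (ler_wpM2l rt0 H) _.
set X := \prod_(j | _) _.
(* Inserting the missing factor for [i] turns the product into one over all positions, which does
   not depend on the place of [i]. *)
have XE : X * ((1 + h%:R) * hroot (cut i)%:R) =
    (1 + h%:R) ^+ h * (hroot y%:R * hroot n%:R ^+ h.-1).
  have -> : X * ((1 + h%:R) * hroot (cut i)%:R) = \prod_j ((1 + h%:R) * hroot (cut j)%:R).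
    by rewrite [RHS](bigD1 i) //= mulrC.
  rewrite big_split /= prodr_const card_ord; congr (_ * _).
  rewrite (bigD1 i0) //= {1}/cut eqxx; congr (_ * _).
  rewrite (eq_bigr (fun=> hroot n%:R)); last by move=> j /negbTE; rewrite /cut => ->.
  by rewrite prodr_const cardC1 card_ord.
have nR : 0 < n%:R :> R by rewrite ltr0n.
have nE : n%:R = hroot n%:R * hroot n%:R ^+ h.-1.
  by rewrite -exprS prednK ?hroot_exp //; lia.
have h1 : 1 <= 1 + h%:R :> R by rewrite lerDl.
have X0 : 0 <= X.
  by apply: prodr_ge0 => j _; rewrite mulr_ge0 ?hroot_ge0 ?addr_ge0.
have XL : X * hroot (cut i)%:R <= (1 + h%:R) ^+ h * (hroot y%:R * hroot n%:R ^+ h.-1).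
  rewrite -XE; apply: ler_wpM2l => //; apply: ler_peMl => //; exact: hroot_ge0.
(* The inserted factor is comparable to [n^(1/h)]: either [cut i = n], or [i = i0] and then
   [n <= Lc y]. *)
have key : hroot n%:R <= Lc%:R * hroot (cut i)%:R.
  rewrite /cut; case: eqP nLy => [_ | _ _] /=.
    rewrite -leqNgt => nLy; apply: le_trans (_ : hroot (Lc * y)%:R <= _).
      by rewrite le_hroot // ler_nat.
    by rewrite natrM hrootM // ler_wpM2r ?hroot_ge0 // hroot_le.
  by rewrite ler_peMl // hroot_ge0.
have -> : h%:R * Lc%:R * rho n%:R * X = h%:R * (Lc%:R * (X * hroot n%:R / n%:R)).
  by rewrite /rho; ring.
rewrite -!mulrA; apply: ler_wpM2l => //; apply: ler_wpM2l => //.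
rewrite mulrA ler_pdivrMr //.
apply: le_trans (ler_wpM2l X0 key) _.
rewrite mulrCA -!mulrA; apply: ler_wpM2l => //.
apply: le_trans XL _; move: nE rn0; set rn := hroot n%:R => nE rn0; rewrite nE.
rewrite le_eqVlt; apply/orP; left; apply/eqP.
by field; rewrite gt_eqF.
Qed.

Definition K3 : R := h%:R * (h%:R * h%:R * Lc%:R * (1 + h%:R) ^+ h).

Lemma K3_ge0 : 0 <= K3.
Proof. by rewrite !mulr_ge0 // exprn_ge0 // addr_ge0. Qed.

(** Let [i] be the large entry and [j] an index with nonzero minor. The two equations recover [k i]
    and [k j] from the other [h - 2] entries, which gives [n^(1/h-1) n^((h-2)/h) = n^(-1/h)]. Since
    [i] is not known beforehand, every [i] must have such a [j]. *)
Lemma sum_two_eq_le M n s (beta : 'I_h -> nat) : (0 < n)%N ->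
  (forall i : 'I_h, exists j : 'I_h, (b i * beta j != b j * beta i)%N) ->
  \sum_(k : {ffun 'I_h -> 'I_M.+1} | (dot k == n) && ((\sum_i beta i * k i)%N == s))
     \prod_i wgt1 (k i) <= K3 / hroot n%:R.
Proof.
move=> n0 indep.
have rn0 : 0 < hroot n%:R by rewrite hroot_gt0 // ltr0n.
have rn1 : 1 <= hroot n%:R by rewrite hroot_ge1 // ler1n.
have nR : 0 < n%:R :> R by rewrite ltr0n.
have h1 : 1 <= 1 + h%:R :> R by rewrite lerDl.
have G0 (k : {ffun 'I_h -> 'I_M.+1}) : 0 <= \prod_i wgt1 (k i).
  by apply: prodr_ge0 => i _; exact: wgt1_ge0.
apply: le_trans (sum_le_dot_max n0 G0 _) _; first by move=> k /andP[/eqP].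
rewrite /K3 -mulrA mulr_natl -[X in _ *+ X](card_ord h) -sumr_const.
apply: ler_sum => i _.
have [j bij] := indep i.
have ji : j != i by apply: contraNneq bij => ->.
pose g (j : 'I_h) (x : 'I_M.+1) : R := if (x <= n)%N then wgt1 x else 0.
have g0 l x : 0 <= g l x by rewrite /g; case: ifP => // _; exact: wgt1_ge0.
have rt0 : 0 <= h%:R * Lc%:R * rho n%:R by rewrite mulr_ge0 // rho_ge0.
have rt1 : 0 <= h%:R * Lc%:R * rho n%:R * h%:R by rewrite mulr_ge0.
apply: (@le_trans _ _ (\sum_(k : {ffun 'I_h -> 'I_M.+1} | (dot k == n) &&
    ((\sum_i beta i * k i)%N == s) && (n <= Lc * k i)%N)
   h%:R * Lc%:R * rho n%:R * h%:R * \prod_(l | (l != i) && (l != j)) g l (k l))).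
  apply: ler_sum => k /andP[/andP[/eqP kn _] nk].
  rewrite (bigD1 i) //= (bigD1 j) //= mulrA.
  apply: ler_pM.
  - by rewrite mulr_ge0 ?wgt1_ge0.
  - by apply: prodr_ge0 => l _; exact: wgt1_ge0.
  - by apply: ler_pM; rewrite ?wgt1_ge0 ?wgt1_le_rho ?wgt1_le.
  - by apply: ler_prod => l _; rewrite wgt1_ge0 //= /g ifT // -kn le_dot.
rewrite -mulr_sumr.
have H : \sum_(k : {ffun 'I_h -> 'I_M.+1} | (dot k == n) &&
    ((\sum_i beta i * k i)%N == s) && (n <= Lc * k i)%N)
      \prod_(l | (l != i) && (l != j)) g l (k l) <=
    ((1 + h%:R) * hroot n%:R) ^+ (h - 2).
  apply: le_trans (@sum_determined_le _ _ _ ord0 _ _ g g0 _) _.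
    move=> k k' /andP[/andP[/eqP kn /eqP ks] _] /andP[/andP[/eqP kn' /eqP ks'] _] kk'.
    have E1 : (b i * k i + b j * k j = b i * k' i + b j * k' j)%N.
      move: kn; rewrite -kn' /dot !(lin_split2 _ _ ji) => /eqP; rewrite (eq_bigr (fun l : 'I_h => b l * k' l)%N).
        by rewrite eqn_add2r => /eqP.
      by move=> l lJ; rewrite kk'.
    have E2 : (beta i * k i + beta j * k j = beta i * k' i + beta j * k' j)%N.
      move: ks; rewrite -ks' !(lin_split2 _ _ ji) => /eqP; rewrite (eq_bigr (fun l : 'I_h => beta l * k' l)%N).
        by rewrite eqn_add2r => /eqP.
      by move=> l lJ; rewrite kk'.
    have [Ei Ej] : (k i = k' i :> nat) /\ (k j = k' j :> nat).
      move: E1 E2 bij; set u := nat_of_ord (k i); set v := nat_of_ord (k j).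
      set u' := nat_of_ord (k' i); set v' := nat_of_ord (k' j) => E1 E2 bij.
      have F1 := congr1 (muln (beta j)) E1; have F2 := congr1 (muln (b j)) E2.
      have F3 := congr1 (muln (beta i)) E1; have F4 := congr1 (muln (b i)) E2.
      split; apply: (@nat_cross (b i * beta j) (b j * beta i)) => //; lia.
    apply/ffunP => l; have [->|li] := eqVneq l i; first exact: val_inj.
    have [->|lj] := eqVneq l j; first exact: val_inj.
    by apply: kk'; rewrite li.
  have -> : (h - 2 = #|[pred l : 'I_h | (l != i) && (l != j)]|)%N.
    have := cardC [pred l : 'I_h | (l != i) && (l != j)]; rewrite card_ord.
    have -> : #|[predC [pred l : 'I_h | (l != i) && (l != j)]]| = 2%N.
      rewrite (eq_card (B := pred2 i j)) ?card2 1?eq_sym ?ji // => l.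
      by rewrite !inE negb_and !negbK.
    by move=> E; rewrite -[X in (X - 2)%N]E addnK.
  rewrite -prodr_const; apply: ler_prod => l _; rewrite sumr_ge0 //=.
  exact: sum_wgt1_cut.
apply: le_trans (ler_wpM2l rt1 H) _.
rewrite -(exp_hroot R h2 n0) exprMn /rho.
have -> : h%:R * Lc%:R * (hroot n%:R / n%:R) * h%:R * ((1 + h%:R) ^+ (h - 2) * hroot n%:R ^+ (h - 2)) =
    h%:R * h%:R * Lc%:R * (1 + h%:R) ^+ (h - 2) * (hroot n%:R ^+ h.-1 / n%:R) :> R.
  have -> : h.-1 = (h - 2).+1 by lia.
  by rewrite exprS; ring.
rewrite ler_wpM2r ?divr_ge0 ?exprn_ge0 ?hroot_ge0 //.
rewrite ler_wpM2l //.
by rewrite ler_weXn2l //; lia.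
Qed.

End linear_forms.

(** * Overlapping pairs of solutions *)

Section codes.
Variables (R : realType) (h : nat) (b : nat -> nat).
Hypothesis h2 : (2 <= h)%N.
Hypothesis b0 : forall i, (i < h)%N -> (0 < b i)%N.
Local Notation hroot := (@hroot R h).
Local Notation hrootm := (@hrootm R h).
Local Notation wgt1 := (@wgt1 R h).
Local Notation dot := (@dot h b _).
Local Notation Lc := (Lc h b).
Local Notation K1 := (K1 R h Lc).
Local Notation K3 := (K3 R h b).

(** A tuple with repeated entries involves fewer coins, so probabilities and weights of
    representations are attached to the set of values. *)
Definition img (I : finType) M (k : {ffun I -> 'I_M}) : {set 'I_M} :=
  finset (fun v => [exists i, k i == v]).

Lemma imgP (I : finType) M (k : {ffun I -> 'I_M}) v :
  reflect (exists i, k i = v) (v \in img k).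
Proof. by rewrite inE; apply: (iffP existsP) => -[i /eqP]; exists i => //; apply/eqP. Qed.

Lemma mem_img (I : finType) M (k : {ffun I -> 'I_M}) i : k i \in img k.
Proof. by apply/imgP; exists i. Qed.

Lemma img_imset M (k : {ffun 'I_h -> 'I_M}) : img k = k @: 'I_h.
Proof. by apply/setP => v; apply/imgP/imsetP => [[i <-]|[i _ ->]]; exists i. Qed.

Lemma card_img M (k : {ffun 'I_h -> 'I_M}) : (#|img k| <= h)%N.
Proof. by rewrite img_imset (leq_trans (leq_imset_card _ _)) // card_ord. Qed.

Definition omega M (X : {set 'I_M}) : R := \prod_(x in X) wgt1 x.

Lemma omega_ge0 M (X : {set 'I_M}) : 0 <= omega X.
Proof. by apply: prodr_ge0 => i _; exact: wgt1_ge0. Qed.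

Lemma omegaU M (X Y : {set 'I_M}) : omega (X :|: Y) = omega X * omega (Y :\: X).
Proof.
rewrite /omega (big_setID X) /=; congr (_ * _); apply: eq_bigl => i; rewrite !inE;
  by do 2 case: (i \in _).
Qed.

Lemma omega_img_inj M (k : {ffun 'I_h -> 'I_M}) : injective k ->
  omega (img k) = \prod_i wgt1 (k i).
Proof.
by move=> kinj; rewrite img_imset /omega big_imset //= => i j _ _; exact: kinj.
Qed.

(* A code records which entries of [q] are entries of [k], and which entries of
   [q] are equal; together with [k] and the entries at the free positions it
   determines [q]. *)
Section one_code.
Variables (I : finType) (M : nat).
Implicit Types (k : {ffun I -> 'I_M}) (q : {ffun 'I_h -> 'I_M}).
Implicit Types (c : {ffun 'I_h -> I + 'I_h}).

(** The choice depends only on the value [q j], so equal entries of [q] share one representative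
    position. *)
Definition rep q (j : 'I_h) : 'I_h := odflt j [pick l | q l == q j].

Definition code k q : {ffun 'I_h -> I + 'I_h} :=
  [ffun j => if [pick i | k i == q j] is Some i then inl i else inr (rep q j)].

(** Representatives of the entries of [q] outside [k] are the positions that code themselves. *)
Definition free c : {set 'I_h} := finset (fun j => c j == inr j).
(** After substituting the code into [b . q], the entry [k i] carries the coefficient [lcoef c i]
    and the free entry [q l] the coefficient [rcoef c l]. *)
Definition lcoef c (i : I) : nat := (\sum_(j | c j == inl i) b j)%N.
Definition rcoef c (l : 'I_h) : nat := (\sum_(j | c j == inr l) b j)%N.

Lemma rep_eq q j : q (rep q j) = q j.
Proof. by rewrite /rep; case: pickP => [l /eqP|/(_ j)]; rewrite ?eqxx. Qed.

Lemma eq_rep q j l : q j = q l -> rep q j = rep q l.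
Proof.
move=> jl; rewrite /rep (eq_pick (Q := fun i => q i == q l)); last by move=> i; rewrite jl.
by case: pickP => // /(_ l); rewrite eqxx.
Qed.

Lemma code_inl k q j i : code k q j = inl i -> k i = q j.
Proof. by rewrite ffunE; case: pickP => // i' /eqP <- [<-]. Qed.

Lemma code_inr k q j l : code k q j = inr l ->
  [/\ q l = q j, code k q l = inr l, l = rep q j & q j \notin img k].
Proof.
rewrite !ffunE; case: pickP => // Hj [<-]; split=> //; first exact: rep_eq.
  case: pickP => [i|_]; first by rewrite rep_eq Hj.
  by congr inr; apply: eq_rep; rewrite rep_eq.
by apply/imgP => -[i ki]; have := Hj i; rewrite ki eqxx.
Qed.

Lemma free_img k q : img q :\: img k = q @: free (code k q).
Proof.
apply/setP => v; rewrite finset.in_setD; apply/andP/imsetP => [[vk /imgP[j jv]]|[j]].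
  case E : (code k q j) => [i|l].
    by move: vk; rewrite -jv -(code_inl E) mem_img.
  by have [kl cl _ _] := code_inr E; exists l; rewrite ?inE ?cl // kl jv.
rewrite inE => /eqP /code_inr[_ _ _ kj] ->; split=> //; exact: mem_img.
Qed.

Lemma free_inj k q : {in free (code k q) &, injective q}.
Proof.
move=> j l; rewrite !inE => /eqP /code_inr[_ _ rj _] /eqP/code_inr[_ _ rl _] jl.
by rewrite rj rl; exact: eq_rep.
Qed.

Lemma omega_free k q :
  omega (img q :\: img k) = \prod_(j in free (code k q)) wgt1 (q j).
Proof. by rewrite free_img /omega big_imset //; exact: free_inj. Qed.

Lemma dot_code k q c : code k q = c ->
  dot q = (\sum_i lcoef c i * k i + \sum_(l in free c) rcoef c l * q l)%N.
Proof.
move=> <-; set c' := code k q.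
under [X in (X + _)%N]eq_bigr => i _ do rewrite /lcoef big_distrl /= big_mkcond /=.
under [X in (_ + X)%N]eq_bigr => l _ do rewrite /rcoef big_distrl /= big_mkcond /=.
rewrite exchange_big /= [X in (_ + X)%N]exchange_big /= -big_split /=.
apply: eq_bigr => j _; case E : (c' j) => [i|l].
  rewrite (bigD1 i) //= eqxx (code_inl E) big1 => [|i' /negbTE ii'].
    by rewrite addn0 big1 ?addn0.
  by rewrite (_ : inl i == inl i' = false) // -ii'; apply/eqP/eqP => [[->]|->].
rewrite big1 //= add0n; have [kl cl _ _] := code_inr E.
rewrite (bigD1 l) /=; last by rewrite inE cl.
rewrite eqxx kl big1 ?addn0 // => i' /andP[_ /negbTE ii'].
by rewrite (_ : inr l == inr i' = false) // -ii'; apply/eqP/eqP => [[->]|->].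
Qed.

Lemma card_free c : (#|free c| <= h)%N.
Proof. by rewrite -[X in (_ <= X)%N](card_ord h) max_card. Qed.

End one_code.

(** For fixed [k] and [c] the free entries of [q] solve a linear equation with value
    [m - sum lcoef k] and determine [q]. *)
Lemma sum_code_le (I : finType) (M m : nat) (k : {ffun I -> 'I_M.+1})
    (c : {ffun 'I_h -> I + 'I_h}) :
  \sum_(q | (dot q == m) && (code k q == c)) omega (img q :\: img k) <=
  if (#|free c| < h)%N then K1 / hrootm (m - \sum_i lcoef c i * k i) else K1.
Proof.
rewrite (eq_bigr (fun q : {ffun 'I_h -> 'I_M.+1} => \prod_(j in free c) wgt1 (q j))); last first.
  by move=> q /andP[_ /eqP <-]; exact: omega_free.
apply: (@sum_wgt1_le _ _ h2 _ _ _ _ (rcoef c) (bsum h b)).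
- exact: Lc_gt0.
- move=> l; rewrite inE => cl; apply/andP; split.
    by rewrite /rcoef (bigD1 l) //= addn_gt0 b0.
  rewrite /bsum /rcoef big_mkcond; apply: leq_sum => j _; by case: ifP.
- by rewrite leq_mul2r card_free orbT.
(* The subtraction is truncated, but any [q] in the sum certifies that [m] is at least the amount
   subtracted. *)
- by move=> q /andP[/eqP <- /eqP /dot_code ->]; rewrite addKn.
- move=> k1 k2 /andP[_ /eqP c1] /andP[_ /eqP c2] k12; apply/ffunP => j.
  case E : (c j) => [i|l].
    have E1 : code k k1 j = inl i by rewrite c1.
    have E2 : code k k2 j = inl i by rewrite c2.
    by rewrite -(code_inl E1) -(code_inl E2).
  have E1 : code k k1 j = inr l by rewrite c1.
  have E2 : code k k2 j = inr l by rewrite c2.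
  have [<- cl _ _] := code_inr E1; have [<- _ _ _] := code_inr E2.
  by apply: k12; rewrite inE -{1}c1 cl.
- exact: card_free.
Qed.

Lemma K1_gt0 : 0 < K1.
Proof. by apply: lt_le_trans (K1_ge1 R h2 _) => //; exact: Lc_gt0. Qed.

Lemma div_hrootm_le a t : 0 <= a -> a / hrootm t <= a.
Proof.
move=> a0; rewrite ler_pdivrMr ?hrootm_gt0 // ler_peMr //; exact: hrootm_ge1.
Qed.

Lemma sum_ext_le (I : finType) (M m : nat) (k : {ffun I -> 'I_M.+1}) :
  \sum_(q | dot q == m) omega (img q :\: img k) <=
  #|{ffun 'I_h -> I + 'I_h}|%:R * K1.
Proof.
rewrite (partition_big (code k) xpredT) //= mulr_natl -sumr_const.
apply: ler_sum => c _; apply: le_trans (sum_code_le _ _ _) _.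
by case: ifP => // _; apply: div_hrootm_le; exact: ltW K1_gt0.
Qed.

(** Codes relative to the empty tuple record only the coincidences inside [q]; they yield the bounds
    for single tuples. *)
Definition Nc0 : R := #|{ffun 'I_h -> 'I_0 + 'I_h}|%:R.
Definition Nc : R := #|{ffun 'I_h -> 'I_h + 'I_h}|%:R.

Lemma img_void M (k : {ffun 'I_0 -> 'I_M}) (X : {set 'I_M}) : X :\: img k = X.
Proof.
apply/setP => v; rewrite finset.in_setD; case: (imgP k v) => // -[[]//].
Qed.

Lemma sum_omega_le (M m : nat) :
  \sum_(q : {ffun 'I_h -> 'I_M.+1} | dot q == m) omega (img q) <= Nc0 * K1.
Proof.
have := @sum_ext_le 'I_0 M m [ffun => ord0].
by under eq_bigr do rewrite img_void.
Qed.

Lemma code_free_full (I : finType) M (k : {ffun I -> 'I_M}) (q : {ffun 'I_h -> 'I_M}) :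
  (#|free (code k q)| < h)%N = false -> injective q.
Proof.
move=> /negbT; rewrite -leqNgt => H.
have /eqP full : free (code k q) == [set: 'I_h]%SET.
  by rewrite eqEcard finset.subsetT cardsT card_ord.
by move=> i j; apply: (@free_inj _ _ k); rewrite full inE.
Qed.

(** A repeated entry leaves fewer than [h] free positions, which saves a factor [m^(1/h)]. *)
Lemma sum_omega_noninj_le (M m : nat) :
  \sum_(q : {ffun 'I_h -> 'I_M.+1} | (dot q == m) && ~~ injectiveb q) omega (img q)
  <= Nc0 * K1 / hrootm m.
Proof.
pose k0 : {ffun 'I_0 -> 'I_M.+1} := [ffun => ord0].
rewrite (partition_big (code k0) xpredT) //= -mulrA mulr_natl -sumr_const.
apply: ler_sum => c _.
have [cf|cf] := boolP (#|free c| < h)%N; last first.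
  rewrite big_pred0 ?divr_ge0 ?(ltW K1_gt0) ?(ltW (hrootm_gt0 _ _ _)) // => q.
  apply/negbTE/negP => /andP[/andP[_ /negP ni] /eqP cE]; apply: ni.
  by apply/injectiveP; apply: (@code_free_full _ _ k0); rewrite cE; exact/negbTE.
have := @sum_code_le _ _ m k0 c; rewrite cf big_ord0 subn0; apply: le_trans.
under [leRHS]eq_bigr do rewrite img_void.
rewrite big_mkcond [leRHS]big_mkcond; apply: ler_sum => q _.
by case: (_ == m); case: (_ == c); rewrite ?andbF ?andbT //=; case: ifP => // _; exact: omega_ge0.
Qed.

(** The vector [lcoef c] is not proportional to [b], in the form required by [sum_two_eq_le]. *)
Definition indep (c : {ffun 'I_h -> 'I_h + 'I_h}) : bool :=
  [forall i : 'I_h, exists j : 'I_h, b i * lcoef c j != b j * lcoef c i]%N.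

(** A shared entry makes some [lcoef] positive and some position not free. If [lcoef] were
    proportional to [b], all its values would be positive, so every entry of [k] would be used by
    some position of [q]; by counting, the code is then a bijection between positions. Hence
    [lcoef = b], and both tuples have the same sum and the same entries. *)
Lemma code_indep M (k q : {ffun 'I_h -> 'I_M}) :
  ~~ [disjoint img k & img q]%B ->
  (dot k != dot q) || (img k != img q) ->
  (#|free (code k q)| < h)%N && indep (code k q).
Proof.
move=> /pred0Pn[v /andP[/= /imgP[i0 ki0] /imgP[j0 kj0]]] ne.
set c := code k q.
have [i1 ci1] : exists i1, c j0 = inl i1.
  case E : (c j0) => [i1|l]; first by exists i1.
  by have [_ _ _] := code_inr E; rewrite kj0 -ki0 mem_img.
apply/andP; split.
  rewrite -[X in (_ < X)%N](card_ord h) -cardsT; apply: proper_card.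
  rewrite finset.properT; apply/eqP => /setP /(_ j0).
  by rewrite !inE ci1.
apply: contraT; rewrite negb_forall => /existsP[i].
rewrite negb_exists => /forallP bad0.
have bad j : (b i * lcoef c j = b j * lcoef c i)%N by apply/eqP; move: (bad0 j); rewrite negbK.
have bi := b0 (ltn_ord i).
have ci1_gt0 : (0 < lcoef c i1)%N.
  by rewrite /lcoef (bigD1 j0) /= ?ci1 // addn_gt0 b0.
have ci_gt0 : (0 < lcoef c i)%N.
  by have := bad i1; have := b0 (ltn_ord i1); nia.
have onto j : exists l, c l = inl j.
  have cj : (0 < lcoef c j)%N by have := bad j; have := b0 (ltn_ord j); nia.
  apply: contrapT => H; move: cj; rewrite /lcoef big_pred0 // => l.
  by apply/negbTE/negP => /eqP cl; apply: H; exists l.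
have [g gE] := fin_all_exists onto.
have g_inj : injective g by move=> x y xy; have := gE x; rewrite xy gE => -[].
have all_inl l : exists j, c l = inl j.
  by have [g' _ gg'] := injF_bij g_inj; exists (g' l); rewrite -{1}(gg' l) gE.
have free0 : free c = finset (fun=> false).
  by apply/setP => l; rewrite !inE; have [j ->] := all_inl l.
have sumE : (\sum_j lcoef c j = bsum h b)%N.
  rewrite /lcoef /bsum; under eq_bigr do rewrite big_mkcond /=.
  rewrite exchange_big /=; apply: eq_bigr => l _.
  have [j cl] := all_inl l; rewrite (bigD1 j) //= cl eqxx big1 ?addn0 // => j' /negbTE jj'.
  by rewrite (_ : inl j == inl j' = false) // -jj'; apply/eqP/eqP => [[->]|->].
(* The proportionality factor is 1, since both vectors have the same total. *)
have bci : b i = lcoef c i.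
  have : (b i * bsum h b = lcoef c i * bsum h b)%N.
    rewrite -{1}sumE /bsum !big_distrr /=; apply: eq_bigr => j _.
    by rewrite bad mulnC.
  have bs : (0 < bsum h b)%N by apply: leq_trans (b_le_bsum b i).
  by move/eqP; rewrite eqn_pmul2r // => /eqP.
have bc j : lcoef c j = b j.
  by have /eqP := bad j; rewrite -bci mulnC eqn_pmul2r // => /eqP.
have nm : dot k = dot q.
  rewrite (dot_code (erefl (code k q))) -/c free0 [X in (_ + X)%N]big_pred0 ?addn0; last by move=> l; rewrite inE.
  by apply: eq_bigr => j _; rewrite bc.
have iE : img k = img q.
  apply/setP => x; apply/imgP/imgP => [[j <-]|[l <-]].
    by exists (g j); rewrite (code_inl (gE j)).
  by have [j cl] := all_inl l; exists j; exact: code_inl cl.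
by move: ne; rewrite nm iE !eqxx.
Qed.

Definition K4 : R := Nc * K1 * (Nc0 * K1 + K3).

Lemma K4_ge0 : 0 <= K4.
Proof.
have K10 := ltW K1_gt0.
by rewrite !mulr_ge0 // addr_ge0 ?K3_ge0 // mulr_ge0.
Qed.

(** Either the value [m - sum lcoef k] left for the free entries is at least [tau], and its size
    gives the saving, or it is one of the [tau] values below [tau], and then [k] satisfies a second,
    independent equation. Injectivity makes [omega (img k)] the product of the weights of the
    entries. *)
Lemma sum_code_pairs_le M n m tau (c : {ffun 'I_h -> 'I_h + 'I_h}) :
  (0 < n)%N -> (0 < tau)%N -> indep c ->
  \sum_(k : {ffun 'I_h -> 'I_M.+1} | (dot k == n) && injectiveb k)
    omega (img k) * (if (\sum_i lcoef c i * k i <= m)%N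
                     then (hrootm (m - \sum_i lcoef c i * k i))^-1 else 0)
  <= Nc0 * K1 / hrootm tau + tau%:R * (K3 / hroot n%:R).
Proof.
move=> n0 tau0 /forallP ind; pose s (k : {ffun 'I_h -> 'I_M.+1}) := (\sum_i lcoef c i * k i)%N.
have ind' (i : 'I_h) : exists j : 'I_h, (b i * lcoef c j != b j * lcoef c i)%N by exact/existsP.
apply: (@le_trans _ _ (\sum_(k : {ffun 'I_h -> 'I_M.+1} | (dot k == n) && injectiveb k)
    (omega (img k) / hrootm tau + \sum_(t < tau) (if s k == (m - t)%N then omega (img k) else 0)))).
  apply: ler_sum => k _; rewrite -/(s k).
  have rhs0 : 0 <= \sum_(t < tau) (if s k == (m - t)%N then omega (img k) else 0).
    by apply: sumr_ge0 => t _; case: ifP => // _; exact: omega_ge0.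
  have rhs1 : 0 <= omega (img k) / hrootm tau.
    by rewrite divr_ge0 ?omega_ge0 // ltW // hrootm_gt0.
  case: ifP => sm; last by rewrite mulr0 addr_ge0.
  have [tm|tm] := leqP tau (m - s k).
    rewrite -[leLHS]addr0 lerD // ler_wpM2l ?omega_ge0 //.
    rewrite lef_pV2 ?posrE ?hrootm_gt0 // /hrootm le_hroot // ler_nat.
    by rewrite geq_max leq_maxl /= (leq_trans tm) // leq_maxr.
  rewrite -[leLHS]add0r lerD // (bigD1 (Ordinal tm)) //= subKn // eqxx.
  rewrite -[leLHS]addr0 lerD //.
    by apply: div_hrootm_le; exact: omega_ge0.
  by apply: sumr_ge0 => t _; case: ifP => // _; exact: omega_ge0.
rewrite big_split /= -mulr_suml; apply: lerD.
  rewrite ler_wpM2r ?invr_ge0 ?(ltW (hrootm_gt0 _ _ _)) //.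
  apply: le_trans (sum_omega_le M n).
  rewrite big_mkcond [leRHS]big_mkcond; apply: ler_sum => k _.
  by case: (_ == n); case: injectiveb => //=; exact: omega_ge0.
rewrite exchange_big /= mulr_natl -[X in _ *+ X](card_ord tau) -sumr_const.
apply: ler_sum => t _.
apply: le_trans (sum_two_eq_le R h2 b0 M (m - t)%N n0 ind').
rewrite -big_mkcondr big_mkcond [leRHS]big_mkcond; apply: ler_sum => k _.
case: (_ == n); rewrite /= ?lexx //; case: injectiveP => /= [kinj|_].
  by rewrite /s; case: ifP => // _; rewrite omega_img_inj.
by case: ifP => // _; apply: prodr_ge0 => i _; exact: wgt1_ge0.
Qed.

(** For injective [k] the pairs are sorted by code. For the other [k] the coincidence already saves
    [n^(1/h)], and the sum over [q] is merely bounded. *)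
Lemma sum_pairs_le M n m tau : (0 < n)%N -> (0 < tau)%N ->
  \sum_(k : {ffun 'I_h -> 'I_M.+1} | dot k == n)
  \sum_(q : {ffun 'I_h -> 'I_M.+1} | [&& dot q == m, ~~ [disjoint img k & img q]%B &
           (n != m) || (img k != img q)])
    omega (img k :|: img q)
  <= K4 * ((hrootm tau)^-1 + tau%:R / hroot n%:R).
Proof.
move=> n0 tau0; have K10 := K1_gt0.
have rn0 : 0 < hroot n%:R by rewrite hroot_gt0 // ltr0n.
have K30 := K3_ge0 R h b.
under eq_bigr => k _ do under eq_bigr => q _ do rewrite omegaU.
under eq_bigr => k _ do rewrite -mulr_sumr.
rewrite (bigID (fun k : {ffun 'I_h -> 'I_M.+1} => injectiveb k)) /=.
pose s (c : {ffun 'I_h -> 'I_h + 'I_h}) (k : {ffun 'I_h -> 'I_M.+1}) :=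
  (\sum_i lcoef c i * k i)%N.
have Hinj : \sum_(k : {ffun 'I_h -> 'I_M.+1} | (dot k == n) && injectiveb k)
   (omega (img k) * \sum_(q : {ffun 'I_h -> 'I_M.+1} | [&& dot q == m, ~~ [disjoint img k & img q]%B &
           (n != m) || (img k != img q)]) omega (img q :\: img k)) <=
   Nc * (K1 * (Nc0 * K1 / hrootm tau + tau%:R * (K3 / hroot n%:R))).
  apply: (@le_trans _ _ (\sum_(k : {ffun 'I_h -> 'I_M.+1} | (dot k == n) && injectiveb k)
     \sum_(c | indep c) K1 * (omega (img k) *
       (if (s c k <= m)%N then (hrootm (m - s c k))^-1 else 0)))).
    apply: ler_sum => k /andP[/eqP kn _].
    rewrite (partition_big (code k) indep) /=; last first.
      move=> q /and3P[/eqP qm sh ne].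
      by have /andP[] : (#|free (code k q)| < h)%N && indep (code k q)
        by apply: code_indep; rewrite // kn qm.
    rewrite mulr_sumr; apply: ler_sum => c _.
    rewrite mulrCA ler_wpM2l ?omega_ge0 //.
    (* A witness [q] shows that [s c k <= m] and that the code is not entirely free; without a
       witness the sum is empty. *)
    case: (pickP (fun q : {ffun 'I_h -> 'I_M.+1} => [&& dot q == m, ~~ [disjoint img k & img q]%B &
       (n != m) || (img k != img q)] && (code k q == c))) => [q|none]; last first.
      rewrite big_pred0 //; case: ifP => _; last by rewrite mulr0.
      by rewrite mulr_ge0 ?invr_ge0 // ltW // hrootm_gt0.
    move=> /andP[/and3P[/eqP qm sh ne] /eqP cE].
    have /andP[cf _] : (#|free (code k q)| < h)%N && indep (code k q).
      by apply: code_indep; rewrite // kn qm.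
    rewrite ifT; last by rewrite -qm (dot_code cE) leq_addr.
    rewrite cE in cf; have := sum_code_le m k c; rewrite cf; apply: le_trans.
    rewrite big_mkcond [leRHS]big_mkcond; apply: ler_sum => q' _.
    case: (_ == m) => //=; case: (_ == c); rewrite ?andbF ?andbT //.
    by case: ifP => // _; exact: omega_ge0.
  rewrite exchange_big /=.
  apply: (@le_trans _ _ (\sum_(c | indep c) K1 * (Nc0 * K1 / hrootm tau + tau%:R * (K3 / hroot n%:R)))).
    apply: ler_sum => c ic; rewrite -mulr_sumr ler_wpM2l ?(ltW K10) //.
    exact: sum_code_pairs_le.
  rewrite sumr_const -[leLHS]mulr_natl ler_wpM2r //; last by rewrite ler_nat max_card.
  rewrite mulr_ge0 ?(ltW K10) // addr_ge0 // ?divr_ge0 ?mulr_ge0 ?divr_ge0 ?(ltW K10) ?(ltW rn0) //.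
    by rewrite ltW // hrootm_gt0.
  by rewrite invr_ge0 ltW.
have Hnon : \sum_(k : {ffun 'I_h -> 'I_M.+1} | (dot k == n) && ~~ injectiveb k)
   (omega (img k) * \sum_(q : {ffun 'I_h -> 'I_M.+1} | [&& dot q == m, ~~ [disjoint img k & img q]%B &
           (n != m) || (img k != img q)]) omega (img q :\: img k)) <=
   Nc0 * K1 / hroot n%:R * (Nc * K1).
  have := sum_omega_noninj_le M n; rewrite hrootmE // => H.
  have NK : 0 <= Nc * K1 by rewrite mulr_ge0 // ltW.
  apply: le_trans (ler_wpM2r NK H); rewrite mulr_suml.
  apply: ler_sum => k _; rewrite ler_wpM2l ?omega_ge0 //.
  apply: le_trans (sum_ext_le m k).
  rewrite big_mkcond [leRHS]big_mkcond; apply: ler_sum => q _.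
  by case: (_ == m) => //=; case: ifP => // _; exact: omega_ge0.
apply: le_trans (lerD Hinj Hnon) _.
have t1 : 1 <= tau%:R :> R by rewrite ler1n.
have H1 : (hroot n%:R)^-1 <= tau%:R / hroot n%:R by rewrite ler_peMl // invr_ge0 ltW.
have H2 : 0 <= (hrootm tau)^-1 by rewrite invr_ge0 ltW // hrootm_gt0.
have N0 : 0 <= Nc by rewrite ler0n.
have N00 : 0 <= Nc0 by rewrite ler0n.
rewrite /K4; set x := (hrootm tau)^-1 in H2 *; set y := tau%:R / _ in H1 *.
have -> : Nc * (K1 * (Nc0 * K1 * x + tau%:R * (K3 / hroot n%:R))) +
  Nc0 * K1 / hroot n%:R * (Nc * K1) =
  Nc * K1 * (Nc0 * K1 * (x + (hroot n%:R)^-1) + K3 * y) by rewrite /y; ring.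
rewrite -[leRHS]mulrA; apply: ler_wpM2l; first by rewrite mulr_ge0 // ltW.
rewrite mulrDl; apply: lerD.
  by apply: ler_wpM2l; [rewrite mulr_ge0 // ltW | rewrite lerD2l].
by apply: ler_wpM2l => //; rewrite lerDr.
Qed.

End codes.

(** * The weighted number of solutions *)

Section weighted_counts.
Variables (R : realType) (h : nat) (b : nat -> nat).
Hypothesis h2 : (2 <= h)%N.
Hypothesis b0 : forall i, (i < h)%N -> (0 < b i)%N.
Local Notation hroot := (@hroot R h).
Local Notation wgt := (@wgt R h).
Local Notation dot := (@dot h b _).
Local Notation bsum := (bsum h b).

Definition dotn (k : {ffun 'I_h -> nat}) : nat := (\sum_(i < h) b i * k i)%N.
Definition natv M (k : {ffun 'I_h -> 'I_M}) : {ffun 'I_h -> nat} :=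
  [ffun i => nat_of_ord (k i)].

Lemma dot_natv M (k : {ffun 'I_h -> 'I_M}) : dotn (natv k) = dot k.
Proof. by apply: eq_bigr => i _; rewrite ffunE. Qed.

Lemma le_dotn (k : {ffun 'I_h -> nat}) i : (k i <= dotn k)%N.
Proof. by rewrite /dotn (bigD1 i) //=; have := b0 (ltn_ord i); nia. Qed.

(** Summands are functions of vectors of natural numbers, so that sums over boxes of different sizes
    can be compared. *)
Definition tsum M (G : {ffun 'I_h -> nat} -> R) : R :=
  \sum_(k : {ffun 'I_h -> 'I_M.+1}) G (natv k).

Lemma tsum_widen M N (G : {ffun 'I_h -> nat} -> R) : (M <= N)%N ->
  (forall k : {ffun 'I_h -> nat}, (exists i, (M < k i)%N) -> G k = 0) -> tsum N G = tsum M G.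
Proof.
move=> MN G0; rewrite /tsum.
rewrite (bigID (fun k : {ffun 'I_h -> 'I_N.+1} => [forall i, k i <= M]%N)) /=.
rewrite [X in _ + X]big1 => [|k]; last first.
  rewrite negb_forall => /existsP[i]; rewrite -ltnNge => Mi.
  by apply: G0; exists i; rewrite ffunE.
pose e (k : {ffun 'I_h -> 'I_M.+1}) : {ffun 'I_h -> 'I_N.+1} := [ffun i => inord (k i)].
pose e' (k : {ffun 'I_h -> 'I_N.+1}) : {ffun 'I_h -> 'I_M.+1} := [ffun i => inord (k i)].
have eE k i : nat_of_ord (e k i) = k i.
  by rewrite ffunE inordK // ltnS (leq_trans _ MN) // -ltnS.
rewrite addr0 (reindex_onto e e') /=; last first.
  move=> k /forallP kM; apply/ffunP => i; apply: val_inj => /=.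
  by rewrite eE ffunE inordK // ltnS.
apply: eq_big => [k|k _].
  apply/andP; split; first by apply/forallP => i; rewrite eE -ltnS.
  by apply/eqP; apply/ffunP => i; apply: val_inj; rewrite ffunE eE inord_val.
by congr (G _); apply/ffunP => i; rewrite ffunE [RHS]ffunE eE.
Qed.

Definition wprod (k : {ffun 'I_h -> nat}) : R := \prod_i wgt (k i).

Lemma wprod_ge0 k : 0 <= wprod k.
Proof. by apply: prodr_ge0 => i _; exact: wgt_ge0. Qed.

Lemma wprod_natv M (k : {ffun 'I_h -> 'I_M}) : wprod (natv k) = \prod_i wgt (k i).
Proof. by apply: eq_bigr => i _; rewrite ffunE. Qed.

Definition cnt (n : nat) : R := tsum n (fun k => if dotn k == n then wprod k else 0).
Definition cumul (n : nat) : R :=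
  tsum n (fun k => if (dotn k <= n)%N then wprod k else 0).

Lemma cnt_widen M n : (n <= M)%N ->
  tsum M (fun k => if dotn k == n then wprod k else 0) = cnt n.
Proof.
move=> nM; apply: tsum_widen => // k [i nk]; case: eqP => // kn.
by have := le_dotn k i; lia.
Qed.

Lemma cumul_widen M n : (n <= M)%N ->
  tsum M (fun k => if (dotn k <= n)%N then wprod k else 0) = cumul n.
Proof.
move=> nM; apply: tsum_widen => // k [i nk]; case: leqP => // kn.
by have := le_dotn k i; lia.
Qed.

Lemma cntE n : cnt n = \sum_(k : {ffun 'I_h -> 'I_n.+1} | dot k == n) \prod_i wgt (k i).
Proof.
rewrite [RHS]big_mkcond; apply: eq_bigr => k _.
by rewrite dot_natv wprod_natv.
Qed.

Lemma cnt_ge0 n : 0 <= cnt n.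
Proof. by apply: sumr_ge0 => k _; case: ifP => // _; exact: wprod_ge0. Qed.

Lemma cumul_ge0 n : 0 <= cumul n.
Proof. by apply: sumr_ge0 => k _; case: ifP => // _; exact: wprod_ge0. Qed.

Lemma cumulS n : cumul n.+1 = cumul n + cnt n.+1.
Proof.
rewrite -(cumul_widen (leqnSn n)) /cnt /tsum -big_split /=; apply: eq_bigr => k _.
case: (ltngtP (dotn (natv k)) n.+1) => kn.
- by rewrite -ltnS kn addr0.
- by rewrite leqNgt (ltn_trans _ kn) ?addr0.
- by rewrite kn ltnn add0r.
Qed.

Lemma cumul0 : cumul 0 = 0.
Proof.
rewrite /cumul /tsum big1 // => k _; case: ifP => // _; rewrite wprod_natv.
have h0 : (0 < h)%N by lia.
by rewrite (bigD1 (Ordinal h0)) //= (ord1 (k _)) wgt0 mul0r.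
Qed.

Lemma cnt0 : cnt 0 = 0.
Proof.
rewrite /cnt /tsum big1 // => k _; case: ifP => // _; rewrite wprod_natv.
have h0 : (0 < h)%N by lia.
by rewrite (bigD1 (Ordinal h0)) //= (ord1 (k _)) wgt0 mul0r.
Qed.

Lemma cumul_le n : cumul n <= h%:R ^+ h * n%:R.
Proof.
apply: (@le_trans _ _ (\sum_(k : {ffun 'I_h -> 'I_n.+1}) \prod_i wgt (k i))).
  apply: ler_sum => k _; rewrite wprod_natv; case: ifP => // _.
  by rewrite -wprod_natv wprod_ge0.
rewrite -(bigA_distr_bigA (fun _ (j : 'I_n.+1) => wgt j)) /=.
by rewrite prodr_const card_ord sum_wgt // exprMn hroot_exp.
Qed.

Definition ceil (q K : nat) : nat := ((K + q.-1) %/ q)%N.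

Lemma ceil_le q K k : (0 < q)%N -> (ceil q K <= k)%N = (K <= q * k)%N.
Proof.
move=> q0; rewrite /ceil -ltnS ltn_divLR // mulnC mulnS; lia.
Qed.

Lemma le_mul_ceil q K : (0 < q)%N -> (K <= q * ceil q K)%N.
Proof. by move=> q0; rewrite -ceil_le. Qed.

Lemma mul_ceil_le q K : (0 < q)%N -> (q * ceil q K <= K + q)%N.
Proof. by move=> q0; rewrite /ceil mulnC (leq_trans (leq_trunc_div _ _)) //; lia. Qed.

(** The [q] cells rounded up to [k] fill the interval from [q (k-1)] to [q k], and the integral is
    homogeneous of degree [1/h]. This exactness is the reason for the choice of [wgt]. *)
Lemma sum_wgt_ceil M q k : (0 < q)%N -> (q * k <= M)%N ->
  \sum_(K < M.+1 | ceil q K == k) wgt K = hroot q%:R * wgt k.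
Proof.
move=> q0 qkM; case: k qkM => [_|k qkM].
  rewrite wgt0 mulr0 big1 // => K; rewrite -leqn0 ceil_le // muln0 leqn0 => /eqP ->.
  exact: wgt0.
have split1 : \sum_(K < M.+1 | (K <= q * k.+1)%N) wgt K =
    \sum_(K < M.+1 | (K <= q * k)%N) wgt K + \sum_(K < M.+1 | ceil q K == k.+1) wgt K.
  rewrite (bigID (fun K : 'I_M.+1 => (K <= q * k)%N)) /=; congr (_ + _).
    by apply: eq_bigl => K; apply/andP/idP => [[]//|Kk]; split=> //; rewrite mulnS (leq_trans Kk) // leq_addl.
  apply: eq_bigl => K; rewrite -!ceil_le // -ltnNge eqn_leq.
  by case: leqP; rewrite ?andbT ?andbF.
move: split1; rewrite !sum_wgt_cut //.
rewrite (minn_idPr qkM) (minn_idPr _); last by rewrite (leq_trans _ qkM) // leq_mul2l leqnSn orbT.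
move=> E; apply: (@addrI _ (h%:R * hroot (q * k)%:R)); rewrite -E.
by rewrite !natrM !hrootM // /wgt /=; ring.
Qed.

Definition vceil q (K : {ffun 'I_h -> nat}) : {ffun 'I_h -> nat} :=
  [ffun i => ceil q (K i)].

(** Each of the [h] coordinates contributes a factor [q^(1/h)], together exactly [q]; the fine
    vectors are counted according to their rounded values. *)
Lemma mul_cumul q n : (0 < q)%N ->
  q%:R * cumul n =
  tsum (q * n) (fun K => if (dotn (vceil q K) <= n)%N then wprod K else 0).
Proof.
move=> q0; rewrite /tsum -big_mkcond /=.
pose f (K : {ffun 'I_h -> 'I_(q * n).+1}) : {ffun 'I_h -> 'I_n.+1} :=
  [ffun i => inord (ceil q (K i))].
have fE (K : {ffun 'I_h -> 'I_(q * n).+1}) i : nat_of_ord (f K i) = ceil q (K i).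
  by rewrite ffunE inordK // ltnS ceil_le // -ltnS.
have fd K : dotn (vceil q (natv K)) = dot (f K).
  by apply: eq_bigr => i _; rewrite fE !ffunE.
under eq_bigl => K do rewrite fd.
rewrite (partition_big f (fun k => dot k <= n)%N) //=.
have -> : cumul n = \sum_(k : {ffun 'I_h -> 'I_n.+1} | (dot k <= n)%N) wprod (natv k).
  by rewrite [RHS]big_mkcond; apply: eq_bigr => k _; rewrite dot_natv.
rewrite mulr_sumr.
apply: eq_bigr => k kn.
rewrite (eq_bigl (mem (family (fun i => [pred x : 'I_(q * n).+1 | ceil q x == k i])))); last first.
  move=> K; apply/andP/familyP => [[_ /eqP <- i]|H]; first by rewrite inE fE.
  have -> : f K = k by apply/ffunP => i; apply: val_inj; rewrite /= fE; apply/eqP; exact: H.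
  by rewrite kn eqxx.
under eq_bigr do rewrite wprod_natv.
rewrite -(bigA_distr_big_dep _ (fun _ (x : 'I_(q * n).+1) => wgt x)) /=.
rewrite -[in LHS](hroot_exp h2 (ler0n R q)) wprod_natv.
rewrite -[X in _ ^+ X * _](card_ord h) -prodr_const -big_split /=.
apply: eq_bigr => i _; rewrite sum_wgt_ceil // leq_mul2l.
by rewrite -ltnS ltn_ord orbT.
Qed.

Lemma mul_cumul_le q n : (0 < q)%N -> q%:R * cumul n <= cumul (q * n).
Proof.
move=> q0; rewrite mul_cumul //; apply: ler_sum => K _.
case: leqP => // H; last by case: ifP => // _; exact: wprod_ge0.
rewrite ifT //; apply: leq_trans (_ : q * n <= _)%N => //.
apply: leq_trans (leq_mul (leqnn q) H).
rewrite /dotn big_distrr /=; apply: leq_sum => i _.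
by rewrite mulnCA leq_mul2l; apply/orP; right; rewrite !ffunE le_mul_ceil.
Qed.

(** Rounding up raises [q] times an entry by at most [q] above the original, hence the linear form
    by at most [q bsum]. *)
Lemma cumul_mul_le q n : (0 < q)%N -> cumul (q * n) <= q%:R * cumul (n + bsum).
Proof.
move=> q0; rewrite mul_cumul // -(cumul_widen (_ : q * n <= q * (n + bsum)))%N; last first.
  by rewrite leq_mul2l leq_addr orbT.
apply: ler_sum => K _.
case: leqP => // H; last by case: ifP => // _; exact: wprod_ge0.
rewrite ifT //; move: (natv K) H => k H; rewrite -(leq_pmul2l q0) mulnDr.
apply: leq_trans (_ : dotn k + q * bsum <= _)%N; last by rewrite leq_add2r.
rewrite /dotn /bsum !big_distrr /= -big_split /=; apply: leq_sum => i _.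
have := mul_ceil_le (k i) q0; rewrite [vceil _ _ i]ffunE.
by move=> H'; rewrite mulnCA [(q * b i)%N]mulnC -mulnDr leq_mul2l H' orbT.
Qed.

(* Comparing [cumul (x * y)] with both [y * cumul x] and [x * cumul (y + bsum)]
   makes [cumul x / x] converge to its supremum with an [O(1/x)] error. *)
Lemma cumul_cross x y : (0 < x)%N -> (0 < y)%N ->
  y%:R * cumul x <= x%:R * cumul (y + bsum).
Proof.
move=> x0 y0; apply: le_trans (mul_cumul_le _ y0) _.
by rewrite mulnC; exact: cumul_mul_le.
Qed.

Lemma cumul_linear : exists2 V : R, 0 <= V & forall n,
  V * (n%:R - bsum%:R) <= cumul n <= V * n%:R.
Proof.
(* The supremum of this set is [V]: the upper bound is immediate, and the lower one compares every
   quotient with the one at [n], after a shift by [bsum]. *)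
pose S : set R := [set cumul x.+1 / x.+1%:R | x in [set: nat]]%classic.
have Sub : ubound S (h%:R ^+ h).
  by move=> _ [x _ <-]; rewrite ler_pdivrMr ?ltr0n // cumul_le.
have hsS : has_sup S by split; [exists (cumul 1 / 1%:R), 0%N | exists (h%:R ^+ h)].
have V0 : 0 <= sup S.
  apply: le_trans (_ : cumul 1 / 1%:R <= _); first by rewrite divr_ge0 // cumul_ge0.
  by apply: ub_le_sup; [case: hsS | exists 0%N].
exists (sup S) => // n; apply/andP; split; last first.
  case: n => [|n]; first by rewrite cumul0 mulr0.
  rewrite -ler_pdivrMr ?ltr0n //; apply: ub_le_sup; first by case: hsS.
  by exists n.
have [nB|nB] := leqP n bsum.
  apply: le_trans (cumul_ge0 _); rewrite mulr_ge0_le0 // subr_le0 ler_nat //.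
rewrite -natrB ?(ltnW nB) //.
have y0 : (0 < n - bsum)%N by rewrite subn_gt0.
rewrite -ler_pdivlMr ?ltr0n //; apply: ge_sup; first by case: hsS.
move=> _ [x _ <-]; rewrite ler_pdivlMr ?ltr0n // mulrAC ler_pdivrMr ?ltr0n //.
rewrite mulrC [leRHS]mulrC -{2}(subnK (ltnW nB)); exact: cumul_cross.
Qed.

End weighted_counts.

(** * Slow oscillation and convergence of the weighted count *)

(** The Bezout vector is the difference [S - T] of two natural vectors. The induction combines the
    vectors found so far with the extended Euclidean algorithm for the gcd and the next [b h]. *)
Lemma bezout_vectors (h : nat) (b : nat -> nat) :
  exists S T : nat -> nat, (\sum_(i < h) b i * S i =
    \sum_(i < h) b i * T i + \big[gcdn/0]_(i < h) b i)%N.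
Proof.
elim: h => [|h [S [T ST]]].
  by exists (fun=> 0%N), (fun=> 0%N); rewrite !big_ord0.
set g := \big[gcdn/0]_(i < h) b i in ST.
have ext (S' : nat -> nat) a x : (\sum_(i < h.+1) b i * (if (i : nat) == h then x else a * S' i) =
    a * (\sum_(i < h) b i * S' i) + b h * x)%N.
  rewrite big_ord_recr /= eqxx; congr (_ + _)%N; rewrite big_distrr /=.
  by apply: eq_bigr => i _; rewrite ltn_eqF // mulnCA.
have [g0|g0] := posnP g.
  (* The gcd so far is 0, so the unit vector at [h] serves; the factor 0 only gives the shape that
     [ext] rewrites. *)
  exists (fun i => if i == h then 1%N else (0 * S i)%N), (fun i => if i == h then 0%N else (0 * T i)%N).
  by rewrite !ext big_ord_recr /= -/g g0 gcd0n; lia.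
case: (@egcdnP g (b h) g0) => u v E _.
exists (fun i => if i == h then 0%N else (u * S i)%N), (fun i => if i == h then v else (u * T i)%N).
rewrite !ext ST big_ord_recr /= -/g mulnDr muln0 addn0 E; lia.
Qed.

Section slow_oscillation.
Variables (R : realType) (h : nat) (b : nat -> nat).
Hypothesis h2 : (2 <= h)%N.
Hypothesis b0 : forall i, (i < h)%N -> (0 < b i)%N.
Local Notation hroot := (@hroot R h).
Local Notation rho := (@rho R h).
Local Notation wgt := (@wgt R h).
Local Notation wgt1 := (@wgt1 R h).
Local Notation dot := (@dot h b _).
Local Notation bsum := (bsum h b).
Local Notation cnt := (cnt R h b).
Local Notation K2 := (K2 R h b).

(** Compare [wgt k <= rho (k-1)] with [rho (k+s)]: the arguments have ratio [1 + (s+1)/(k-1)], which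
    is at most [1 + (s+1)/y] because [k > y]. *)
Lemma wgt_shift (y k s t : nat) : (0 < y)%N -> (y < k)%N -> (t <= y)%N ->
  y%:R / (y%:R + s%:R + 1) * wgt k <= wgt (k + s - t).
Proof.
move=> y0 yk ty; set m := (k + s - t)%N.
have m0 : (0 < m)%N by lia.
apply: le_trans (wgt_ge R h2 m0).
have mks : m%:R <= (k + s)%:R :> R by rewrite ler_nat leq_subr.
apply: le_trans (le_rho h2 _ mks); last by rewrite ltr0n.
have k1 : (0 < k.-1)%N by lia.
have -> : wgt k = wgt k.-1.+1 by rewrite prednK //; lia.
have den : 0 < y%:R + s%:R + 1 :> R by rewrite ltr_wpDl.
apply: le_trans (ler_wpM2l _ (wgt_le_pred R h2 k1)) _.
  by rewrite divr_ge0 // ltW.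
have x0 : 0 < (k + s)%:R :> R by rewrite ltr0n; lia.
have kR : 0 < k.-1%:R :> R by rewrite ltr0n.
pose c : R := (k + s)%:R / k.-1%:R.
have c1 : 1 <= c by rewrite ler_pdivlMr // mul1r ler_nat; lia.
have := @rho_scale R h _ c x0 c1.
have -> : (k + s)%:R / c = k.-1%:R :> R by rewrite /c invf_div mulrCA divff ?mulr1 // gt_eqF.
move=> H; rewrite mulrAC ler_pdivrMr //.
apply: le_trans (ler_wpM2l (ler0n R y) H) _.
rewrite mulrA mulrC ler_wpM2l ?rho_ge0 ?(ltW x0) // /c mulrA ler_pdivrMr //.
rewrite -(natrD _ y) natr1 -!natrM ler_nat.
by case: k yk k1 {m m0 mks x0 kR c c1 H} => // k yk k1 /=; nia.
Qed.

Lemma cnt_cut_le n y : (0 < n)%N -> (0 < y)%N ->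
  cnt n <= \sum_(k : {ffun 'I_h -> 'I_n.+1} | (dot k == n) && [forall i, y < k i]%N)
      \prod_i wgt (k i) + h%:R * (K2 * hroot y%:R / hroot n%:R).
Proof.
move=> n0 y0; rewrite cntE // (bigID (fun k : {ffun 'I_h -> 'I_n.+1} => [forall i, y < k i]%N)) /=.
rewrite lerD2l.
apply: (@le_trans _ _ (\sum_i \sum_(k : {ffun 'I_h -> 'I_n.+1} | (dot k == n) && (k i <= y)%N)
     \prod_i wgt1 (k i))).
  under [leRHS]eq_bigr do rewrite big_mkcondr.
  rewrite exchange_big /= big_mkcondr; apply: ler_sum => k _.
  have W1 : \prod_i wgt (k i) <= \prod_i wgt1 (k i).
    by apply: ler_prod => i _; rewrite wgt_ge0 // wgt_le_wgt1.
  have W0 : 0 <= \prod_i wgt1 (k i) by apply: prodr_ge0 => i _; exact: wgt1_ge0.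
  case: ifP => [|_]; last by apply: sumr_ge0 => i _; case: ifP.
  rewrite negb_forall => /existsP[i]; rewrite -leqNgt => ki.
  rewrite [leRHS](bigD1 i) //= ki -[leLHS]addr0 lerD //.
  by apply: sumr_ge0 => j _; case: ifP.
rewrite mulr_natl -[X in _ *+ X](card_ord h) -sumr_const; apply: ler_sum => i _.
exact: sum_cut_le.
Qed.

(* Shifting the solutions of [b . k = n] by the fixed vector [S - T] sends them to
   solutions of [b . k = m] and hardly changes the weights of large entries. *)
Lemma cnt_shift (S T : nat -> nat) n m y s : (0 < n)%N -> (0 < y)%N ->
  (\sum_(i < h) b i * S i + n = \sum_(i < h) b i * T i + m)%N ->
  (forall i, (i < h)%N -> (S i <= s)%N) -> (forall i, (i < h)%N -> (T i <= y)%N) ->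
  (y%:R / (y%:R + s%:R + 1)) ^+ h *
    (cnt n - h%:R * (K2 * hroot y%:R / hroot n%:R)) <= cnt m.
Proof.
move=> n0 y0 ST Ss Ty; set lam := _ / _.
have den : 0 < y%:R + s%:R + 1 :> R by rewrite ltr_wpDl.
have lam0 : 0 <= lam by rewrite divr_ge0 // ltW.
have := cnt_cut_le n0 y0; rewrite -lerBlDr => H.
apply: le_trans (ler_wpM2l (exprn_ge0 h lam0) H) _.
rewrite mulr_sumr cntE //.
pose D (k : {ffun 'I_h -> 'I_n.+1}) := (dot k == n) && [forall i, y < k i]%N.
pose f (k : {ffun 'I_h -> 'I_n.+1}) : {ffun 'I_h -> 'I_m.+1} :=
  [ffun i => inord (k i + S i - T i)].
have dE k : D k -> (\sum_(i < h) b i * (k i + S i - T i) = m)%N.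
  move=> /andP[/eqP kn /forallP ky].
  apply: (@addnI (\sum_(i < h) b i * T i)%N); rewrite -ST -[in RHS]kn /dot -!big_split /=.
  apply: eq_bigr => i _; rewrite -!mulnDr; congr (_ * _)%N.
  by have := ky i; have := Ty _ (ltn_ord i); lia.
have fE k i : D k -> nat_of_ord (f k i) = (k i + S i - T i)%N.
  move=> Dk; rewrite ffunE inordK // ltnS -(dE _ Dk) (bigD1 i) //=.
  by apply: leq_trans (leq_addr _ _); rewrite leq_pmull // b0.
have f_inj : {in D &, injective f}.
  move=> k k' Dk Dk' kk'; apply/ffunP => i; apply: val_inj => /=.
  have := fE _ i Dk; rewrite kk' (fE _ i Dk').
  move: (Dk) (Dk') => /andP[_ /forallP/(_ i) ky] /andP[_ /forallP/(_ i) ky'].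
  by have := Ty _ (ltn_ord i); lia.
apply: (@le_trans _ _ (\sum_(k | D k) \prod_i wgt (f k i))).
  apply: ler_sum => k Dk; rewrite -[X in _ ^+ X](card_ord h) -prodr_const -big_split /=.
  apply: ler_prod => i _; rewrite mulr_ge0 ?wgt_ge0 //= (fE _ _ Dk).
  move: (Dk) => /andP[_ /forallP/(_ i) ky].
  apply: le_trans (wgt_shift (S i) y0 ky (Ty _ (ltn_ord i))).
  apply: ler_wpM2r; first exact: wgt_ge0.
  apply: ler_wpM2l => //; rewrite lef_pV2 ?posrE // ?ltr_wpDl //.
  by rewrite lerD2r lerD2l ler_nat Ss.
rewrite -(big_imset (fun g : {ffun 'I_h -> 'I_m.+1} => \prod_i wgt (g i)) f_inj) /=.
rewrite big_mkcond [leRHS]big_mkcond; apply: ler_sum => g _.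
have W0 : 0 <= \prod_i wgt (g i) by apply: prodr_ge0 => i _; exact: wgt_ge0.
case: ifP => [/imsetP[k Dk gE]|_]; last by case: ifP.
rewrite ifT //; apply/eqP; rewrite -[RHS](dE _ Dk) gE.
by apply: eq_bigr => i _; rewrite fE.
Qed.

End slow_oscillation.

(** The window of [J] values ending at [n - 1]: its members are at least [n / 2] and reach [n] by a
    shift of at most [J]. *)
Lemma window_arith n J j : (2 * J.+1 <= n)%N -> (j < J)%N ->
  [/\ (0 < n - J.+1 + j.+1)%N, (n <= 2 * (n - J.+1 + j.+1))%N &
     (n - J.+1 + j.+1 + (J - j) = n)%N].
Proof. by move=> nJ jJ; split; lia. Qed.

Section limit_exists.
Variables (R : realType) (h : nat) (b : nat -> nat).
Hypothesis h2 : (2 <= h)%N.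
Hypothesis b0 : forall i, (i < h)%N -> (0 < b i)%N.
Hypothesis gcd1 : (\big[gcdn/0]_(i < h) b i = 1)%N.
Local Notation hroot := (@hroot R h).
Local Notation bsum := (bsum h b).
Local Notation cnt := (cnt R h b).
Local Notation cumul := (cumul R h b).
Local Notation K2 := (K2 R h b).

Lemma cnt_le n : (0 < n)%N -> cnt n <= K2.
Proof.
move=> n0; have h0 : (0 < h)%N by lia.
have := sum_cut_le R h2 b0 n (Ordinal h0) n0 n0.
rewrite -mulrA divff ?mulr1; last by rewrite gt_eqF // hroot_gt0 // ltr0n.
apply: le_trans; rewrite cntE // big_mkcond [leRHS]big_mkcond; apply: ler_sum => k _.
case: eqP => //= _; rewrite -ltnS ltn_ord; apply: ler_prod => i _.
by rewrite wgt_ge0 // wgt_le_wgt1.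
Qed.

Lemma sum_cnt n J : \sum_(j < J) cnt (n + j.+1)%N = cumul (n + J)%N - cumul n.
Proof.
elim: J => [|J IH]; first by rewrite big_ord0 addn0 subrr.
by rewrite big_ord_recr /= IH !addnS cumulS //; ring.
Qed.

(** The value [cnt n] is compared with its average over [J] following values for the upper bound,
    and over [J] preceding values for the lower one; the averages are [V] up to [V bsum / J]. The
    parameter [q] measures all relative errors and is sent to infinity afterwards. *)
Lemma cnt_bounds V : 0 <= V ->
  (forall n, V * (n%:R - bsum%:R) <= cumul n <= V * n%:R) ->
  forall q, (2 <= q)%N -> exists n0, forall n, (n0 <= n)%N ->
  V * (1 - q%:R^-1) - h%:R * K2 * hroot (2 / q%:R) <= (1 + 2 / q%:R) ^+ h * cnt n /\
  cnt n <= h%:R * K2 * hroot (2 / q%:R) + (1 + 2 / q%:R) ^+ h * (V * (1 + q%:R^-1)).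
Proof.
move=> V0 VF q q2; have [S [T]] := bezout_vectors h b; rewrite gcd1 => ST.
(* A positive bound for all entries of both Bezout vectors. *)
pose D := (1 + \sum_(i < h) S i + \sum_(i < h) T i)%N.
have SD i : (i < h)%N -> (S i <= D)%N.
  move=> ih; rewrite /D (bigD1 (Ordinal ih)) //=.
  by rewrite -!addnA addnCA leq_addr.
have TD i : (i < h)%N -> (T i <= D)%N.
  move=> ih; rewrite /D (bigD1 (Ordinal ih) (F := T)) //=.
  by rewrite addnCA leq_addr.
have D0 : (0 < D)%N by rewrite /D -addnA.
pose J0 := (q * bsum + 1)%N.
exists (q * (q * D * J0))%N => n nn0.
have q0 : (0 < q)%N by lia.
have qD0 : (0 < q * D)%N by rewrite muln_gt0 q0.
(* Entries up to [y], about [n / q], are discarded. A shift by at most [J] moves an entry by at most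
   [D J <= y / q], and the threshold on [n] ensures [bsum <= J / q]. *)
pose y := (n %/ q)%N; pose J := (y %/ (q * D))%N.
have yge : (q * D * J0 <= y)%N by rewrite leq_divRL // mulnC.
have Jge : (J0 <= J)%N by rewrite leq_divRL // mulnC.
have qDJ : (q * D * J <= y)%N by rewrite mulnC leq_trunc_div.
have qy : (q * y <= n)%N by rewrite mulnC leq_trunc_div.
have J1 : (0 < J)%N by apply: leq_trans Jge; rewrite /J0 addn1.
have qley : (q <= y)%N by apply: leq_trans qDJ; rewrite -mulnA leq_pmulr // muln_gt0 D0.
have y0 : (0 < y)%N by lia.
have Jy : (q * J <= y)%N by apply: leq_trans qDJ; rewrite leq_mul2r leq_pmulr ?orbT.
have DJy : (D * J <= y)%N by apply: leq_trans qDJ; rewrite -mulnA leq_pmull.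
have qR : 0 < q%:R :> R by rewrite ltr0n.
have yR : 0 < y%:R :> R by rewrite ltr0n.
have JR : 0 < J%:R :> R by rewrite ltr0n.
have K20 := K2_ge0 R h b.
have lam1 : 0 < 1 + 2 / q%:R :> R by rewrite ltr_pwDl // divr_ge0.
pose E := h%:R * K2 * hroot (2 / q%:R).
(* [E] is the cost of the small entries, as [y / n' <= 2 / q]. The inverse weight ratio is at most
   [1 + 1/q + 1/y], and [y >= q]. *)
have slow n' j : (0 < n')%N -> (q * y <= 2 * n')%N -> (j <= J)%N ->
    cnt n' <= E + (1 + 2 / q%:R) ^+ h * cnt (n' + j)%N.
  move=> n'0 qyn' jJ; have n'R : 0 < n'%:R :> R by rewrite ltr0n.
  have := @cnt_shift R h b h2 b0 (fun i => j * S i)%N (fun i => j * T i)%N n' (n' + j) y (D * J) n'0 y0.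
  set lam := y%:R / _ => H.
  have den : 0 < y%:R + (D * J)%:R + 1 :> R by rewrite ltr_wpDl.
  have lam0 : 0 < lam by rewrite divr_gt0.
  have {}H : lam ^+ h * (cnt n' - h%:R * (K2 * hroot y%:R / hroot n'%:R)) <= cnt (n' + j)%N.
    apply: H => [|i ih|i ih].
    - under eq_bigr do rewrite mulnCA.
      under [in RHS]eq_bigr do rewrite mulnCA.
      by rewrite -!big_distrr /= ST mulnDr muln1 -addnA (addnC n').
    - by rewrite mulnC leq_mul // SD.
    - by apply: leq_trans DJy; rewrite mulnC leq_mul // TD.
  have {}H : cnt n' - h%:R * (K2 * hroot y%:R / hroot n'%:R) <= lam ^- h * cnt (n' + j)%N.
    by rewrite [leRHS]mulrC ler_pdivlMr ?exprn_gt0 // [leLHS]mulrC.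
  have e1 : h%:R * (K2 * hroot y%:R / hroot n'%:R) <= E.
    rewrite /E -[leRHS]mulrA -[X in _ * X <= _]mulrA.
    apply: ler_wpM2l => //; apply: ler_wpM2l => //; rewrite ler_pdivrMr ?hroot_gt0 //.
    rewrite -hrootM ?(ltW n'R) ?divr_ge0 // le_hroot //.
    by rewrite mulrAC ler_pdivlMr // -!natrM ler_nat mulnC.
  have e2 : lam ^- h <= (1 + 2 / q%:R) ^+ h.
    rewrite -exprVn lerXn2r ?nnegrE ?invr_ge0 ?(ltW lam0) ?(ltW lam1) //.
    rewrite invf_div ler_pdivrMr // mulrDl mul1r -addrA lerD2l.
    rewrite mulrAC ler_pdivlMr // natr1 -!natrM ler_nat mulnC mulnS mul2n -addnn.
    by rewrite leq_add // mulnA.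
  have := ler_wpM2r (cnt_ge0 R b h2 (n' + j)%N) e2; lra.
have bJ : bsum%:R <= J%:R / q%:R :> R.
  rewrite ler_pdivlMr // -natrM ler_nat mulnC; move: Jge; rewrite /J0; lia.
split; last first.
  have : \sum_(j < J) cnt n <= \sum_(j < J) (E + (1 + 2 / q%:R) ^+ h * cnt (n + j.+1)%N).
    apply: ler_sum => j _; apply: slow; last exact: ltn_ord.
      by apply: leq_trans qy; rewrite muln_gt0 q0.
    by rewrite (leq_trans qy) // leq_pmull.
  rewrite big_split /= -[X in _ <= _ + X]mulr_sumr sum_cnt !sumr_const card_ord.
  rewrite -[leLHS]mulr_natl -[X in _ <= X + _]mulr_natl => H.
  have /andP[_ F1] := VF (n + J)%N; have /andP[F2 _] := VF n.
  have F3 : cumul (n + J)%N - cumul n <= V * (J%:R + J%:R / q%:R).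
    apply: le_trans (lerB F1 F2) _; rewrite -mulrBr ler_wpM2l // natrD.
    by move: bJ; lra.
  rewrite -(ler_pM2l JR) -/E; apply: le_trans H _.
  rewrite [leRHS]mulrDr lerD2l.
  apply: le_trans (ler_wpM2l (exprn_ge0 h (ltW lam1)) F3) _.
  by rewrite le_eqVlt; apply/orP; left; apply/eqP; ring.
have nJ : (2 * J.+1 <= n)%N.
  apply: leq_trans qy; apply: leq_trans (leq_mul q2 (leqnn y)).
  rewrite leq_mul2l /=; apply: leq_trans Jy; apply: leq_trans (leq_mul q2 (leqnn J)).
  by rewrite mul2n -addnn -addn1 leq_add2l.
(* Then [n1 + j.+1] with [j < J] runs over the [J] values just below [n]. *)
pose n1 := (n - J.+1)%N.
have : \sum_(j < J) cnt (n1 + j.+1)%N <= \sum_(j < J) (E + (1 + 2 / q%:R) ^+ h * cnt n).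
  apply: ler_sum => j _; have jJ := ltn_ord j.
  have [n10 n1n n1E] := window_arith nJ jJ.
  rewrite -[in leRHS]n1E; apply: slow => //; last exact: leq_subr.
  exact: leq_trans n1n.
rewrite sum_cnt sumr_const card_ord -[leRHS]mulr_natl => H.
have /andP[F1 _] := VF (n1 + J)%N; have /andP[_ F2] := VF n1.
have F3 : V * (J%:R - J%:R / q%:R) <= cumul (n1 + J)%N - cumul n1.
  apply: le_trans (lerB F1 F2); rewrite -mulrBr ler_wpM2l // natrD.
  by move: bJ; lra.
rewrite lerBlDl -(ler_pM2l JR) -/E; apply: le_trans H.
by apply: le_trans F3; rewrite le_eqVlt; apply/orP; left; apply/eqP; ring.
Qed.

Lemma cvg_hroot_harmonic :
  ((fun q : nat => hroot (2 / q.+2%:R)) @ \oo --> (0 : R))%classic.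
Proof.
apply/cvgrPdist_le => e e0.
have e1 : 0 < e ^+ h / 2 by rewrite divr_gt0 // exprn_gt0.
near=> q; rewrite sub0r normrN ger0_norm ?hroot_ge0 //.
apply: hroot_le_exp; rewrite ?divr_ge0 ?(ltW e0) //.
have : q.+1%:R^-1 < e ^+ h / 2 by near: q; exact: near_infty_natSinv_lt (PosNum e1).
have : q.+2%:R^-1 <= q.+1%:R^-1 :> R by rewrite lef_pV2 ?posrE ?ltr0n // ler_nat.
by move: (q.+2%:R^-1) (q.+1%:R^-1) => z u zu ue; lra.
Unshelve. all: by end_near. Qed.

Lemma cnt_cvg V : 0 <= V ->
  (forall n, V * (n%:R - bsum%:R) <= cumul n <= V * n%:R) ->
  (cnt @ \oo --> V)%classic.
Proof.
move=> V0 VF.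
(* Bounds in the single parameter [x = (2/q)^(1/h)], which dominates [2/q] and [1/q]; both functions
   tend to [V] as [x] tends to 0. *)
pose g1 (x : R) : R := h%:R * K2 * x + V * (1 + x) * (1 + x) ^+ h.
pose g2 (x : R) : R := V - x * (V + h%:R * K2) - ((1 + x) ^+ h - 1) * K2.
have c1 : ((1 + x) @[x --> (0 : R)] --> (1 : R))%classic.
  rewrite -[X in (_ --> X)%classic](addr0 1); apply: cvgD; [exact: cvg_cst | exact: cvg_id].
have ch : ((1 + x) ^+ h @[x --> (0 : R)] --> (1 : R))%classic.
  rewrite -[X in (_ --> X)%classic](expr1n _ h).
  by apply: (cvg_comp _ (fun x : R => x ^+ h) c1); exact: exprn_continuous.
have G1 : (g1 x @[x --> (0 : R)] --> V)%classic.
  have -> : V = h%:R * K2 * 0 + V * 1 * 1 by ring.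
  apply: cvgD; first by apply: cvgM; [exact: cvg_cst | exact: cvg_id].
  by apply: cvgM => //; apply: cvgM => //; exact: cvg_cst.
have G2 : (g2 x @[x --> (0 : R)] --> V)%classic.
  have -> : V = V - 0 * (V + h%:R * K2) - (1 - 1) * K2 by ring.
  apply: cvgB; first (apply: cvgB; first exact: cvg_cst).
    by apply: cvgM; [exact: cvg_id | exact: cvg_cst].
  by apply: cvgM; [apply: cvgB => //; exact: cvg_cst | exact: cvg_cst].
have K20 := K2_ge0 R h b.
apply/cvgrPdist_le => e e0.
have [q [Q1 Q2]] : exists q : nat, `|V - g1 (hroot (2 / q.+2%:R))| <= e /\
    `|V - g2 (hroot (2 / q.+2%:R))| <= e.
  have := cvg_comp _ _ cvg_hroot_harmonic G1 => /cvgrPdist_le /(_ _ e0) N1.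
  have := cvg_comp _ _ cvg_hroot_harmonic G2 => /cvgrPdist_le /(_ _ e0) N2.
  have [q _ /(_ q (leqnn _)) [Q1 Q2]] := filterI N1 N2.
  by exists q.
have [n0 Hn0] := cnt_bounds V0 VF (isT : (2 <= q.+2)%N).
near=> n; have n1 : (0 < n)%N by near: n; exists 1%N.
have [|L U] := Hn0 n; first by near: n; exists n0.
have /= Kn := cnt_le n1; have cn0 := cnt_ge0 R b h2 n.
have qx : 2 / q.+2%:R <= hroot (2 / q.+2%:R).
  by apply: hroot_ge => //; rewrite divr_ge0 //= ler_pdivrMr ?ltr0n // mul1r ler_nat.
have qi0 : 0 < q.+2%:R^-1 :> R by rewrite invr_gt0 ltr0n.
set x := hroot _ in Q1 Q2 L U qx; set z := q.+2%:R^-1 in L U qx qi0.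
have pz : (1 + 2 * z) ^+ h <= (1 + x) ^+ h.
  by rewrite lerXn2r ?nnegrE ?lerD2l //; lra.
have p1 : 1 <= (1 + 2 * z) ^+ h by rewrite exprn_ege1 //; lra.
rewrite ler_norml; move: Q1 Q2; rewrite !ler_norml => /andP[Q1 _] /andP[_ Q2].
apply/andP; split.
  suff : cnt n <= g1 x by lra.
  apply: le_trans U _; rewrite /g1 lerD2l [leRHS]mulrC; apply: ler_pM => //.
  - by rewrite exprn_ge0 //; lra.
  - by rewrite mulr_ge0 //; lra.
  - by rewrite ler_wpM2l // lerD2l; lra.
suff : g2 x <= cnt n by lra.
have H1 : V * z <= V * x by rewrite ler_wpM2l //; lra.
have H2 : ((1 + 2 * z) ^+ h - 1) * cnt n <= ((1 + x) ^+ h - 1) * K2.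
  by apply: ler_pM => //; lra.
rewrite /g2; move: L; rewrite mulrBr mulr1; lra.
Unshelve. all: by end_near. Qed.

End limit_exists.

(** * The Gamma integral *)

Section gamma_cells.
Local Open Scope classical_set_scope.
Variables (R : realType) (h : nat).
Hypothesis h2 : (2 <= h)%N.
Local Notation hroot := (@hroot R h).
Local Notation wgt := (@wgt R h).
Local Notation mu := (@lebesgue_measure R).
Let alpha : R := h%:R^-1.
Let pw (x : R) : R := x `^ (alpha - 1).
Let gam (x : R) : R := pw x * expR (- x).

Let measurable_pw (D : set R) : measurable D -> measurable_fun D (EFin \o pw).
Proof.
move=> mD; apply/measurable_EFinP; apply: measurable_funTS.
exact: measurable_powR.
Qed.

Let measurable_gam (D : set R) : measurable D -> measurable_fun D (EFin \o gam).
Proof.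
move=> mD; apply/measurable_EFinP; apply: measurable_funTS.
apply: measurable_funM; first exact: measurable_powR.
by apply: measurableT_comp => //; exact: measurable_expR.
Qed.

Lemma is_derive_hroot (x : R) : 0 < x ->
  is_derive x (1 : R) (fun y : R => h%:R * hroot y) (pw x).
Proof.
move=> x0; have := is_derive1_powR alpha x0 => H.
have -> : pw x = h%:R *: (alpha * x `^ (alpha - 1)).
  rewrite /GRing.scale /= mulrA divff ?mul1r // gt_eqF //; exact: hR_gt0.
by apply: (@is_deriveZ _ _ _ (fun y : R => y `^ alpha)).
Qed.

Lemma integral_pw_pos a b : 0 < a -> a < b ->
  (\int[mu]_(x in `[a, b]) (pw x)%:E = (h%:R * hroot b - h%:R * hroot a)%:E)%E.
Proof.
move=> a0 ab; rewrite EFinB.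
have pos x : x \in `[a, b]%R -> 0 < x.
  by rewrite in_itv /= => /andP[ax _]; exact: lt_le_trans ax.
have pos' x : x \in `]a, b[%R -> 0 < x.
  by rewrite in_itv /= => /andP[ax _]; exact: lt_trans ax.
apply: (@continuous_FTC2 _ pw (fun x => h%:R * hroot x)) => //.
- apply: derivable_within_continuous => x /pos x0.
  by apply: (@ex_derive _ _ _ _ _ _ _ (is_derive1_powR (alpha - 1) x0)).
- have : {within `[a, b], continuous (fun x : R => h%:R * hroot x)}.
    apply: derivable_within_continuous => x /pos x0.
    exact: (@ex_derive _ _ _ _ _ _ _ (is_derive_hroot x0)).
  move=> /(continuous_within_itvP _ ab)[_ ca cb]; split=> // x /pos' x0.
  exact: (@ex_derive _ _ _ _ _ _ _ (is_derive_hroot x0)).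
- move=> x /pos' x0; rewrite derive1E.
  exact: (@derive_val _ _ _ _ _ _ _ (is_derive_hroot x0)).
Qed.

(** For [a = 0] the integrand is unbounded, so the fundamental theorem is applied on intervals that
    exhaust []0, b]], followed by monotone convergence. *)
Lemma integral_pw a b : 0 <= a -> a < b ->
  (\int[mu]_(x in `]a, b]) (pw x)%:E = (h%:R * hroot b - h%:R * hroot a)%:E)%E.
Proof.
rewrite le_eqVlt => /orP[/eqP <- b0|a0 ab]; last first.
  rewrite integral_itv_obnd_cbnd ?integral_pw_pos //.
  exact: measurable_pw.
(* The denominator starts at 2, which keeps every interval nondegenerate. *)
pose F (n : nat) : set R := `[b / n.+2%:R, b].
have FE : `]0, b] = \bigcup_n F n.
  apply/seteqP; split => x /=.
    rewrite in_itv /= => /andP[x0 xb].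
    have [n nx] : exists n : nat, b / x <= n.+2%:R.
      exists (Num.truncn (b / x)); rewrite ltW // (lt_le_trans (truncnS_gt _)) // ler_nat.
      by rewrite ltnS.
    exists n => //; rewrite /F /= in_itv /= xb andbT ler_pdivrMr ?ltr0n //.
    by rewrite mulrC -ler_pdivrMr.
  move=> [n _]; rewrite /F /= !in_itv /= => /andP[nx ->]; rewrite andbT.
  by apply: lt_le_trans nx; rewrite divr_gt0.
have ndF : nondecreasing_seq F.
  apply/nondecreasing_seqP => n; apply/subsetPset => x; rewrite /F /= !in_itv /=.
  move=> /andP[nx ->]; rewrite andbT; apply: le_trans nx.
  by rewrite ler_pM2l // lef_pV2 ?posrE ?ltr0n // ler_nat.
have H : (\int[mu]_(x in F i) (pw x)%:E)%E @[i --> \oo] --> (\int[mu]_(x in `]0%R, b]) (pw x)%:E)%E.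
  rewrite FE; apply: ge0_nondecreasing_set_cvg_integral => [//|n|n|n x _].
  - exact: measurable_itv.
  - by apply: measurable_pw; exact: measurable_itv.
  - by rewrite lee_fin powR_ge0.
have H2 : (h%:R * hroot b - h%:R * hroot (b / i.+2%:R))%:E @[i --> \oo] -->
    (h%:R * hroot b - h%:R * hroot 0)%:E.
  apply: cvg_EFin; first exact: nearW.
  apply: cvgB; first exact: cvg_cst.
  apply: cvgM; first exact: cvg_cst.
  rewrite hroot0 //.
  have -> : (fun i : nat => hroot (b / i.+2%:R)) = (fun i : nat => hroot (b / 2) * hroot (2 / i.+2%:R)).
    apply/funext => i; rewrite -hrootM ?divr_ge0 ?(ltW b0) //; congr hroot.
    by rewrite mulrA divfK.
  rewrite -(mulr0 (hroot (b / 2))); apply: cvgM; [exact: cvg_cst | exact: cvg_hroot_harmonic].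
apply: (cvg_unique _ H); first exact: ereal_hausdorff.
apply: cvg_trans H2; apply: near_eq_cvg; apply: nearW => n.
rewrite integral_pw_pos //; first by rewrite divr_gt0.
by rewrite ltr_pdivrMr ?ltr0n // ltr_pMr // ltr1n.
Qed.

Lemma integral_gam_cell a b : 0 <= a -> a < b ->
  ((expR (- b) * (h%:R * hroot b - h%:R * hroot a))%:E <=
     \int[mu]_(x in `]a, b]) (gam x)%:E <=
   (expR (- a) * (h%:R * hroot b - h%:R * hroot a))%:E)%E.
Proof.
move=> a0 ab.
have pwE e : (\int[mu]_(x in `]a, b]) (expR e * pw x)%:E =
   (expR e * (h%:R * hroot b - h%:R * hroot a))%:E)%E.
  rewrite EFinM -integral_pw // -ge0_integralZl //.
  - exact: measurable_pw.
  - by move=> x _; rewrite lee_fin powR_ge0.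
have mpw e : measurable_fun `]a, b] (EFin \o (fun x => expR e * pw x)).
  apply/measurable_EFinP; apply: measurable_funM => //.
  by have /measurable_EFinP := @measurable_pw `]a, b] (measurable_itv _).
rewrite -!pwE; apply/andP; split; apply: ge0_le_integral => //.
- by move=> x _; rewrite lee_fin mulr_ge0 ?expR_ge0 ?powR_ge0.
- exact: mpw.
- exact: measurable_gam.
- move=> x; rewrite /= in_itv /= => /andP[ax xb]; rewrite lee_fin mulrC ler_wpM2l ?powR_ge0 //.
  by rewrite ler_expR lerN2.
- by move=> x _; rewrite lee_fin mulr_ge0 ?expR_ge0 ?powR_ge0.
- exact: measurable_gam.
- exact: mpw.
- move=> x; rewrite /= in_itv /= => /andP[ax xb]; rewrite lee_fin [leRHS]mulrC ler_wpM2l ?powR_ge0 //.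
  by rewrite ler_expR lerN2 ltW.
Qed.

(** By homogeneity this is [e^(-c (k+1))] times the integral of [x^(1/h-1)] over the cell from [c k]
    to [c (k+1)]: a lower sum for the Gamma integral, and also a term of the generating function of
    [wgt] at [e^(-c)]. *)
Definition cell (c : R) (k : nat) : R := hroot c * (wgt k.+1 * expR (- (c * k.+1%:R))).

Lemma cell_ge0 c k : 0 <= cell c k.
Proof.
apply: mulr_ge0; first exact: hroot_ge0.
by apply: mulr_ge0; [exact: wgt_ge0 | exact: expR_ge0].
Qed.

Lemma gamma_series (c : R) : 0 < c ->
  (\int[mu]_(x in `]0%R, +oo[) (gam x)%:E =
   \sum_(k <oo) \int[mu]_(x in `](c * k%:R)%R, (c * k.+1%:R)%R]) (gam x)%:E)%E.
Proof.
move=> c0; pose F (k : nat) : set R := `](c * k%:R), (c * k.+1%:R)].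
have FE : `]0, +oo[ = \bigcup_k F k.
  apply/seteqP; split => x /=.
    rewrite in_itv /= andbT => x0.
    have xc0 : 0 <= x / c by rewrite divr_ge0 // ltW.
    pose P n := x <= c * n.+1%:R.
    have exP : exists n, P n.
      exists (Num.truncn (x / c)); rewrite /P mulrC -ler_pdivrMr //.
      by rewrite ltW // truncnS_gt.
    exists (ex_minn exP) => //; case: ex_minnP => m Pm mmin; rewrite /P in Pm.
    rewrite /F /= in_itv /= Pm andbT.
    case: m Pm mmin => [|m] Pm mmin; first by rewrite mulr0.
    by rewrite ltNge; apply/negP => xm; have := mmin m xm; rewrite ltnn.
  move=> [k _]; rewrite /F /= !in_itv /= andbT => /andP[+ _].
  by apply: le_lt_trans; rewrite mulr_ge0 // ltW.
rewrite FE ge0_integral_bigcup //=.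
- by move=> k; exact: measurable_itv.
- by rewrite -FE; exact: measurable_gam.
- by move=> x _; rewrite lee_fin mulr_ge0 ?expR_ge0 ?powR_ge0.
- apply/trivIsetP => i j _ _; wlog ij : i j / (i < j)%N => [H|_].
    move=> ne; have [ij|ij] := ltnP i j; first exact: H.
    by rewrite setIC H // ?(eq_sym j) // ltn_neqAle eq_sym ne.
  apply/seteqP; split => x //; rewrite /F /= !in_itv /= => -[/andP[_ xi] /andP[jx _]].
  have := le_lt_trans (le_trans xi _) jx.
  by rewrite ler_pM2l // ler_nat ij ltxx => /(_ isT).
Qed.

Lemma cell_bounds (c : R) k : 0 < c ->
  ((cell c k)%:E <= \int[mu]_(x in `](c * k%:R)%R, (c * k.+1%:R)%R]) (gam x)%:E <=
   (expR c * cell c k)%:E)%E.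
Proof.
move=> c0; have c00 := ltW c0.
have := @integral_gam_cell (c * k%:R) (c * k.+1%:R); rewrite mulr_ge0 // ltr_pM2l // ltr_nat ltnSn.
move=> /(_ isT isT).
have -> : expR (- (c * k.+1%:R)) * (h%:R * hroot (c * k.+1%:R) - h%:R * hroot (c * k%:R)) = cell c k.
  by rewrite /cell /wgt !hrootM //=; ring.
have -> : expR (- (c * k%:R)) * (h%:R * hroot (c * k.+1%:R) - h%:R * hroot (c * k%:R)) = expR c * cell c k.
  have -> : - (c * k%:R) = c + - (c * k.+1%:R) :> R by rewrite -natr1; ring.
  by rewrite expRD /cell /wgt !hrootM //=; ring.
by [].
Qed.

(** A geometric majorant, which makes the Gamma integral finite, so that [fine] in its definition
    loses nothing. *)
Lemma sum_cell_bound (c : R) : 0 < c -> exists2 B : R, 0 <= B & forall K,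
  \sum_(k < K) cell c k <= B.
Proof.
move=> c0; pose r := expR (- c).
have r1 : r < 1 by rewrite expR_lt1 oppr_lt0.
have r0 : 0 < r by exact: expR_gt0.
exists (hroot c * h%:R / (1 - r)).
  by rewrite divr_ge0 ?mulr_ge0 ?hroot_ge0 // subr_ge0 ltW.
move=> K; apply: (@le_trans _ _ (\sum_(k < K) hroot c * h%:R * r ^+ k)).
  apply: ler_sum => k _; rewrite /cell mulrA; apply: ler_pM.
  - by rewrite mulr_ge0 ?hroot_ge0 ?wgt_ge0.
  - exact: expR_ge0.
  - rewrite ler_wpM2l ?hroot_ge0 //.
    by apply: le_trans (wgt_le_wgt1 R h _) (wgt1_le R h2 _).
  - rewrite /r -expRM_natl mulrN ler_expR lerN2 mulrC ler_wpM2l ?(ltW c0) //.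
    by rewrite ler_nat.
rewrite -mulr_sumr ler_wpM2l ?mulr_ge0 ?hroot_ge0 //.
have := subrX1 r K => E.
have : (1 - r) * \sum_(k < K) r ^+ k = 1 - r ^+ K by rewrite -[RHS]opprB E; ring.
move=> H; rewrite -[leRHS]mul1r ler_pdivlMr ?subr_gt0 // mulrC H.
by rewrite lerBlDr lerDl exprn_ge0 // ltW.
Qed.

Lemma Gamma_le (c B : R) : 0 < c -> (forall K, \sum_(k < K) cell c k <= B) ->
  (\int[mu]_(x in `]0%R, +oo[) (gam x)%:E <= (expR c * B)%:E)%E.
Proof.
move=> c0 HB; rewrite (gamma_series c0).
apply: (@le_trans _ _ (\sum_(k <oo) (expR c * cell c k)%:E)%E).
  apply: lee_nneseries => [k _ _|k _].
    by apply: integral_ge0 => x _; rewrite lee_fin mulr_ge0 ?expR_ge0 ?powR_ge0.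
  by have /andP[] := cell_bounds k c0.
apply: lime_le.
  by apply: is_cvg_nneseries => k _ _; rewrite lee_fin mulr_ge0 ?expR_ge0 ?cell_ge0.
apply: nearW => K; rewrite sumEFin lee_fin -mulr_sumr ler_wpM2l ?expR_ge0 //.
by rewrite big_mkord.
Qed.

Lemma Gamma_fin : (\int[mu]_(x in `]0%R, +oo[) (gam x)%:E \is a fin_num)%E.
Proof.
have [B B0 HB] := @sum_cell_bound 1 ltr01.
rewrite ge0_fin_numE; last first.
  by apply: integral_ge0 => x _; rewrite lee_fin mulr_ge0 ?expR_ge0 ?powR_ge0.
by apply: le_lt_trans (Gamma_le ltr01 HB) _; rewrite ltry.
Qed.

Lemma GammaE : (Gamma (h%:R^-1 : R))%:E = (\int[mu]_(x in `]0%R, +oo[) (gam x)%:E)%E.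
Proof. by rewrite /Gamma fineK //; exact: Gamma_fin. Qed.

Lemma sum_cell_le_Gamma c K : 0 < c -> \sum_(k < K) cell c k <= Gamma (h%:R^-1 : R).
Proof.
move=> c0; rewrite -lee_fin GammaE (gamma_series c0).
apply: le_trans (nneseries_lim_ge K _); last first.
  by move=> k _ _; apply: integral_ge0 => x _; rewrite lee_fin mulr_ge0 ?expR_ge0 ?powR_ge0.
rewrite big_mkord -sumEFin; apply: lee_sum => k _.
by have /andP[] := cell_bounds k c0.
Qed.

Lemma Gamma_le_cells c B : 0 < c -> (forall K, \sum_(k < K) cell c k <= B) ->
  Gamma (h%:R^-1 : R) <= expR c * B.
Proof. by move=> c0 HB; rewrite -lee_fin GammaE; exact: Gamma_le. Qed.

Lemma Gamma_gt0 : 0 < Gamma (h%:R^-1 : R).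
Proof.
apply: lt_le_trans (sum_cell_le_Gamma 1 ltr01); rewrite big_ord1 /cell hroot1 mul1r.
rewrite mulr_gt0 ?expR_gt0 //; apply: lt_le_trans (wgt_ge R h2 _) => //.
by rewrite divr_gt0 ?hroot_gt0.
Qed.

End gamma_cells.

(** The limit [x --> 0], packaged for the comparison of the two generating functions. *)
Lemma le_of_small (R : realType) (a c C : R) : 0 <= a -> 0 <= C ->
  (forall x, 0 < x < 1 -> a * (1 - x * C) <= c) -> a <= c.
Proof.
move=> a0 C0 H; apply/ler_addgt0Pr => e e0.
have aC : 0 <= a * C by rewrite mulr_ge0.
pose x := e / (a * C + e + 1).
have den : 0 < a * C + e + 1 by lra.
have x0 : 0 < x by rewrite divr_gt0.
have x1 : x < 1 by rewrite ltr_pdivrMr //; lra.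
have := H x; rewrite x0 x1 => /(_ isT).
have : a * C * x <= e.
  rewrite /x mulrA ler_pdivrMr // [leLHS]mulrC ler_wpM2l ?(ltW e0) //; lra.
lra.
Qed.

(** * Generating functions *)

Section laplace.
Variables (R : realType) (h : nat) (b : nat -> nat).
Hypothesis h2 : (2 <= h)%N.
Hypothesis b0 : forall i, (i < h)%N -> (0 < b i)%N.
Local Notation hroot := (@hroot R h).
Local Notation wgt := (@wgt R h).
Local Notation bsum := (bsum h b).
Local Notation cnt := (cnt R h b).
Local Notation cumul := (cumul R h b).
Local Notation tsum := (@tsum R h).
Local Notation wprod := (@wprod R h).
Local Notation dotn := (@dotn h b).
Local Notation cell := (@cell R h).
Local Notation G := (Gamma (h%:R^-1 : R)).

Lemma tsum_le_widen M N (F : {ffun 'I_h -> nat} -> R) : (M <= N)%N ->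
  (forall k, 0 <= F k) -> tsum M F <= tsum N F.
Proof.
move=> MN F0; pose F' (k : {ffun 'I_h -> nat}) := if [forall i, k i <= M]%N then F k else 0.
have -> : tsum M F = tsum M F'.
  apply: eq_bigr => k _; rewrite /F' ifT //; apply/forallP => i.
  by rewrite ffunE -ltnS.
rewrite -(@tsum_widen R h M N F') //.
  by apply: ler_sum => k _; rewrite /F'; case: ifP.
move=> k [i ki]; rewrite /F'; case: forallP => // /(_ i).
by rewrite leqNgt ki.
Qed.

Definition genp (r : R) (N : nat) : R := \sum_(n < N.+1) cnt n * r ^+ n.
Definition truncp (r : R) (K : nat) : R := \prod_(i < h) \sum_(x < K.+1) wgt x * r ^+ (b i * x).

Lemma truncpE r K : truncp r K = tsum K (fun k => wprod k * r ^+ dotn k).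
Proof.
rewrite /truncp (bigA_distr_bigA (fun (i : 'I_h) (x : 'I_K.+1) => wgt x * r ^+ (b i * x))) /=.
apply: eq_bigr => k _; rewrite big_split /= wprod_natv dot_natv; congr (_ * _).
by rewrite -expr_sum.
Qed.

(** A vector with [b . k <= K] has all entries at most [K]. Together with the converse inclusion in
    [truncp_le_genp] this keeps all generating functions finite. *)
Lemma genp_le_truncp r K : 0 <= r -> genp r K <= truncp r K.
Proof.
move=> r0; rewrite truncpE /genp.
have E (n : 'I_K.+1) : cnt n * r ^+ n =
    tsum K (fun k => if dotn k == n then wprod k * r ^+ n else 0).
  have nK : (n <= K)%N by rewrite -ltnS.
  rewrite -(@cnt_widen R h b h2 b0 K n) // mulr_suml; apply: eq_bigr => k _.
  by case: ifP; rewrite ?mul0r.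
under eq_bigr do rewrite E.
rewrite exchange_big /=; apply: ler_sum => k _.
have [kK|kK] := ltnP (dotn (natv k)) K.+1.
  rewrite (bigD1 (Ordinal kK)) //= eqxx big1 ?addr0 // => n /negbTE nk.
  by move: nk; rewrite -val_eqE /= eq_sym => ->.
rewrite big1 ?mulr_ge0 ?exprn_ge0 ?wprod_ge0 // => n _; case: eqP => // E'.
by have := ltn_ord n; rewrite -E' ltnNge kK.
Qed.

Lemma truncp_le_genp r K : 0 <= r -> truncp r K <= genp r (bsum * K).
Proof.
move=> r0; rewrite truncpE /genp.
apply: (@le_trans _ _ (\sum_(n < (bsum * K).+1)
    tsum K (fun k => if dotn k == n then wprod k * r ^+ n else 0))).
  rewrite exchange_big /=; apply: ler_sum => k _.
  have kK : (dotn (natv k) < (bsum * K).+1)%N.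
    rewrite ltnS /dotn /bsum big_distrl /=; apply: leq_sum => i _.
    by rewrite leq_mul2l ffunE -ltnS ltn_ord orbT.
  rewrite (bigD1 (Ordinal kK)) //= eqxx lerDl; apply: sumr_ge0 => n _.
  by case: ifP => // _; rewrite mulr_ge0 ?exprn_ge0 ?wprod_ge0.
apply: ler_sum => n _.
have -> : tsum K (fun k => if dotn k == n then wprod k * r ^+ n else 0) =
    tsum K (fun k => if dotn k == n then wprod k else 0) * r ^+ n.
  by rewrite mulr_suml; apply: eq_bigr => k _; case: ifP; rewrite ?mul0r.
rewrite ler_wpM2r ?exprn_ge0 //.
have [nK|/ltnW nK] := leqP n K; first by rewrite cnt_widen.
by apply: tsum_le_widen => // k; case: ifP => // _; exact: wprod_ge0.
Qed.

(** Summation by parts carries the estimate of [cumul] over to the generating function of [cnt]. *)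
Lemma genp_abel r N :
  genp r N = (1 - r) * (\sum_(n < N) cumul n * r ^+ n) + cumul N * r ^+ N.
Proof.
elim: N => [|N IH].
  by rewrite /genp big_ord_recl !big_ord0 /= cnt0 // cumul0 //; ring.
rewrite /genp big_ord_recr /= -/(genp r N) IH cumulS // big_ord_recr /= exprS; ring.
Qed.

(** The model case: coefficient 1 at every [n >= 1], with summatory function [n]. *)
Definition geo (r : R) (N : nat) : R := \sum_(n < N) r ^+ n.+1.

Lemma geo_abel r N : geo r N = (1 - r) * (\sum_(n < N) n%:R * r ^+ n) + N%:R * r ^+ N.
Proof.
elim: N => [|N IH]; first by rewrite /geo !big_ord0; ring.
rewrite /geo big_ord_recr /= -/(geo r N) IH big_ord_recr /= -natr1 exprS; ring.
Qed.

Lemma one_abel (r : R) N : 1 = (1 - r) * (\sum_(n < N) r ^+ n) + r ^+ N.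
Proof.
elim: N => [|N IH]; first by rewrite big_ord0 expr0; ring.
by rewrite big_ord_recr /= exprS {1}IH; ring.
Qed.

Lemma geo_closed r N : (1 - r) * geo r N = r * (1 - r ^+ N).
Proof.
elim: N => [|N IH]; first by rewrite /geo big_ord0 expr0; ring.
by rewrite /geo big_ord_recr /= -/(geo r N) mulrDr IH exprS; ring.
Qed.

Variable V : R.
Hypothesis V0 : 0 <= V.
Hypothesis VF : forall n, V * (n%:R - bsum%:R) <= cumul n <= V * n%:R.

Lemma genp_bounds r N : 0 <= r <= 1 ->
  V * (geo r N - bsum%:R) <= genp r N <= V * geo r N.
Proof.
move=> /andP[r0 r1]; have r2 : 0 <= 1 - r by lra.
rewrite genp_abel; apply/andP; split.
  have -> : V * (geo r N - bsum%:R) =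
      (1 - r) * (\sum_(n < N) V * (n%:R - bsum%:R) * r ^+ n) + V * (N%:R - bsum%:R) * r ^+ N.
    have EB : bsum%:R = bsum%:R * ((1 - r) * (\sum_(n < N) r ^+ n) + r ^+ N).
      by rewrite -one_abel mulr1.
    rewrite geo_abel [X in V * (_ - X)]EB.
    have -> : \sum_(n < N) V * (n%:R - bsum%:R) * r ^+ n =
      V * (\sum_(n < N) n%:R * r ^+ n) - V * bsum%:R * \sum_(n < N) r ^+ n.
      by rewrite !mulr_sumr -sumrB; apply: eq_bigr => n _; ring.
    by ring.
  apply: lerD.
    apply: ler_wpM2l => //; apply: ler_sum => n _; rewrite ler_wpM2r ?exprn_ge0 //.
    by have /andP[] := VF n.
  by rewrite ler_wpM2r ?exprn_ge0 //; have /andP[] := VF N.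
have -> : V * geo r N = (1 - r) * (\sum_(n < N) V * n%:R * r ^+ n) + V * N%:R * r ^+ N.
  rewrite geo_abel.
  have -> : \sum_(n < N) V * n%:R * r ^+ n = V * \sum_(n < N) n%:R * r ^+ n.
    by rewrite mulr_sumr; apply: eq_bigr => n _; ring.
  by ring.
apply: lerD.
  apply: ler_wpM2l => //; apply: ler_sum => n _; rewrite ler_wpM2r ?exprn_ge0 //.
  by have /andP[] := VF n.
by rewrite ler_wpM2r ?exprn_ge0 //; have /andP[] := VF N.
Qed.

Let pb : R := \prod_(i < h) hroot (b i)%:R.

Lemma pb_gt0 : 0 < pb.
Proof. by apply: prodr_gt0 => i _; rewrite hroot_gt0 // ltr0n b0. Qed.

(** Cells of width [b i * z] in coordinate [i] turn [e^(-z)] raised to [b i * x] into the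
    exponential at a cell end, and the factors [(b i * z)^(1/h)] multiply to [pb * z]. *)
Lemma prod_cells z K : 0 < z ->
  \prod_(i < h) (\sum_(k < K) cell ((b i)%:R * z) k) = pb * z * truncp (expR (- z)) K.
Proof.
move=> z0; have zE : z = \prod_(i < h) hroot z.
  by rewrite prodr_const card_ord hroot_exp // ltW.
rewrite [X in pb * X * _]zE /pb.
rewrite -!big_split /=; apply: eq_bigr => i _.
rewrite [in RHS]big_ord_recl wgt0 mul0r add0r mulr_sumr; apply: eq_bigr => k _.
rewrite /cell hrootM ?(ltW z0) // lift0; congr (_ * (_ * _)).
by rewrite -expRM_natl; congr expR; rewrite natrM; ring.
Qed.

(** In closed form [z geo = z r (1 - r^K) / (1 - r)] with [r = e^(-z)], and [z r <= 1 - r <= z]. *)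
Lemma geo_expR_bounds z K : 0 < z ->
  expR (- z) * (1 - expR (- z) ^+ K) <= z * geo (expR (- z)) K <= 1.
Proof.
move=> z0; have r1 : expR (- z) < 1 by rewrite expR_lt1 oppr_lt0.
have r0 : 0 < expR (- z) by exact: expR_gt0.
set r := expR (- z) in r1 r0 *.
have g0 : 0 <= geo r K by apply: sumr_ge0 => n _; rewrite exprn_ge0 // ltW.
have rK : 0 <= r ^+ K by rewrite exprn_ge0 // ltW.
have zr : 1 - r <= z by have := expR_ge1Dx (- z); rewrite -/r; lra.
have zr' : z * r <= 1 - r.
  have := expR_ge1Dx z; have : expR z * r = 1 by rewrite /r -expRD subrr expR0.
  move=> E /(ler_wpM2r (ltW r0)); rewrite E; lra.
apply/andP; split.
  by rewrite -geo_closed; exact: ler_wpM2r.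
have : (1 - r) * (z * geo r K) <= (1 - r) * 1.
  have -> : (1 - r) * (z * geo r K) = z * r * (1 - r ^+ K).
    by rewrite mulrCA geo_closed; ring.
  apply: le_trans (_ : z * r * 1 <= _); last by rewrite !mulr1.
  by apply: ler_wpM2l; [rewrite mulr_ge0 // ltW | lra].
by rewrite ler_pM2l // subr_gt0.
Qed.

Lemma sum_cell_mono c K K' : (K <= K')%N ->
  \sum_(k < K) cell c k <= \sum_(k < K') cell c k.
Proof.
move=> KK'; rewrite -!(big_mkord xpredT (cell c)) (@big_cat_nat _ _ _ K 0 K') //= lerDl.
by apply: sumr_ge0 => k _; exact: cell_ge0.
Qed.

(** Lower sums never exceed the Gamma integral. Letting [K] tend to infinity at fixed [z] leaves
    [e^(-z) - z bsum >= 1 - z (1 + bsum)]. *)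
Lemma V_le_Gamma : pb * V <= G ^+ h.
Proof.
apply: (@le_of_small _ _ _ (1 + bsum%:R)).
- by rewrite mulr_ge0 // ltW // pb_gt0.
- by rewrite addr_ge0.
move=> z /andP[z0 z1].
have r1 : expR (- z) < 1 by rewrite expR_lt1 oppr_lt0.
have r0 : 0 < expR (- z) by exact: expR_gt0.
have HK K : pb * V * (expR (- z) * (1 - expR (- z) ^+ K) - z * bsum%:R) <= G ^+ h.
  apply: (@le_trans _ _ (\prod_(i < h) (\sum_(k < K) cell ((b i)%:R * z) k))); last first.
    rewrite -[X in _ ^+ X](card_ord h) -prodr_const; apply: ler_prod => i _.
    rewrite sum_cell_le_Gamma ?andbT //; last by rewrite mulr_gt0 // ltr0n b0.
    by apply: sumr_ge0 => k _; exact: cell_ge0.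
  rewrite prod_cells // -!mulrA ler_wpM2l ?(ltW pb_gt0) //.
  have r01 : 0 <= expR (- z) <= 1 by rewrite !ltW.
  have /andP[H1 _] := genp_bounds K r01.
  have H2 := genp_le_truncp K (ltW r0).
  apply: le_trans (ler_wpM2l (ltW z0) (le_trans H1 H2)).
  rewrite [leRHS]mulrCA ler_wpM2l // [leRHS]mulrBr lerD2r.
  by have /andP[] := geo_expR_bounds K z0.
have r_lim : ((fun K => pb * V * (expR (- z) * (1 - expR (- z) ^+ K) - z * bsum%:R)) @ \oo -->
   pb * V * (expR (- z) * (1 - 0) - z * bsum%:R))%classic.
  apply: cvgM; first exact: cvg_cst.
  apply: cvgB; last exact: cvg_cst.
  apply: cvgM; first exact: cvg_cst.
  apply: cvgB; first exact: cvg_cst.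
  by apply: cvg_expr; rewrite ger0_norm // ltW.
have lim_le : pb * V * (expR (- z) * (1 - 0) - z * bsum%:R) <= G ^+ h.
  rewrite -(cvg_lim _ r_lim) //; apply: limr_le; first exact: cvgP r_lim.
  exact: nearW.
apply: le_trans lim_le; rewrite ler_wpM2l //; first by rewrite mulr_ge0 // ltW // pb_gt0.
by have := expR_ge1Dx (- z); lra.
Qed.

(** Finitely many cells already reach the part [(1 - z) e^(-b_i z)] of the Gamma integral; the
    product of these parts is at least [(1 - z)^(h + bsum)]. *)
Lemma Gamma_le_V : G ^+ h <= pb * V.
Proof.
have G0 : 0 < G := Gamma_gt0 R h2.
apply: (@le_of_small _ _ _ (h + bsum)%:R) => //; first by rewrite exprn_ge0 // ltW.
move=> z /andP[z0 z1].
have step i : (i < h)%N -> exists K, (1 - z) * expR (- ((b i)%:R * z)) * G <=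
    \sum_(k < K) cell ((b i)%:R * z) k.
  move=> ih; have c0 : 0 < (b i)%:R * z by rewrite mulr_gt0 // ltr0n b0.
  (* If all partial sums stayed below this bound, the upper estimate would give [G <= (1 - z) G]. *)
  apply: contrapT => /forallNP H.
  have := @Gamma_le_cells R h h2 _ ((1 - z) * expR (- ((b i)%:R * z)) * G) c0.
  have HK K : \sum_(k < K) cell ((b i)%:R * z) k <= (1 - z) * expR (- ((b i)%:R * z)) * G.
    by have /negP := H K; rewrite -ltNge => /ltW.
  move=> /(_ HK); set c := _ * z.
  have -> : expR c * ((1 - z) * expR (- c) * G) = expR c * expR (- c) * ((1 - z) * G) by ring.
  rewrite -expRD subrr expR0 mul1r.
  by have := mulr_gt0 z0 G0; lra.
have [Kf HKf] : exists Kf : 'I_h -> nat, forall i : 'I_h,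
    (1 - z) * expR (- ((b i)%:R * z)) * G <= \sum_(k < Kf i) cell ((b i)%:R * z) k.
  have step' (i : 'I_h) := step i (ltn_ord i).
  by have [Kf HKf] := fin_all_exists step'; exists Kf.
pose K := (\max_i Kf i)%N.
have HK : \prod_(i < h) ((1 - z) * expR (- ((b i)%:R * z)) * G) <=
    \prod_(i < h) (\sum_(k < K) cell ((b i)%:R * z) k).
  apply: ler_prod => i _; rewrite !mulr_ge0 ?expR_ge0 ?(ltW G0) ?subr_ge0 ?(ltW z1) //=.
  by apply: le_trans (HKf i) _; apply: sum_cell_mono; exact: leq_bigmax.
have r1 : expR (- z) < 1 by rewrite expR_lt1 oppr_lt0.
have r0 : 0 < expR (- z) by exact: expR_gt0.
have r01 : 0 <= expR (- z) <= 1 by rewrite !ltW.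
have up : pb * z * truncp (expR (- z)) K <= pb * V.
  rewrite -mulrA ler_wpM2l ?(ltW pb_gt0) //.
  have /andP[_ H1] := genp_bounds (bsum * K) r01.
  have H2 := truncp_le_genp K (ltW r0).
  apply: le_trans (ler_wpM2l (ltW z0) (le_trans H2 H1)) _.
  rewrite mulrCA -[leRHS]mulr1 ler_wpM2l //.
  by have /andP[] := geo_expR_bounds (bsum * K) z0.
rewrite prod_cells // in HK; apply: le_trans (le_trans HK up).
rewrite !big_split /= !prodr_const card_ord [leRHS]mulrC ler_wpM2l ?exprn_ge0 ?(ltW G0) //.
have -> : \prod_(i < h) expR (- ((b i)%:R * z)) = expR (- z) ^+ bsum.
  rewrite /bsum expr_sum; apply: eq_bigr => i _.
  by rewrite -expRM_natl mulrN.
have e1 : 1 - z <= expR (- z) by have := expR_ge1Dx (- z); lra.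
apply: (@le_trans _ _ ((1 - z) ^+ (h + bsum))).
  have zm : -1 <= - z by lra.
  by have := bernoulli_ineq (h + bsum) zm; lra.
rewrite exprD ler_wpM2l ?exprn_ge0 ?subr_ge0 ?(ltW z1) // lerXn2r // nnegrE; last exact: ltW.
by rewrite subr_ge0 ltW.
Qed.

Lemma V_eq : V = G ^+ h / pb.
Proof.
have pb0 := pb_gt0.
have : pb * V = G ^+ h by apply/eqP; rewrite eq_le V_le_Gamma Gamma_le_V.
by move=> <-; rewrite mulrAC divff ?mul1r // gt_eqF.
Qed.

End laplace.

Lemma cnt_cvg_Gamma (R : realType) (h : nat) (b : nat -> nat) : (2 <= h)%N ->
  (forall i, (i < h)%N -> (0 < b i)%N) -> (\big[gcdn/0]_(i < h) b i = 1)%N ->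
  (cnt R h b @ \oo --> Gamma (h%:R^-1 : R) ^+ h / \prod_(i < h) hroot h (b i)%:R)%classic.
Proof.
move=> h2 b0 g1; have [V V0 VF] := cumul_linear R h2 b0.
rewrite -(V_eq h2 b0 V0 VF); exact: cnt_cvg.
Qed.

(** * Second moment of the number of gaps *)

Section second_moment.
Variables (R : realType) (h : nat) (b : nat -> nat).
Hypothesis h2 : (2 <= h)%N.
Hypothesis b0 : forall i, (i < h)%N -> (0 < b i)%N.
Variables (p : nat -> R) (M : nat) (Lam : R).
Hypothesis p01 : forall n, 0 <= p n <= 1.
Hypothesis Lam1 : 1 <= Lam.
Hypothesis pLam : forall x, (x <= M)%N -> p x <= Lam * wgt1 R h x.
Local Notation hroot := (@hroot R h).
Local Notation hrootm := (@hrootm R h).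
Local Notation dot := (@dot h b _).
Local Notation omega := (@omega R h _).
Local Notation wt := (@wt R p M.+1).
Local Notation K4 := (K4 R h b).
Local Notation ivec := {ffun 'I_h -> 'I_M.+1}.

(** Tuples with the same set of values are merged: they require the same coins, and Janson's
    inequality is applied to distinct sets. *)
Definition reps (n : nat) : {set {set 'I_M.+1}} :=
  finset (fun X => [exists k : ivec, (dot k == n) && (img k == X)]).

Definition fam (n : nat) : seq {set 'I_M.+1} := enum (reps n).

Lemma fam_uniq n : uniq (fam n). Proof. exact: enum_uniq. Qed.

Lemma famP n X : reflect (exists2 k : ivec, dot k = n & img k = X) (X \in fam n).
Proof.
rewrite mem_enum inE; apply: (iffP existsP) => [[k /andP[/eqP kn /eqP kX]]|[k kn kX]].
  by exists k.
by exists k; rewrite kn kX !eqxx.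
Qed.

Lemma sum_fam_le n (F : {set 'I_M.+1} -> R) : (forall X, 0 <= F X) ->
  \sum_(X <- fam n) F X <= \sum_(k : ivec | dot k == n) F (img k).
Proof.
move=> F0; rewrite big_enum /=.
rewrite [leRHS](partition_big (@img _ _) (mem (reps n))) /=; last first.
  by move=> k kn; rewrite inE; apply/existsP; exists k; rewrite kn eqxx.
apply: ler_sum => X; rewrite inE => /existsP[k /andP[kn /eqP kX]].
rewrite (bigD1 k) /=; last by rewrite kn kX eqxx.
by rewrite kX lerDl; apply: sumr_ge0.
Qed.

(** Equal sets are excluded only when [n = m]. For [n != m] they count, so the same sum also bounds
    the sets that represent both numbers. *)
Definition npairs (n m : nat) : R :=
  \sum_(k : ivec | dot k == n)
  \sum_(q : ivec | [&& dot q == m, ~~ [disjoint img k & img q]%B &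
           (n != m) || (img k != img q)])
    wt (img k :|: img q).

Lemma sum_fam_pairs_le n m :
  \sum_(X <- fam n) \sum_(Y <- fam m | (Y != X) && ~~ [disjoint X & Y]%B) wt (X :|: Y)
  <= npairs n m.
Proof.
have w0 X : 0 <= wt X by exact: wt_ge0.
apply: le_trans (sum_fam_le _ _) _; first by move=> X; exact: sumr_ge0.
apply: ler_sum => k _; rewrite big_mkcond /=.
apply: le_trans (sum_fam_le _ _) _; first by move=> X; case: ifP.
rewrite big_mkcond [leRHS]big_mkcond /=; apply: ler_sum => q _.
case: (_ == m) => //=; case: eqP => [->|/eqP ne] /=; first by case: ifP.
by rewrite [img k == _]eq_sym ne orbT andbT.
Qed.

Lemma sum_fam_inter_le n m : n != m ->
  \sum_(X <- fam n | X \in fam m) wt X <= npairs n m.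
Proof.
move=> nm; have w0 X : 0 <= wt X by exact: wt_ge0.
rewrite big_mkcond /=; apply: le_trans (sum_fam_le _ _) _; first by move=> X; case: ifP.
apply: ler_sum => k _; case: famP => [[q qm qk]|_]; last exact: sumr_ge0.
have h0 : (0 < h)%N by lia.
rewrite (bigD1 q) /=; last first.
  rewrite qm eqxx nm qk /= andbT; apply/pred0Pn; exists (k (Ordinal h0)).
  by rewrite /= mem_img.
by rewrite qk finset.setUid lerDl; apply: sumr_ge0.
Qed.

Lemma wt_le_omega (X : {set 'I_M.+1}) t : (#|X| <= t)%N -> wt X <= Lam ^+ t * omega X.
Proof.
move=> Xt; apply: (@le_trans _ _ (\prod_(x in X) (Lam * wgt1 R h x))).
  apply: ler_prod => x _; have /andP[-> _] := p01 x.
  by rewrite pLam // -ltnS.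
rewrite big_split /= prodr_const ler_wpM2r ?omega_ge0 //.
by rewrite ler_weXn2l.
Qed.

Lemma npairs_le n m tau : (0 < n)%N -> (0 < tau)%N ->
  npairs n m <= Lam ^+ (h + h) * (K4 * ((hrootm tau)^-1 + tau%:R / hroot n%:R)).
Proof.
move=> n0 tau0; have L0 : 0 <= Lam ^+ (h + h) by rewrite exprn_ge0 // (le_trans ler01).
apply: le_trans (ler_wpM2l L0 (sum_pairs_le R h2 b0 M m n0 tau0)).
rewrite mulr_sumr; apply: ler_sum => k _; rewrite mulr_sumr; apply: ler_sum => q _.
apply: wt_le_omega; rewrite cardsU (leq_trans (leq_subr _ _)) //.
by rewrite leq_add ?card_img.
Qed.

Definition pzero (n : nat) : R := Ex p M.+1 (avoid R (fam n)).
Definition mean (n : nat) : R := \sum_(X <- fam n) wt X.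

Lemma mean_ge0 n : 0 <= mean n.
Proof. by apply: sumr_ge0 => X _; exact: wt_ge0. Qed.

(** Harris' product bound, with [1 - x >= e^(-x (1 + 2 rh))] for [0 <= x <= rh <= 1/2]. *)
Lemma pzero_ge n (rh : R) : 0 <= rh <= 1/2 -> (forall X, X \in fam n -> wt X <= rh) ->
  expR (- (mean n * (1 + 2 * rh))) <= pzero n.
Proof.
move=> /andP[r0 r1] wr; apply: le_trans (harris_avoid p01 _).
rewrite /mean mulr_suml -sumrN expR_sum.
rewrite big_seq [leRHS]big_seq; apply: ler_prod => X /wr; rewrite expR_ge0 /=.
have := @wt_ge0 R p p01 _ X; move: (wt X) => x x0 xr.
have x1 : 0 < 1 - x by lra.
have : (1 - x)^-1 <= expR (x * (1 + 2 * rh)).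
  apply: le_trans (_ : 1 + x * (1 + 2 * rh) <= _); last exact: expR_ge1Dx.
  rewrite -[leLHS]mul1r ler_pdivrMr //; nra.
move=> H; rewrite expRN -[leRHS]invrK lef_pV2 ?posrE ?invr_gt0 //.
exact: expR_gt0.
Qed.

(** Janson's inequality for the union of the two families. Of the five error terms, one pays for the
    sets common to both families and four for the overlapping pairs within and between them. *)
Lemma pzero_pair_le n m tau N : n != m -> (N <= n)%N -> (N <= m)%N -> (0 < N)%N -> (0 < tau)%N ->
  Ex p M.+1 (fun A => avoid R (fam n) A * avoid R (fam m) A) <=
  expR (- mean n - mean m +
    5 * (Lam ^+ (h + h) * (K4 * ((hrootm tau)^-1 + tau%:R / hroot N%:R)))).
Proof.
move=> nm Nn Nm N0 tau0; set D := Lam ^+ _ * _.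
have K40 := K4_ge0 R h2 b0.
have L0 : 0 <= Lam ^+ (h + h) by rewrite exprn_ge0 // (le_trans ler01).
have npD n' m' : (N <= n')%N -> npairs n' m' <= D.
  move=> Nn'; have n'0 := leq_trans N0 Nn'.
  apply: le_trans (npairs_le m' n'0 tau0) _.
  apply: ler_wpM2l => //; apply: ler_wpM2l => //; rewrite lerD2l ler_wpM2l //.
  by rewrite lef_pV2 ?posrE ?hroot_gt0 ?ltr0n // le_hroot // ler_nat.
(* Common sets are listed once, to keep the joined family duplicate-free. *)
pose Fm := [seq X <- fam m | X \notin fam n].
pose F := fam n ++ Fm.
have uF : uniq F.
  rewrite cat_uniq fam_uniq filter_uniq ?fam_uniq // andbT.
  by apply/hasPn => X; rewrite mem_filter => /andP[].
have av A : avoid R (fam n) A * avoid R (fam m) A <= avoid R F A.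
  rewrite /F {3}/avoid big_cat /= ler_wpM2l ?avoid_ge0 //.
  rewrite /avoid /Fm [leRHS]big_filter [leLHS](bigID (fun X => X \in fam n)) /=.
  apply: ler_piMl; first by apply: prodr_ge0 => X _; rewrite subr_ge0 ind_le1.
  apply: numdomain.Num.Theory.prodr_ile1 => X _.
  by rewrite subr_ge0 ind_le1 lerBlDr lerDl ind_ge0.
apply: le_trans (Ex_le p01 _ av) _; apply: le_trans (janson p01 uF) _.
rewrite ler_expR.
have w0 X : 0 <= wt X by exact: wt_ge0.
have mE : \sum_(X <- F) wt X = mean n + mean m - \sum_(X <- fam m | X \in fam n) wt X.
  rewrite /F big_cat /= /Fm [X in _ + X]big_filter /= [mean m](bigID (fun X => X \in fam n)) /=.
  by rewrite /mean; ring.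
have I1 : \sum_(X <- fam m | X \in fam n) wt X <= D.
  by apply: le_trans (sum_fam_inter_le _) (npD _ _ Nm); rewrite eq_sym.
have sub n' m' : (N <= n')%N ->
    \sum_(X <- fam n') \sum_(Y <- fam m' | (Y != X) && ~~ [disjoint X & Y]%B) wt (X :|: Y) <= D.
  by move=> Nn'; apply: le_trans (sum_fam_pairs_le _ _) (npD _ _ Nn').
have filt (H : {set 'I_M.+1} -> R) : (forall X, 0 <= H X) ->
    \sum_(X <- Fm) H X <= \sum_(X <- fam m) H X.
  by move=> H0; rewrite /Fm [leLHS]big_filter big_mkcond; apply: ler_sum => X _; case: ifP.
have inner X : \sum_(Y <- F | (Y != X) && ~~ [disjoint X & Y]%B) wt (X :|: Y) <=
   \sum_(Y <- fam n | (Y != X) && ~~ [disjoint X & Y]%B) wt (X :|: Y) +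
   \sum_(Y <- fam m | (Y != X) && ~~ [disjoint X & Y]%B) wt (X :|: Y).
  rewrite /F big_cat lerD2l /= big_mkcond [leRHS]big_mkcond /=.
  by apply: filt => Y; case: ifP.
have J : \sum_(X <- F) \sum_(Y <- F | (Y != X) && ~~ [disjoint X & Y]%B) wt (X :|: Y) <= 4 * D.
  apply: le_trans (ler_sum _ (fun X _ => inner X)) _.
  rewrite /F big_cat /= !big_split /=.
  have H1 := sub n n Nn; have H2 := sub n m Nn; have H3 := sub m n Nm; have H4 := sub m m Nm.
  have P0 (s : seq {set 'I_M.+1}) X :
      0 <= \sum_(Y <- s | (Y != X) && ~~ [disjoint X & Y]%B) wt (X :|: Y) by exact: sumr_ge0.
  have H3' := le_trans (filt _ (P0 (fam n))) H3.
  have H4' := le_trans (filt _ (P0 (fam m))) H4.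
  move: H1 H2 H3' H4'; lra.
rewrite mE; move: J I1; lra.
Qed.

(** Let [X] be the number of avoided indices, of mean [m]. The diagonal adds at most [m] to its
    second moment, so the variance is at most [m + (e^eta - 1) m^2]. *)
Lemma chebyshev_avoid (s : seq nat) (eta : R) : uniq s ->
  (forall n m, n \in s -> m \in s -> n != m ->
     Ex p M.+1 (fun A => avoid R (fam n) A * avoid R (fam m) A) <=
     expR eta * (pzero n * pzero m)) ->
  0 < \sum_(n <- s) pzero n ->
  Ex p M.+1 (fun A => (\sum_(n <- s) avoid R (fam n) A == 0)%:R) <=
  (\sum_(n <- s) pzero n)^-1 + (expR eta - 1).
Proof.
move=> us H; set m := \sum_(n <- s) pzero n => m0.
have pz0 n : 0 <= pzero n by apply: Ex_ge0 => // A; exact: avoid_ge0.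
have av2 n A : avoid R (fam n) A * avoid R (fam n) A <= avoid R (fam n) A.
  by rewrite ler_piMl ?avoid_ge0 //; have /andP[] := avoid01 R (fam n) A.
have E2 : Ex p M.+1 (fun A => (\sum_(n <- s) avoid R (fam n) A) ^+ 2) <= m + expR eta * m ^+ 2.
  rewrite (@eq_Ex _ _ _ _ (fun A => \sum_(n <- s) \sum_(k <- s) avoid R (fam n) A * avoid R (fam k) A)); last first.
    by move=> A; rewrite expr2 mulr_suml; apply: eq_bigr => n _; rewrite mulr_sumr.
  rewrite Ex_sum.
  have -> : m + expR eta * m ^+ 2 = \sum_(n <- s) (pzero n + \sum_(k <- s) expR eta * (pzero n * pzero k)).
    rewrite big_split /= -/m; congr (_ + _).
    rewrite expr2 mulr_suml mulr_sumr; apply: eq_bigr => n _.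
    by rewrite -mulr_sumr -mulr_sumr.
  rewrite big_seq [leRHS]big_seq; apply: ler_sum => n ns.
  rewrite Ex_sum (big_rem n ns) /= [in leRHS](big_rem n ns) /=.
  apply: lerD.
    by rewrite /pzero; apply: Ex_le => // A; exact: av2.
  apply: (@le_trans _ _ (\sum_(k <- rem n s) expR eta * (pzero n * pzero k))).
    rewrite big_seq [leRHS]big_seq; apply: ler_sum => k.
    rewrite mem_rem_uniq // inE => /andP[kn ks]; apply: H => //.
    by rewrite eq_sym.
  by rewrite lerDr mulr_ge0 ?expR_ge0 // mulr_ge0.
(* Pointwise, [m^2] times the indicator of [X = 0] is at most [(X - m)^2]. *)
have : Ex p M.+1 (fun A => m ^+ 2 * (\sum_(n <- s) avoid R (fam n) A == 0)%:R) <=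
   Ex p M.+1 (fun A => (\sum_(n <- s) avoid R (fam n) A) ^+ 2 -
      2 * m * (\sum_(n <- s) avoid R (fam n) A) + m ^+ 2).
  apply: Ex_le => // A; case: eqP => [->|_].
    by rewrite mulr1 expr0n /= mulr0 subr0 add0r.
  rewrite mulr0; move: (\sum_(_ <- _) _) => x.
  have -> : x ^+ 2 - 2 * m * x + m ^+ 2 = (x - m) ^+ 2 by ring.
  exact: sqr_ge0.
rewrite ExZ ExD ExB ExZ Ex_cst Ex_sum -/m => H1.
have m2 : 0 < m ^+ 2 by rewrite exprn_gt0.
rewrite -(ler_pM2l m2); apply: le_trans H1 _.
have -> : m ^+ 2 * (m^-1 + (expR eta - 1)) = m + expR eta * m ^+ 2 - m ^+ 2.
  by field; rewrite gt_eqF.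
move: E2; rewrite !expr2; lra.
Qed.

End second_moment.

(** * The expected number of representations *)

Section expectation.
Variables (R : realType) (h : nat) (b : nat -> nat).
Hypothesis h2 : (2 <= h)%N.
Hypothesis b0 : forall i, (i < h)%N -> (0 < b i)%N.
Variable c : R.
Hypothesis c0 : 0 <= c.
Local Notation hroot := (@hroot R h).
Local Notation hrootm := (@hrootm R h).
Local Notation rho := (@rho R h).
Local Notation wgt := (@wgt R h).
Local Notation wgt1 := (@wgt1 R h).
Local Notation dot := (@dot h b _).
Local Notation omega := (@omega R h _).
Local Notation cnt := (cnt R h b).
Local Notation K1 := (K1 R h (Lc h b)).
Local Notation K2 := (K2 R h b).

(* [0] always belongs to the random set, whence [prob 0 = 1]. *)
Definition prob (n : nat) : R :=
  if n == 0%N then 1 else Num.min (c * hroot (n%:R * ln n%:R) / n%:R) 1.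

Lemma ln_nat_ge0 (n : nat) : 0 <= ln (n%:R : R).
Proof.
by case: n => [|n]; [rewrite ln0 | rewrite ln_ge0 // ler1n].
Qed.

Lemma ler_ln_nat (m n : nat) : (0 < m)%N -> (m <= n)%N -> ln (m%:R : R) <= ln n%:R.
Proof.
by move=> m0 mn; rewrite ler_ln ?posrE ?ltr0n ?ler_nat // (leq_trans m0).
Qed.

Lemma prob01 n : 0 <= prob n <= 1.
Proof.
rewrite /prob; case: ifP => _; first by rewrite lexx ler01.
by rewrite ge_min lexx orbT andbT le_min ler01 andbT divr_ge0 // mulr_ge0 // hroot_ge0.
Qed.

Lemma capE (n : nat) : c * hroot (n%:R * ln n%:R) / n%:R = c * hroot (ln n%:R) * rho n%:R.
Proof. by rewrite hrootM // ?ln_nat_ge0 // /rho; ring. Qed.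

Lemma prob_le x n : (0 < x)%N -> (x <= n)%N -> prob x <= c * hroot (ln n%:R) * wgt x.
Proof.
move=> x0 xn; rewrite /prob gtn_eqF //.
apply: le_trans (_ : c * hroot (x%:R * ln x%:R) / x%:R <= _); first by rewrite ge_min lexx.
rewrite capE; apply: ler_pM.
- by rewrite mulr_ge0 ?hroot_ge0.
- by rewrite rho_ge0.
- by rewrite ler_wpM2l // le_hroot ?ln_nat_ge0 // ler_ln_nat.
- exact: wgt_ge.
Qed.

(** A common ratio between probabilities and weights up to [n]; the maximum with 1 covers the
    element 0 and allows raising the exponent. *)
Definition lam (n : nat) : R := Num.max 1 (c * hroot (ln n%:R)).

Lemma lam_ge1 n : 1 <= lam n. Proof. by rewrite le_max lexx. Qed.

Lemma prob_le_lam x n : (x <= n)%N -> prob x <= lam n * wgt1 x.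
Proof.
move=> xn; have [->|x0] := posnP x.
  by rewrite /prob /wgt1 wgt0 add0r mulr1 lam_ge1.
apply: le_trans (prob_le x0 xn) _; rewrite wgt1E // ler_wpM2r ?wgt_ge0 //.
by rewrite /lam le_max lexx orbT.
Qed.

Lemma lam_pow n : lam n ^+ h <= 1 + c ^+ h * ln n%:R.
Proof.
have l0 := ln_nat_ge0 n; have ch : 0 <= c ^+ h by rewrite exprn_ge0.
rewrite /lam maxEle; case: ifP => _.
  by rewrite exprMn hroot_exp // lerDr.
by rewrite expr1n lerDl mulr_ge0.
Qed.

(** The expected number of representations: a repeated entry is a single coin, hence the product
    over the set of values. *)
Definition Er (M n : nat) : R :=
  \sum_(k : {ffun 'I_h -> 'I_M.+1} | dot k == n) \prod_(x in img k) prob x.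

Definition C5 : R := Nc0 R h * K1 + h%:R * K2.

Lemma prod_img_le M n (k : {ffun 'I_h -> 'I_M.+1}) : dot k = n ->
  \prod_(x in img k) prob x <= lam n ^+ h * omega (img k).
Proof.
move=> kn; apply: (@le_trans _ _ (\prod_(x in img k) (lam n * wgt1 x))).
  apply: ler_prod => x /imgP[i <-]; have /andP[-> _] := prob01 (k i).
  by rewrite prob_le_lam // -kn le_dot.
rewrite big_split /= prodr_const ler_wpM2r ?omega_ge0 //.
by rewrite ler_weXn2l ?lam_ge1 // card_img.
Qed.

Lemma prod_img_inj M (k : {ffun 'I_h -> 'I_M}) : injective k ->
  \prod_(x in img k) prob x = \prod_i prob (k i).
Proof.
by move=> kinj; rewrite img_imset big_imset //= => i j _ _; exact: kinj.
Qed.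

(** Injective tuples with positive entries give the main term, since the logarithm at an entry is at
    most that at [n]. Tuples with an entry 0 or a repeated entry cost [O(n^(-1/h))] times a
    logarithm. *)
Lemma Er_upper M n : (0 < n)%N -> (n <= M)%N ->
  Er M n <= c ^+ h * ln n%:R * cnt n + (1 + c ^+ h * ln n%:R) * (C5 / hroot n%:R).
Proof.
move=> n0 nM; have l0 := ln_nat_ge0 n.
have rn0 : 0 < hroot n%:R by rewrite hroot_gt0 // ltr0n.
have lm0 : 0 <= lam n ^+ h by rewrite exprn_ge0 // (le_trans ler01) // lam_ge1.
have K10 : 0 <= K1 by exact: ltW (K1_gt0 R h2 b0).
have K20 := K2_ge0 R h b.
pose W (k : {ffun 'I_h -> 'I_M.+1}) := \prod_i wgt1 (k i).
have W0 k : 0 <= W k by apply: prodr_ge0 => i _; exact: wgt1_ge0.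
apply: (@le_trans _ _ (c ^+ h * ln n%:R * cnt n + lam n ^+ h * (C5 / hroot n%:R))); last first.
  rewrite lerD2l ler_wpM2r ?lam_pow // divr_ge0 ?(ltW rn0) //.
  by rewrite addr_ge0 // mulr_ge0.
rewrite /Er (bigID (fun k : {ffun 'I_h -> 'I_M.+1} => injectiveb k)) /=.
have Hnon : \sum_(k : {ffun 'I_h -> 'I_M.+1} | (dot k == n) && ~~ injectiveb k)
    \prod_(x in img k) prob x <= lam n ^+ h * (Nc0 R h * K1 / hroot n%:R).
  have := sum_omega_noninj_le R h2 b0 M n; rewrite hrootmE // => H.
  apply: le_trans (ler_wpM2l lm0 H); rewrite mulr_sumr; apply: ler_sum => k /andP[/eqP kn _].
  exact: prod_img_le.
have Hinj : \sum_(k : {ffun 'I_h -> 'I_M.+1} | (dot k == n) && injectiveb k)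
    \prod_(x in img k) prob x <= c ^+ h * ln n%:R * cnt n +
      lam n ^+ h * (h%:R * (K2 / hroot n%:R)).
  apply: (@le_trans _ _ (\sum_(k : {ffun 'I_h -> 'I_M.+1} | dot k == n)
     (c ^+ h * ln n%:R * \prod_i wgt (k i) +
      lam n ^+ h * \sum_i (if (k i <= 1)%N then W k else 0)))).
    rewrite big_mkcondr; apply: ler_sum => k /eqP kn.
    have rhs1 : 0 <= c ^+ h * ln n%:R * \prod_i wgt (k i).
      by rewrite !mulr_ge0 ?exprn_ge0 ?prodr_ge0 // => i _; exact: wgt_ge0.
    have rhs2 : 0 <= lam n ^+ h * \sum_i (if (k i <= 1)%N then W k else 0).
      by rewrite mulr_ge0 // sumr_ge0 // => i _; case: ifP.
    case: injectiveP => kinj; last by rewrite addr_ge0.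
    (* A zero entry has probability 1, far above its weight [wgt 0]; such tuples are charged to
       those with an entry at most 1, weighted by [wgt1]. *)
    have [/existsP[i /eqP ki]|/existsPn allpos] := boolP [exists i, k i == ord0].
      rewrite -[leLHS]add0r; apply: lerD => //.
      apply: le_trans (prod_img_le kn) _; rewrite ler_wpM2l // omega_img_inj //.
      rewrite [leRHS](bigD1 i) //= ki /= lerDl; apply: sumr_ge0 => j _; by case: ifP.
    rewrite -[leLHS]addr0; apply: lerD => //; rewrite prod_img_inj //.
    rewrite -{1}(hroot_exp h2 l0) -exprMn -[X in _ ^+ X](card_ord h) -prodr_const -big_split /=.
    apply: ler_prod => i _; have /andP[-> _] /= := prob01 (k i).
    apply: prob_le; last by rewrite -kn le_dot.
    by have := allpos i; rewrite -val_eqE /= lt0n.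
  rewrite big_split /= -!mulr_sumr; apply: lerD.
    rewrite -(cnt_widen R h2 b0 nM) /tsum le_eqVlt; apply/orP; left; apply/eqP.
    congr (_ * _); rewrite big_mkcond; apply: eq_bigr => k _.
    by rewrite dot_natv wprod_natv.
  rewrite ler_wpM2l // exchange_big /= mulr_natl -[X in _ *+ X](card_ord h) -sumr_const.
  apply: ler_sum => i _; rewrite -big_mkcondr.
  have := sum_cut_le R h2 b0 M i n0 (ltn0Sn 0).
  by rewrite hroot1 mulr1.
apply: le_trans (lerD Hinj Hnon) _.
rewrite -addrA lerD2l -mulrDr ler_wpM2l // /C5 addrC mulrDl lerD2l.
by rewrite mulrA.
Qed.

Lemma prod_le_img M (k : {ffun 'I_h -> 'I_M}) :
  \prod_i prob (k i) <= \prod_(x in img k) prob x.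
Proof.
rewrite (partition_big k (mem (img k))) /=; last by move=> i _; exact: mem_img.
apply: ler_prod => x /imgP[i kx]; apply/andP; split.
  by apply: prodr_ge0 => j _; have /andP[] := prob01 (k j).
rewrite (bigD1 i) /=; last by rewrite kx.
have /andP[p0 _] := prob01 (k i); rewrite kx in p0 *.
apply: ler_piMr => //; apply: numdomain.Num.Theory.prodr_ile1 => j _; exact: prob01.
Qed.

(** Only tuples with all entries above [y] are kept. There the minimum with 1 is inactive, the
    logarithm is at least [ln y], and [rho x >= y / (y+1) * wgt x]. *)
Lemma Er_lower n y : (0 < n)%N -> (0 < y)%N ->
  (forall k, (y < k)%N -> c * hroot (k%:R * ln k%:R) / k%:R <= 1) ->
  c ^+ h * ln y%:R * (y%:R / (y%:R + 1)) ^+ h *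
    (cnt n - h%:R * (K2 * hroot y%:R / hroot n%:R)) <= Er n n.
Proof.
move=> n0 y0 cap.
have yR : 0 < y%:R :> R by rewrite ltr0n.
have ly := ln_nat_ge0 y.
set A := c * hroot (ln y%:R) * (y%:R / (y%:R + 1)).
have A0 : 0 <= A by rewrite !mulr_ge0 ?hroot_ge0 // divr_ge0 // addr_ge0.
have -> : c ^+ h * ln y%:R * (y%:R / (y%:R + 1)) ^+ h = A ^+ h.
  by rewrite /A !exprMn hroot_exp.
have := cnt_cut_le R h2 b0 n0 y0; rewrite -lerBlDr => H.
apply: le_trans (ler_wpM2l (exprn_ge0 h A0) H) _; rewrite mulr_sumr /Er.
rewrite big_mkcondr; apply: ler_sum => k _.
case: ifP => [/forallP ky|_]; last first.
  by apply: prodr_ge0 => x _; have /andP[] := prob01 x.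
apply: le_trans (prod_le_img k).
rewrite -[X in _ ^+ X](card_ord h) -prodr_const -big_split /=.
apply: ler_prod => i _; rewrite mulr_ge0 ?wgt_ge0 //=.
have ki := ky i; move: (nat_of_ord (k i)) ki => x yx.
have x0 : (0 < x)%N by lia.
have x1 : (0 < x.-1)%N by lia.
rewrite /prob gtn_eqF // (min_idPl (cap x yx)) capE /A -!mulrA.
apply: ler_wpM2l => //; rewrite mulrA.
have hl : hroot (ln y%:R) <= hroot (ln x%:R) by rewrite le_hroot // ler_ln_nat // ltnW.
rewrite -mulrA; apply: ler_pM; rewrite ?hroot_ge0 //.
  apply: mulr_ge0 => //; apply: mulr_ge0; last exact: wgt_ge0.
  by rewrite invr_ge0 addr_ge0.
have -> : wgt x = wgt x.-1.+1 by rewrite prednK.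
rewrite mulrA.
apply: le_trans (ler_wpM2l _ (wgt_le_pred R h2 x1)) _; first by rewrite divr_ge0 // addr_ge0.
have xR : 0 < x%:R :> R by rewrite ltr0n.
have x1R : 0 < x.-1%:R :> R by rewrite ltr0n.
pose d : R := x%:R / x.-1%:R.
have d1 : 1 <= d by rewrite ler_pdivlMr // mul1r ler_nat; lia.
have := @rho_scale R h _ d xR d1.
have -> : x%:R / d = x.-1%:R :> R by rewrite /d invf_div mulrCA divff ?mulr1 // gt_eqF.
move=> H2; have y1 : 0 < y%:R + 1 :> R by rewrite addr_gt0.
rewrite mulrAC ler_pdivrMr //.
apply: le_trans (ler_wpM2l (ltW yR) H2) _.
rewrite mulrA [leLHS]mulrC ler_wpM2l ?rho_ge0 ?(ltW xR) // /d mulrA ler_pdivrMr //.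
rewrite natr1 -!natrM ler_nat.
by case: x yx x0 x1 {xR x1R d d1 H2 hl} => // x yx _ _ /=; nia.
Qed.

End expectation.

(** * Growth of roots, logarithms and powers *)

Section growth.
Local Open Scope classical_set_scope.
Variables (R : realType) (h : nat).
Hypothesis h2 : (2 <= h)%N.
Local Notation hroot := (@hroot R h).

Lemma cvg_inv_hroot : ((fun n : nat => (hroot n%:R)^-1) @ \oo --> (0 : R)).
Proof.
apply/cvgrPdist_le => e e0; near=> n.
rewrite sub0r normrN ger0_norm ?invr_ge0 ?hroot_ge0 //.
have n0 : (0 < n)%N by near: n; exists 1%N.
have rn : 0 < hroot n%:R by rewrite hroot_gt0 // ltr0n.
rewrite -[leRHS]invrK lef_pV2 ?posrE ?invr_gt0 // leNgt; apply/negP => lt.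
have : (e^-1) ^+ h <= n%:R by near: n; exact: nbhs_infty_ger.
apply/negP; rewrite -ltNge -[ltLHS](hroot_exp h2) // ltrXn2r ?nnegrE ?hroot_ge0 ?invr_ge0 ?(ltW e0) //.
by rewrite -lt0n; lia.
Unshelve. all: by end_near. Qed.

Lemma cvg_inv_ln : ((fun n : nat => (ln (n%:R : R))^-1) @ \oo --> (0 : R)).
Proof.
apply/cvgrPdist_le => e e0; near=> n.
have n0 : (0 < n)%N by near: n; exists 1%N.
have l0 : 0 <= ln (n%:R : R) by rewrite ln_ge0 // ler1n.
rewrite sub0r normrN ger0_norm ?invr_ge0 //.
have en : e^-1 <= ln n%:R.
  rewrite -[leLHS]expRK ler_ln ?posrE ?expR_gt0 ?ltr0n //.
  by near: n; exact: nbhs_infty_ger.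
rewrite -[leRHS]invrK lef_pV2 ?posrE ?invr_gt0 //.
by apply: lt_le_trans en; rewrite invr_gt0.
Unshelve. all: by end_near. Qed.

Lemma cvg_inv_powR (d : R) : 0 < d -> ((fun n : nat => (n%:R `^ d)^-1) @ \oo --> (0 : R)).
Proof.
move=> d0; apply/cvgrPdist_le => e e0; near=> n.
have n0 : (0 < n)%N by near: n; exists 1%N.
have nR : 0 < n%:R :> R by rewrite ltr0n.
rewrite sub0r normrN ger0_norm ?invr_ge0 ?powR_ge0 //.
rewrite -[leRHS]invrK lef_pV2 ?posrE ?invr_gt0 ?powR_gt0 //.
have : (e^-1) `^ d^-1 <= n%:R by near: n; exact: nbhs_infty_ger.
move=> H; have := @ge0_ler_powR R d (ltW d0) _ _ _ _ H; rewrite !nnegrE powR_ge0 ler0n.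
by rewrite -powRrM mulVf ?gt_eqF // powRr1 ?invr_ge0 ?(ltW e0) //; apply.
Unshelve. all: by end_near. Qed.

Lemma ln_le_powR (x d : R) : 0 < d -> 0 < x -> ln x <= x `^ d / d.
Proof.
move=> d0 x0; rewrite ler_pdivlMr // mulrC -ln_powR.
have x1 : 0 < x `^ d by rewrite powR_gt0.
have := @le_ln1Dx R (x `^ d - 1); rewrite subrKC => H.
apply: le_trans (H _) _; [lra | lra].
Qed.

Lemma cvg_polylog (d : R) : 0 < d ->
  ((fun n : nat => (1 + ln (2 * n%:R : R)) ^+ 3 / (n%:R `^ d)) @ \oo --> (0 : R)).
Proof.
(* Each of the three logarithms is [O(n^(d/6))], so half of the power [n^d] remains. *)
move=> d0; pose e := d / 6; have e0 : 0 < e by rewrite divr_gt0.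
pose C : R := 3 + e^-1.
have C0 : 0 < C by rewrite addr_gt0 // invr_gt0.
have d20 : 0 < d / 2 by rewrite divr_gt0.
have lim0 : (fun n : nat => C ^+ 3 * (n%:R `^ (d / 2))^-1) @ \oo --> (0 : R).
  by rewrite -[X in _ --> X](mulr0 (C ^+ 3)); apply: cvgM; [exact: cvg_cst | exact: cvg_inv_powR].
apply: (squeeze_cvgr _ (cvg_cst 0) lim0).
near=> n; have n0 : (0 < n)%N by near: n; exists 1%N.
have nR : 0 < n%:R :> R by rewrite ltr0n.
have n1 : 1 <= n%:R :> R by rewrite ler1n.
have l2 : 0 <= ln (2 * n%:R : R) by rewrite ln_ge0 //; lra.
rewrite divr_ge0 ?powR_ge0 ?exprn_ge0 ?addr_ge0 //=.
have ne1 : 1 <= n%:R `^ e.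
  by rewrite -[leLHS](powRr0 n%:R) ler_powR // ltW.
have H : 1 + ln (2 * n%:R) <= C * n%:R `^ e.
  rewrite lnM ?posrE //; have := ln_le_powR e0 nR.
  have l1 : ln (2 : R) <= 1 by have := @le_ln1Dx R 1; rewrite -[1 + 1]/(2 : R); apply; lra.
  rewrite /C mulrDl [e^-1 * _]mulrC => H; lra.
have H3 : (1 + ln (2 * n%:R)) ^+ 3 <= C ^+ 3 * n%:R `^ (d / 2).
  have -> : n%:R `^ (d / 2) = (n%:R `^ e) ^+ 3.
    by rewrite -powR_mulrn ?powR_ge0 // -powRrM; congr (_ `^ _); rewrite /e; field.
  by rewrite -exprMn lerXn2r ?nnegrE ?addr_ge0 // mulr_ge0 ?powR_ge0 // ltW.
rewrite ler_pdivrMr ?powR_gt0 //; apply: le_trans H3 _.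
have q0 : 0 < n%:R `^ (d / 2) by rewrite powR_gt0.
have -> : n%:R `^ d = n%:R `^ (d / 2) * n%:R `^ (d / 2).
  rewrite -powRD; first by congr (_ `^ _); field.
  by apply/implyP => _; rewrite gt_eqF.
by rewrite mulrA divfK ?gt_eqF.
Unshelve. all: by end_near. Qed.

End growth.

(** * Asymptotics of the expectation *)

Section asymptotics.
Local Open Scope classical_set_scope.
Variables (R : realType) (h : nat) (b : nat -> nat).
Hypothesis h2 : (2 <= h)%N.
Hypothesis b0 : forall i, (i < h)%N -> (0 < b i)%N.
Variable c : R.
Hypothesis c0 : 0 <= c.
Variable C0 : R.
Local Notation hroot := (@hroot R h).
Local Notation hrootm := (@hrootm R h).
Local Notation rho := (@rho R h).
Local Notation dot := (@dot h b _).
Local Notation cnt := (cnt R h b).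
Local Notation K2 := (K2 R h b).
Local Notation K4 := (K4 R h b).
Local Notation C5 := (C5 R h b).
Local Notation prob := (@prob R h c).
Local Notation lam := (@lam R h c).
Local Notation Er := (@Er R h b c).
Local Notation Lc := (Lc h b).
Hypothesis cnt_lim : cnt @ \oo --> C0.

Let upper (n : nat) : R :=
  c ^+ h * cnt n + ((ln (n%:R : R))^-1 + c ^+ h) * (C5 * (hroot n%:R)^-1).

Lemma cvg_upper : upper @ \oo --> c ^+ h * C0.
Proof.
have -> : c ^+ h * C0 = c ^+ h * C0 + (0 + c ^+ h) * (C5 * 0) by ring.
apply: cvgD; first by apply: cvgM => //; exact: cvg_cst.
apply: cvgM; first by apply: cvgD; [exact: cvg_inv_ln | exact: cvg_cst].
by apply: cvgM; [exact: cvg_cst | exact: cvg_inv_hroot].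
Qed.

Lemma Er_le_upper M n : (1 < n)%N -> (n <= M)%N -> Er M n <= upper n * ln n%:R.
Proof.
move=> n1 nM; apply: le_trans (Er_upper h2 b0 c0 (ltnW n1) nM) _.
have l0 : 0 < ln (n%:R : R) by rewrite ln_gt0 // ltr1n.
rewrite /upper le_eqVlt; apply/orP; left; apply/eqP.
by field; rewrite !gt_eqF // hroot_gt0 // ltr0n ltnW.
Qed.

(** After taking [h]-th powers, [c^h k ln k <= k^2 <= k^h] follows from [ln k <= 2 k^(1/2)] once
    [2 c^h <= k^(1/2)]. *)
Lemma cap_small : exists k0, forall k, (k0 <= k)%N ->
  c * hroot (k%:R * ln k%:R) / k%:R <= 1.
Proof.
pose B : R := (2 * c ^+ h) ^+ 2; exists (Num.truncn B).+1 => k kB.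
have k0 : (0 < k)%N by apply: leq_trans kB.
have kR : 0 < k%:R :> R by rewrite ltr0n.
have k1 : 1 <= k%:R :> R by rewrite ler1n.
have l0 := ln_nat_ge0 R k.
have ch : 0 <= c ^+ h by rewrite exprn_ge0.
have Bk : B <= k%:R by rewrite ltW // (lt_le_trans (truncnS_gt _)) // ler_nat.
pose s : R := k%:R `^ 2^-1.
have ss : s * s = k%:R by rewrite /s -powRD ?gt_eqF ?implybT // -div1r -splitr powRr1 // ltW.
have s0 : 0 <= s by exact: powR_ge0.
have sB : 2 * c ^+ h <= s.
  by rewrite -(@ler_pXn2r _ 2) ?nnegrE ?mulr_ge0 // [leRHS]expr2 ss.
rewrite ler_pdivrMr // mul1r -(@ler_pXn2r _ h) ?nnegrE ?mulr_ge0 ?hroot_ge0 ?(ltW kR) //; last by lia.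
rewrite exprMn hroot_exp ?mulr_ge0 ?(ltW kR) //.
apply: (@le_trans _ _ (k%:R ^+ 2)); last by rewrite ler_weXn2l.
rewrite mulrCA expr2 ler_wpM2l ?(ltW kR) //.
have : ln k%:R <= s / 2^-1 by apply: ln_le_powR.
rewrite invrK => /(ler_wpM2l ch) /le_trans; apply.
by rewrite -ss [s * 2]mulrC mulrA [c ^+ h * 2]mulrC ler_wpM2r.
Qed.

(** The lower bound cuts at [y = n %/ q] with [q] fixed: [ln y / ln n] still tends to 1, and the
    discarded tuples cost a multiple of [q^(-1/h)], made small by choosing [q] first. *)
Lemma Er_cvg : (fun n => Er n n / ln n%:R) @ \oo --> c ^+ h * C0.
Proof.
have ch : 0 <= c ^+ h by rewrite exprn_ge0.
have K20 := K2_ge0 R h b.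
apply/cvgrPdist_le => e e0; have e20 : 0 < e / 2 by rewrite divr_gt0.
have [q q0 qe] : exists2 q, (0 < q)%N & c ^+ h * (h%:R * K2 * (hroot q%:R)^-1) <= e / 2.
  have : (fun q : nat => c ^+ h * (h%:R * K2 * (hroot q%:R)^-1)) @ \oo --> c ^+ h * (h%:R * K2 * 0).
    apply: cvgM; first exact: cvg_cst.
    by apply: cvgM; [exact: cvg_cst | exact: cvg_inv_hroot].
  rewrite !mulr0 => /cvgrPdist_le /(_ _ e20) N1.
  have N2 : \forall q \near \oo, (0 < q)%N by exists 1%N.
  have [q _ /(_ q (leqnn q)) [Q1 Q2]] := filterI N1 N2.
  exists q => //; move: Q1; rewrite sub0r normrN => /(le_trans (ler_norm _)).
  by [].
set eq := h%:R * K2 * (hroot q%:R)^-1 in qe.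
have qR : 0 < q%:R :> R by rewrite ltr0n.
(* Lower bounds for [ln y / ln n] and [y / (y+1)], from [n <= 2 q y] and [n <= q (y+1)]; both tend
   to 1. *)
pose a1 (n : nat) : R := 1 - ln (2 * q%:R) * (ln n%:R)^-1.
pose a2 (n : nat) : R := 1 - q%:R * (hroot n%:R)^-1.
have ca1 : a1 @ \oo --> (1 : R).
  rewrite -[X in _ --> X](subr0 1) -[X in _ --> _ - X](mulr0 (ln (2 * q%:R))).
  apply: cvgB; first exact: cvg_cst.
  by apply: cvgM; [exact: cvg_cst | exact: cvg_inv_ln].
have ca2 : a2 @ \oo --> (1 : R).
  rewrite -[X in _ --> X](subr0 1) -[X in _ --> _ - X](mulr0 q%:R).
  apply: cvgB; first exact: cvg_cst.
  by apply: cvgM; [exact: cvg_cst | exact: cvg_inv_hroot].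
have cL : (fun n => c ^+ h * (a1 n * a2 n ^+ h * cnt n - eq)) @ \oo --> c ^+ h * (C0 - eq).
  apply: cvgM; first exact: cvg_cst.
  apply: cvgB; last exact: cvg_cst.
  have ca2h : a2 n ^+ h @[n --> \oo] --> (1 ^+ h : R).
    by apply: (cvg_comp _ (fun x : R => x ^+ h) ca2); exact: exprn_continuous.
  have E : C0 = 1 * (1 ^+ h) * C0 by rewrite expr1n !mul1r.
  rewrite [in X in _ --> X]E; exact: cvgM (cvgM ca1 ca2h) cnt_lim.
have [k0 cap] := cap_small.
near=> n.
have n2 : (1 < n)%N by near: n; exists 2%N.
have n0 := ltnW n2.
have nR : 0 < n%:R :> R by rewrite ltr0n.
have l0 : 0 < ln (n%:R : R) by rewrite ln_gt0 // ltr1n.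
have rn : 0 < hroot n%:R by rewrite hroot_gt0.
have nq : (q * (2 + k0) <= n)%N by near: n; exists (q * (2 + k0))%N.
have A1 : 0 <= a1 n.
  have : `|1 - a1 n| <= 1 by near: n; move/cvgrPdist_le : ca1; apply.
  by rewrite ler_norml => /andP[_]; lra.
have A2 : 0 <= a2 n.
  have : `|1 - a2 n| <= 1 by near: n; move/cvgrPdist_le : ca2; apply.
  by rewrite ler_norml => /andP[_]; lra.
have Un : `|c ^+ h * C0 - upper n| <= e.
  by near: n; move/cvgrPdist_le : cvg_upper; apply.
have Ln : `|c ^+ h * (C0 - eq) - c ^+ h * (a1 n * a2 n ^+ h * cnt n - eq)| <= e / 2.
  by near: n; move/cvgrPdist_le : cL; apply.
have T1 : Er n n / ln n%:R <= upper n by rewrite ler_pdivrMr // Er_le_upper.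
have T2 : c ^+ h * (a1 n * a2 n ^+ h * cnt n - eq) <= Er n n / ln n%:R.
  pose y := (n %/ q)%N.
  have yk : (2 + k0 <= y)%N by rewrite leq_divRL // mulnC.
  have y0 : (0 < y)%N by apply: leq_trans yk.
  have yR : 0 < y%:R :> R by rewrite ltr0n.
  have yq : (q * y <= n)%N by rewrite mulnC leq_trunc_div.
  have yq' : (n < q * y.+1)%N by rewrite mulnC -ltn_divLR.
  have := @Er_lower R h b h2 b0 c c0 n y n0 y0.
  have cap' k : (y < k)%N -> c * hroot (k%:R * ln k%:R) / k%:R <= 1.
    move=> yk'; apply: cap; apply: leq_trans (ltnW yk'); apply: leq_trans yk.
    by rewrite leq_addl.
  move=> /(_ cap') H; rewrite ler_pdivlMr //; apply: le_trans H.
  set en := h%:R * (K2 * hroot y%:R / hroot n%:R).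
  have enq : en <= eq.
    rewrite /en /eq -[leRHS]mulrA -[X in _ * X <= _]mulrA.
    apply: ler_wpM2l => //; apply: ler_wpM2l => //.
    rewrite ler_pdivrMr // [leRHS]mulrC ler_pdivlMr ?hroot_gt0 // -hrootM ?ler0n //.
    by rewrite le_hroot // ?mulr_ge0 // -natrM ler_nat mulnC.
  pose B1 : R := ln y%:R / ln n%:R; pose B2 : R := y%:R / (y%:R + 1).
  have y1 : 0 < y%:R + 1 :> R by rewrite addr_gt0.
  have B11 : B1 <= 1.
    by rewrite ler_pdivrMr // mul1r ler_ln_nat // leq_div.
  have B1a : a1 n <= B1.
    rewrite /a1 /B1 ler_pdivlMr // mulrBl mul1r -mulrA mulVf ?gt_eqF // mulr1 lerBlDr.
    rewrite -lnM ?posrE ?mulr_gt0 // ler_ln ?posrE ?mulr_gt0 //.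
    rewrite -!natrM ler_nat (leq_trans (ltnW yq')) //.
    have -> : (y * (2 * q) = q * (2 * y))%N by rewrite mulnA mulnC [(y * 2)%N]mulnC.
    by rewrite leq_mul2l mul2n -addnn -addn1 leq_add2l y0 orbT.
  have B10 : 0 <= B1 by rewrite divr_ge0 ?ln_nat_ge0 // ltW.
  have B20 : 0 <= B2 by rewrite divr_ge0 // ltW.
  have B21 : B2 <= 1 by rewrite ler_pdivrMr // mul1r lerDl.
  have B2a : a2 n <= B2.
    apply: (@le_trans _ _ (1 - q%:R / n%:R)).
      rewrite lerD2l lerN2 ler_wpM2l // lef_pV2 ?posrE // hroot_le // ler1n //.
    rewrite /B2 ler_pdivlMr // mulrBl mul1r lerBlDr lerD2l mulrAC ler_pdivlMr // mul1r.
    by rewrite natr1 -natrM ler_nat ltnW.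
  have -> : c ^+ h * ln y%:R * B2 ^+ h * (cnt n - en) =
      c ^+ h * (B1 * B2 ^+ h * (cnt n - en)) * ln n%:R.
    by rewrite /B1; field; rewrite gt_eqF.
  apply: ler_wpM2r; first exact: ltW.
  apply: ler_wpM2l => //; rewrite mulrBr.
  have cn := cnt_ge0 R b h2 n.
  have en0 : 0 <= en by rewrite !mulr_ge0 ?invr_ge0 ?hroot_ge0.
  have BB : B1 * B2 ^+ h <= 1.
    by rewrite mulr_ile1 ?exprn_ge0 // exprn_ile1.
  have aB : a1 n * a2 n ^+ h <= B1 * B2 ^+ h.
    by apply: ler_pM => //; [rewrite exprn_ge0 | rewrite lerXn2r ?nnegrE].
  have H1 := ler_wpM2r cn aB.
  have H2 := ler_wpM2r en0 BB; rewrite mul1r in H2.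
  by move: H1 H2 enq; lra.
move: Un Ln; rewrite !ler_norml => /andP[U1 U2] /andP[L1 L2].
apply/andP; split; first by lra.
rewrite mulrBr in L2; lra.
Unshelve. all: by end_near. Qed.

End asymptotics.

(** * Gaps in dyadic intervals *)

Section many_gaps.
Local Open Scope classical_set_scope.
Variables (R : realType) (h : nat) (b : nat -> nat).
Hypothesis h2 : (2 <= h)%N.
Hypothesis b0 : forall i, (i < h)%N -> (0 < b i)%N.
Variable c : R.
Hypothesis c0 : 0 <= c.
Variables (C0 eps : R).
Hypothesis eps01 : 0 < eps < 1.
Local Notation hroot := (@hroot R h).
Local Notation hrootm := (@hrootm R h).
Local Notation rho := (@rho R h).
Local Notation wgt1 := (@wgt1 R h).
Local Notation dot := (@dot h b _).
Local Notation cnt := (cnt R h b).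
Local Notation K4 := (K4 R h b).
Local Notation prob := (@prob R h c).
Local Notation lam := (@lam R h c).
Local Notation Er := (@Er R h b c).
Local Notation Lc := (Lc h b).
Local Notation fam := (fam h b).
Hypothesis cnt_lim : cnt @ \oo --> C0.
Hypothesis cC0 : c ^+ h * C0 = 1 - eps.

Lemma exists_large_entry M n (k : {ffun 'I_h -> 'I_M}) : (0 < n)%N -> dot k = n ->
  exists i, (n <= Lc * k i)%N.
Proof.
move=> n0 kn; apply: contrapT => H.
have lt i : (Lc * k i <= n.-1)%N.
  by rewrite -ltnS prednK // ltnNge; apply/negP => ni; apply: H; exists i.
have : (Lc * dot k <= bsum h b * n.-1)%N.
  rewrite /dot /bsum big_distrr big_distrl /=; apply: leq_sum => i _.
  by rewrite mulnCA leq_mul2l lt orbT.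
rewrite kn; have : (bsum h b * n.-1 <= Lc * n.-1)%N by rewrite leq_mul2r /Lc leq_pmull ?orbT //; lia.
move=> H1 H2; have := leq_trans H2 H1; rewrite leq_pmul2l ?Lc_gt0 //.
by rewrite leqNgt prednK ?leqnn.
Qed.

(** A single large entry already makes the whole set improbable. *)
Lemma wt_fam_le M N n X : (0 < N)%N -> (N <= n)%N -> (n <= M)%N -> X \in fam M n ->
  wt prob X <= lam M * (h%:R * Lc%:R) / hroot N%:R.
Proof.
move=> N0 Nn nM /famP[k kn <-]; have n0 := leq_trans N0 Nn.
have NR : 0 < N%:R :> R by rewrite ltr0n.
have [i ni] := exists_large_entry n0 kn.
have l0 : 0 <= lam M by apply: le_trans (lam_ge1 _ _ _).
rewrite /wt (bigD1 (k i)) ?mem_img //=.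
apply: (@le_trans _ _ (prob (k i))).
  apply: ler_piMr; first by have /andP[] := prob01 h c0 (k i).
  by apply: numdomain.Num.Theory.prodr_ile1 => x _; exact: prob01.
have kM : (k i <= M)%N by rewrite -ltnS.
apply: le_trans (prob_le_lam h2 c0 kM) _; rewrite -mulrA ler_wpM2l //.
apply: le_trans (wgt1_le_rho R h2 n0 ni) _; rewrite ler_wpM2l //.
(* Here [h >= 2] gives [N^(1/h-1) <= N^(-1/h)]. *)
apply: (@le_trans _ _ (rho N%:R)); first by rewrite le_rho // ler_nat.
have rN : 1 <= hroot N%:R by rewrite hroot_ge1 // ler1n.
have rN0 : 0 < hroot N%:R by lra.
rewrite /rho ler_pdivrMr // mulrC ler_pdivlMr //.
rewrite -[leRHS](hroot_exp h2 (ltW NR)) -expr2 ler_weXn2l //.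
Qed.

Let d : R := h%:R^-1 / 2 * h%:R^-1.

Lemma d_gt0 : 0 < d.
Proof. by have h0 := hR_gt0 R h2; rewrite mulr_gt0 ?divr_gt0 ?invr_gt0. Qed.

(** Take [tau] to be the integer part of [s = N^(1/(2h))]. The second term is at most [1/s], and the
    first at most [2 / s^(1/h)] because [s <= 2 tau]; the exponent is [d = 1/(2 h^2)]. *)
Lemma tau_choice N : (0 < N)%N -> exists2 tau, (0 < tau)%N &
  (hrootm tau)^-1 + tau%:R / hroot N%:R <= 3 / N%:R `^ d.
Proof.
move=> N0; have NR : 0 < N%:R :> R by rewrite ltr0n.
have N1 : 1 <= N%:R :> R by rewrite ler1n.
have h0 := hR_gt0 R h2; have hi0 : 0 < h%:R^-1 :> R by rewrite invr_gt0.
pose s : R := N%:R `^ (h%:R^-1 / 2).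
have s1 : 1 <= s by rewrite -[leLHS](powRr0 N%:R) ler_powR // ltW // divr_gt0.
have s0 : 0 < s by lra.
have ss : s * s = hroot N%:R.
  rewrite /s -powRD; first by rewrite -splitr.
  by apply/implyP => _; rewrite gt_eqF.
have hs : hroot s = N%:R `^ d by rewrite /hroot /s -powRrM.
have hs0 : 0 < hroot s by rewrite hroot_gt0.
pose tau := Num.truncn s.
have /andP[ts st] := truncn_itv (ltW s0).
have t0 : (0 < tau)%N by rewrite -ltnS -(@ltr_nat R); apply: le_lt_trans st.
have tR : 1 <= tau%:R :> R by rewrite ler1n.
exists tau => //; rewrite -hs.
have H1 : tau%:R / hroot N%:R <= (hroot s)^-1.
  rewrite -ss ler_pdivrMr ?mulr_gt0 // [leRHS]mulrC ler_pdivlMr //.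
  by apply: ler_pM => //; [exact: ltW | exact: hroot_le].
have H2 : (hrootm tau)^-1 <= 2 / hroot s.
  rewrite hrootmE // ler_pdivlMr // mulrC ler_pdivrMr ?hroot_gt0 ?ltr0n //.
  apply: (@le_trans _ _ (hroot (2 * tau%:R))).
    apply: le_hroot; first exact: ltW.
    by apply: le_trans (ltW st) _; rewrite -natr1 -/tau; lra.
  rewrite hrootM // ler_wpM2r ?hroot_ge0 // hroot_le // ler1n //.
have -> : 3 / hroot s = 2 / hroot s + (hroot s)^-1 by field; rewrite gt_eqF.
exact: lerD.
Qed.

(** One vanishing quantity that dominates every error in the dyadic interval; at most two powers of
    the logarithm come from [lam], or from [lam] and a mean. *)
Let E1 (N : nat) : R := (1 + ln (2 * N%:R : R)) ^+ 3 / N%:R `^ d.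
Let Gc : R := 1 + c ^+ h.
(** Here 15 is 5 from [pzero_pair_le] times 3 from [tau_choice], and 4 is the factor [2 rh] of
    Harris' bound for each of two means. *)
Let CE : R := 15 * (Gc ^+ 2 * K4) + 4 * (Gc * (h%:R * Lc%:R)).

Lemma cvg_E1 : E1 @ \oo --> (0 : R).
Proof. exact: cvg_polylog d_gt0. Qed.

Lemma ch_ge0 : 0 <= c ^+ h. Proof. by rewrite exprn_ge0. Qed.

Lemma Gc_ge1 : 1 <= Gc. Proof. by rewrite lerDl ch_ge0. Qed.

Lemma lam_pow_le N : (0 < N)%N -> lam (2 * N) ^+ h <= Gc * (1 + ln (2 * N%:R)).
Proof.
move=> N0; apply: le_trans (lam_pow h2 c0 _) _; rewrite natrM /Gc.
have N1 : 1 <= N%:R :> R by rewrite ler1n.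
have l0 : 0 <= ln (2 * N%:R : R) by rewrite ln_ge0 //; lra.
have := ch_ge0; have := mulr_ge0 ch_ge0 l0; lra.
Qed.

(** Chebyshev's bound is [1/m + (e^eta - 1)] with [m] the expected number of gaps and
    [eta = CE * E1 N]; each part is at most [e / 2] for large [N]. *)
Lemma zero_prob_small (e : R) : 0 < e -> \forall N \near \oo,
  Ex prob (2 * N).+1 (fun A => (\sum_(n <- iota N.+1 N) avoid R (fam (2 * N) n) A == 0)%:R) <= e.
Proof.
move=> e0; case/andP: eps01 => eps0 eps1.
have e20 : 0 < e / 2 by rewrite divr_gt0.
have eps4 : 0 < eps / 4 by rewrite divr_gt0.
have GL0 : 0 <= Gc * (h%:R * Lc%:R) by rewrite mulr_ge0 // (le_trans ler01) // Gc_ge1.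
have up := @cvg_upper R h b h2 c C0 cnt_lim; rewrite cC0 in up.
move/cvgrPdist_le : up => /(_ _ eps4) [n1 _ Hn1].
have cexp : expR (CE * E1 N) @[N --> \oo] --> expR (CE * 0).
  have cCE : CE * E1 N @[N --> \oo] --> CE * 0.
    by apply: cvgM; [exact: cvg_cst | exact: cvg_E1].
  by apply: (cvg_comp _ (@expR R) cCE); exact: continuous_expR.
rewrite mulr0 expR0 in cexp.
have crho : 2 * (Gc * (h%:R * Lc%:R) * E1 N) @[N --> \oo] --> 2 * (Gc * (h%:R * Lc%:R) * 0).
  by apply: cvgM; [exact: cvg_cst | apply: cvgM; [exact: cvg_cst | exact: cvg_E1]].
rewrite !mulr0 in crho.
have cinv : 4 / eps * (ln (N%:R : R))^-1 @[N --> \oo] --> 4 / eps * 0.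
  by apply: cvgM; [exact: cvg_cst | exact: cvg_inv_ln].
rewrite mulr0 in cinv.
near=> N.
have N2 : (1 < N)%N by near: N; exists 2%N.
have N0 := ltnW N2.
have NR : 0 < N%:R :> R by rewrite ltr0n.
have N1 : 1 <= N%:R :> R by rewrite ler1n.
have Nn1 : (n1 <= N)%N by near: N; exists n1.
have B1 : `|1 - expR (CE * E1 N)| <= e / 2.
  by near: N; move/cvgrPdist_le : cexp; apply.
have B2 : `|0 - 2 * (Gc * (h%:R * Lc%:R) * E1 N)| <= eps / 4.
  by near: N; move/cvgrPdist_le : crho; apply.
have B3 : `|0 - 4 / eps * (ln (N%:R : R))^-1| <= e / 2.
  by near: N; move/cvgrPdist_le : cinv; apply.
have l2 : 0 <= ln (2 * N%:R : R) by rewrite ln_ge0 //; lra.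
pose l : R := 1 + ln (2 * N%:R).
have l1 : 1 <= l by rewrite lerDl.
have Nd0 : 0 < N%:R `^ d by rewrite powR_gt0.
have E1E : E1 N = l ^+ 3 / N%:R `^ d by [].
set M := (2 * N)%N.
have L1 : 1 <= lam M := lam_ge1 h c M.
have Lh : lam M ^+ h <= Gc * l := lam_pow_le N0.
have L0 : 0 <= lam M by lra.
have Gc1 := Gc_ge1; have Gc0 : 0 <= Gc by lra.
have Llam : lam M <= Gc * l.
  by apply: le_trans Lh; rewrite -[leLHS]expr1 ler_weXn2l // ltnW.
pose rh : R := lam M * (h%:R * Lc%:R) / hroot N%:R.
have rN : 0 < hroot N%:R by rewrite hroot_gt0.
have rhE : rh <= Gc * (h%:R * Lc%:R) * (l / N%:R `^ d).
  rewrite /rh [leRHS]mulrA; apply: ler_pM.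
  - by rewrite mulr_ge0.
  - by rewrite invr_ge0 ltW.
  - by rewrite [leRHS]mulrAC ler_wpM2r.
  - rewrite lef_pV2 ?posrE // /hroot ler_powR //.
    have h0 := hR_gt0 R h2.
    have hi1 : h%:R^-1 <= 1 :> R by rewrite invf_le1 // ler1n ltnW.
    have hi0 : 0 < h%:R^-1 :> R by rewrite invr_gt0.
    rewrite /d -[leRHS]mul1r; apply: ler_wpM2r; first exact: ltW.
    by lra.
have l3 : l <= l ^+ 3 by rewrite -[leLHS]expr1 ler_weXn2l.
have l23 : l ^+ 2 <= l ^+ 3 by rewrite ler_weXn2l.
have rhE1 : rh <= Gc * (h%:R * Lc%:R) * E1 N.
  apply: le_trans rhE _; rewrite E1E ler_wpM2l // ler_wpM2r ?invr_ge0 ?(ltW Nd0) //.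
have rh0 : 0 <= rh by rewrite !mulr_ge0 ?invr_ge0 ?(ltW rN).
have rh8 : 2 * rh <= eps / 4.
  move: B2; rewrite sub0r normrN => /(le_trans (ler_norm _)); move: rhE1; lra.
have p01 := @prob01 R h c c0.
have pL x : (x <= M)%N -> prob x <= lam M * wgt1 x by exact: prob_le_lam.
have wr n X : (N < n)%N -> (n <= M)%N -> X \in fam M n -> wt prob X <= rh.
  by move=> Nn nM; apply: wt_fam_le => //; exact: ltnW.
(* The mean counts sets, the expectation counts tuples, so the former is smaller; a quarter of [eps]
   is spent on the limit. *)
have mn n : (N < n)%N -> (n <= M)%N -> mean h b prob M n <= (1 - eps * 3 / 4) * ln n%:R.
  move=> Nn nM; have n2 : (1 < n)%N by exact: ltn_trans Nn.
  apply: (@le_trans _ _ (Er M n)).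
    by apply: sum_fam_le => X; exact: wt_ge0.
  apply: le_trans (Er_le_upper h2 b0 c0 n2 nM) _.
  rewrite ler_wpM2r ?ln_nat_ge0 //.
  have := Hn1 n (leq_trans Nn1 (ltnW Nn)); rewrite /= ler_norml => /andP[+ _]; lra.
have lnM n : (N < n)%N -> (n <= M)%N -> ln (n%:R : R) <= ln (2 * N%:R).
  by move=> Nn nM; rewrite -natrM ler_ln_nat // (leq_ltn_trans _ Nn).
have [tau tau0 Htau] := tau_choice N0.
pose D := lam M ^+ (h + h) * (K4 * ((hrootm tau)^-1 + tau%:R / hroot N%:R)).
have K40 := K4_ge0 R h2 b0.
have DE : D <= 3 * (Gc ^+ 2 * K4) * E1 N.
  have H : D <= (Gc * l) ^+ 2 * (K4 * (3 / N%:R `^ d)).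
    rewrite /D; apply: ler_pM.
    - by rewrite exprn_ge0.
    - rewrite mulr_ge0 // addr_ge0 // ?invr_ge0 ?divr_ge0 ?(ltW rN) //.
      by rewrite ltW // hrootm_gt0.
    - rewrite exprD expr2; apply: ler_pM => //; by rewrite exprn_ge0.
    - by rewrite ler_wpM2l.
  apply: le_trans H _; rewrite E1E.
  have -> : (Gc * l) ^+ 2 * (K4 * (3 / N%:R `^ d)) =
     3 * (Gc ^+ 2 * K4) * (l ^+ 2 / N%:R `^ d) by ring.
  apply: ler_wpM2l; first by apply: mulr_ge0 => //; apply: mulr_ge0 => //; rewrite exprn_ge0.
  by apply: ler_wpM2r => //; rewrite invr_ge0 ltW.
have mean_l n : (N < n)%N -> (n <= M)%N -> mean h b prob M n <= l.
  move=> Nn nM; apply: le_trans (mn n Nn nM) _.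
  apply: le_trans (_ : 1 * ln n%:R <= _).
    by rewrite ler_wpM2r ?ln_nat_ge0 //; lra.
  by rewrite mul1r; apply: le_trans (lnM n Nn nM) _; rewrite /l lerDr.
have rl : rh * l <= Gc * (h%:R * Lc%:R) * E1 N.
  apply: le_trans (ler_wpM2r (_ : 0 <= l) rhE) _; first by lra.
  rewrite E1E -[leLHS]mulrA; apply: ler_wpM2l => //.
  have -> : l / N%:R `^ d * l = l ^+ 2 / N%:R `^ d by ring.
  by rewrite ler_wpM2r ?invr_ge0 ?(ltW Nd0).
have etaE : 5 * D + 4 * (rh * l) <= CE * E1 N.
  by rewrite /CE; move: DE rl; lra.
have rhalf : 0 <= rh <= 1 / 2 by rewrite rh0 /=; lra.
have mem n : n \in iota N.+1 N -> (N < n)%N /\ (n <= M)%N.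
  by rewrite mem_iota => /andP[Nn nM]; split=> //; rewrite /M mul2n -addnn -ltnS -addSn.
have pz n : (N < n)%N -> (n <= M)%N ->
    expR (- (mean h b prob M n * (1 + 2 * rh))) <= pzero h b prob M n.
  by move=> Nn nM; apply: pzero_ge => // X; exact: wr.
(* Another quarter pays for the factor [1 + 2 rh], as [(1 - 3 eps/4) (1 + eps/4) <= 1 - eps/2]. *)
have pz2 n : (N < n)%N -> (n <= M)%N ->
    expR (- ((1 - eps / 2) * ln (2 * N%:R))) <= pzero h b prob M n.
  move=> Nn nM; apply: le_trans (pz n Nn nM); rewrite ler_expR lerN2.
  have H1 := mn n Nn nM; have H2 := lnM n Nn nM.
  apply: (@le_trans _ _ ((1 - eps * 3 / 4) * ln n%:R * (1 + eps / 4))).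
    apply: ler_pM => //; [exact: mean_ge0|lra|lra].
  have ee : 0 <= eps * eps by rewrite mulr_ge0 // ltW.
  rewrite mulrAC; apply: ler_pM; rewrite ?ln_nat_ge0 //.
    by rewrite mulr_ge0 //; lra.
  lra.
pose m := \sum_(n <- iota N.+1 N) pzero h b prob M n.
(* There are [N] terms of size at least [(2N)^(-1 + eps/2)], so [m] is at least [(2N)^(eps/2) / 2];
   the logarithmic bound from [1 + x <= e^x] is enough. *)
have mge : eps / 4 * ln N%:R <= m.
  apply: (@le_trans _ _ (\sum_(n <- iota N.+1 N) expR (- ((1 - eps / 2) * ln (2 * N%:R))))); last first.
    rewrite /m big_seq [leRHS]big_seq; apply: ler_sum => n /mem[Nn nM].
    exact: pz2.
  rewrite big_const_seq count_predT size_iota iter_addr_0 -[leRHS]mulr_natl.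
  have NE : N%:R = expR (ln (2 * N%:R)) / 2 :> R.
    by rewrite lnK ?posrE ?mulr_gt0 //; field.
  rewrite [X in _ <= X * _]NE [leRHS]mulrAC -expRD.
  have -> : ln (2 * N%:R) - (1 - eps / 2) * ln (2 * N%:R) = eps / 2 * ln (2 * N%:R) :> R by ring.
  have NlR : ln (N%:R : R) <= ln (2 * N%:R).
    by rewrite ler_ln ?posrE ?mulr_gt0 //; lra.
  have := expR_ge1Dx (eps / 2 * ln (2 * N%:R)).
  have : eps * ln N%:R <= eps * ln (2 * N%:R) by rewrite ler_wpM2l // ltW.
  lra.
have lN : 0 < ln (N%:R : R) by rewrite ln_gt0 // ltr1n.
have m0 : 0 < m by apply: lt_le_trans mge; rewrite mulr_gt0.
have minv : m^-1 <= e / 2.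
  have : m^-1 <= 4 / eps * (ln N%:R)^-1.
    have -> : 4 / eps * (ln N%:R)^-1 = (eps / 4 * ln N%:R)^-1.
      by field; rewrite !gt_eqF.
    by rewrite lef_pV2 ?posrE ?mulr_gt0.
  by move: B3; rewrite sub0r normrN => /(le_trans (ler_norm _)); lra.
have := @chebyshev_avoid R h b prob M p01 (iota N.+1 N) (CE * E1 N) (iota_uniq _ _).
rewrite -/m => /(_ _ m0) H; apply: le_trans (H _) _; last first.
  by move: B1; rewrite ler_norml => /andP[B1 _]; lra.
move=> n k /mem[Nn nM] /mem[Nk kM] nk.
apply: le_trans (pzero_pair_le h2 b0 p01 L1 pL nk (ltnW Nn) (ltnW Nk) N0 tau0) _.
rewrite -/D.
(* Janson's bound involves the means, Chebyshev's the probabilities; Harris' lower bound exchanges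
   them at the cost [2 rh] times the means. *)
apply: (@le_trans _ _ (expR (CE * E1 N) *
   (expR (- (mean h b prob M n * (1 + 2 * rh))) * expR (- (mean h b prob M k * (1 + 2 * rh)))))).
  rewrite -!expRD ler_expR.
  have H1 := ler_wpM2l rh0 (mean_l n Nn nM); have H2 := ler_wpM2l rh0 (mean_l k Nk kM).
  by move: etaE H1 H2; lra.
rewrite ler_wpM2l ?expR_ge0 //; apply: ler_pM; rewrite ?expR_ge0 //; exact: pz.
Unshelve. all: by end_near. Qed.

End many_gaps.

Local Open Scope classical_set_scope.

(** * The random set *)

Section random_set.
Variables (R : realType) (dT : measure_display) (T : measurableType dT).
Variables (P : probability T R) (E : nat -> set T) (p : nat -> R).
Hypothesis mE : forall n, (0 < n)%N -> measurable (E n).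
Hypothesis p0 : p 0%N = 1.
Hypothesis PE : forall n, (0 < n)%N -> P (E n) = (p n)%:E.
Hypothesis indepE : mutually_independent_pos P E.

(** Since 0 always belongs to the random set, its event is the whole space, whatever [E 0] is. *)
Let F (n : nat) : set T := if n == 0%N then setT else E n.

Lemma inA_F w n : inA E w n = (w \in F n).
Proof. by rewrite /inA /F; case: ifP => // _; rewrite in_setT. Qed.

Lemma measurable_F n : measurable (F n).
Proof.
by rewrite /F; case: ifPn => [_|]; [exact: measurableT | rewrite -lt0n => /mE].
Qed.

Lemma measurable_bigF (s : seq nat) : measurable (\big[setI/setT]_(n <- s) F n).
Proof.
elim: s => [|n s IH]; first by rewrite big_nil; exact: measurableT.
by rewrite big_cons; apply: measurableI => //; exact: measurable_F.
Qed.

Lemma indepF (s : seq nat) : uniq s ->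
  P (\big[setI/setT]_(n <- s) F n) = (\prod_(n <- s) p n)%:E.
Proof.
move=> us; pose s' := [seq n <- s | (0 < n)%N].
have -> : \big[setI/setT]_(n <- s) F n = \big[setI/setT]_(n <- s') E n.
  rewrite big_filter [RHS]big_mkcond; apply: eq_bigr => n _.
  by rewrite /F lt0n; case: eqP.
have -> : \prod_(n <- s) p n = \prod_(n <- s') p n.
  rewrite big_filter [RHS]big_mkcond; apply: eq_bigr => n _.
  by rewrite lt0n; case: eqP => // ->.
rewrite indepE ?filter_uniq // ?filter_all //.
rewrite -prodEFin big_seq [RHS]big_seq; apply: eq_bigr => n.
by rewrite mem_filter => /andP[/PE ->].
Qed.

Definition restr (M : nat) (A : nat -> bool) : nat -> bool := fun n => (n < M)%N && A n.

Lemma restrS M A : restr M.+1 A = upd (restr M A) M (A M).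
Proof.
by apply/funext => n; rewrite /restr /upd ltnS leq_eqVlt; case: eqP => //= ->.
Qed.

Definition evt (M : nat) (Q : (nat -> bool) -> bool) : set T :=
  [set w | Q (restr M (inA E w))].

Lemma evtS M Q : evt M.+1 Q =
  (F M `&` evt M (fun A => Q (upd A M true))) `|`
  (evt M (fun A => Q (upd A M false)) `\` F M).
Proof.
apply/seteqP; split => w; rewrite /evt /= restrS inA_F.
  have [Fw|nFw] := pselect (F M w).
    by rewrite mem_set // => Qw; left; split.
  by rewrite memNset // => Qw; right; split.
by move=> [[Fw Qw]|[Qw nFw]]; [rewrite mem_set | rewrite memNset].
Qed.

Lemma measurable_evt M Q : measurable (evt M Q).
Proof.
elim: M Q => [|M IH] Q; last first.
  rewrite evtS; apply: measurableU.
    by apply: measurableI => //; exact: measurable_F.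
  by apply: measurableD => //; exact: measurable_F.
have [q|q] := boolP (Q (fun=> false)).
  rewrite (_ : evt 0 Q = setT); first exact: measurableT.
  apply/seteqP; split=> // w _; rewrite /evt /= (_ : restr 0 _ = fun=> false) //.
rewrite (_ : evt 0 Q = set0); first exact: measurable0.
apply/seteqP; split=> // w; rewrite /evt /= (_ : restr 0 _ = fun=> false) //.
by rewrite (negbTE q).
Qed.

(* Carrying along the events [F n], [n >= M], lets the induction on [M] use only
   the product rule for intersections, never for complements. *)
Lemma prob_evt_inter M Q (s : seq nat) : uniq s -> all (fun n => M <= n)%N s ->
  P (evt M Q `&` \big[setI/setT]_(n <- s) F n) =
  (Ex p M (fun A => (Q A)%:R) * \prod_(n <- s) p n)%:E.
Proof.
elim: M Q s => [|M IH] Q s us /allP sM.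
  rewrite /Ex /=; have [q|q] := boolP (Q (fun=> false)).
    rewrite (_ : evt 0 Q = setT) ?setTI ?mul1r ?indepF //.
    by apply/seteqP; split=> // w _; rewrite /evt /= (_ : restr 0 _ = fun=> false).
  rewrite (_ : evt 0 Q = set0) ?set0I ?measure0 ?mul0r //.
  apply/seteqP; split=> // w; rewrite /evt /= (_ : restr 0 _ = fun=> false) //.
  by rewrite (negbTE q).
have Ms : M \notin s by apply/negP => /sM; rewrite ltnn.
have sM' : all (fun n => M <= n)%N s by apply/allP => n /sM /ltnW.
set X := \big[setI/setT]_(n <- s) F n.
set Q1 := fun A => Q (upd A M true); set Q0 := fun A => Q (upd A M false).
have mX : measurable X := measurable_bigF s.
have mF := measurable_F M.
have bigMs : \big[setI/setT]_(n <- M :: s) F n = F M `&` X by rewrite big_cons.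
have I1 : P (evt M Q1 `&` (F M `&` X)) = (Ex p M (fun A => (Q1 A)%:R) * (p M * \prod_(n <- s) p n))%:E.
  by rewrite -bigMs IH /= ?big_cons ?Ms ?us ?leqnn ?sM'.
have I0 : P (evt M Q0 `&` (F M `&` X)) = (Ex p M (fun A => (Q0 A)%:R) * (p M * \prod_(n <- s) p n))%:E.
  by rewrite -bigMs IH /= ?big_cons ?Ms ?us ?leqnn ?sM'.
have I2 : P (evt M Q0 `&` X) = (Ex p M (fun A => (Q0 A)%:R) * \prod_(n <- s) p n)%:E.
  by rewrite IH.
rewrite evtS -/Q1 -/Q0 setIUl measureU; first last.
- apply/seteqP; split=> // w /= [[[Fw _] _] [[_ nFw] _]]; exact: nFw.
- by apply: measurableI => //; apply: measurableD => //; exact: measurable_evt.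
- by apply: measurableI => //; apply: measurableI => //; exact: measurable_evt.
have -> : (F M `&` evt M Q1) `&` X = evt M Q1 `&` (F M `&` X).
  by rewrite [F M `&` evt _ _]setIC setIA.
have -> : (evt M Q0 `\` F M) `&` X = (evt M Q0 `&` X) `\` F M.
  by rewrite setDE setIAC -setDE.
rewrite measureD //; last 2 first.
- by apply: measurableI => //; exact: measurable_evt.
- apply: (@le_lt_trans _ _ 1%E); last by rewrite ltry.
  by apply: probability_le1; apply: measurableI => //; exact: measurable_evt.
have -> : (evt M Q0 `&` X) `&` F M = evt M Q0 `&` (F M `&` X).
  by rewrite -setIA [X `&` _]setIC.
rewrite /= I1 I0 I2 -EFinB -EFinD /=; congr EFin.
rewrite /Ex /= -/(Ex _ _) /Q1 /Q0; ring.
Qed.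

Lemma prob_evt M Q : P (evt M Q) = (Ex p M (fun A => (Q A)%:R))%:E.
Proof.
by have := @prob_evt_inter M Q [::] isT isT; rewrite !big_nil setIT mulr1.
Qed.

(** The bridge from the finite averages [Ex] to the measure [P], for properties that depend on the
    first [M] coins only. *)
Lemma prob_evt_local M (Q : (nat -> bool) -> bool) :
  (forall A, Q (restr M A) = Q A) ->
  measurable [set w | Q (inA E w)] /\
  P [set w | Q (inA E w)] = (Ex p M (fun A => (Q A)%:R))%:E.
Proof.
move=> QM; have -> : [set w | Q (inA E w)] = evt M Q.
  by apply/seteqP; split => w /=; rewrite /evt /= QM.
by split; [exact: measurable_evt | exact: prob_evt].
Qed.

Section representations.
Variables (h : nat) (b : nat -> nat).
Hypothesis h2 : (2 <= h)%N.
Hypothesis b0 : forall i, (i < h)%N -> (0 < b i)%N.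
Hypothesis p01 : forall n, 0 <= p n <= 1.

Lemma rA_sum w n : (rA h b E w n)%:R =
  \sum_(k : {ffun 'I_h -> 'I_n.+1} | dot b k == n) ind R (img k) (inA E w) :> R.
Proof.
rewrite /rA -sum1_card natr_sum.
rewrite (eq_bigl (fun k : {ffun 'I_h -> 'I_n.+1} =>
   (dot b k == n) && [forall i, inA E w (k i)])); last first.
  by move=> k; apply/idP/idP; rewrite in_setE /= andbC.
rewrite big_mkcondr; apply: eq_bigr => k _; rewrite /ind.
suff -> : [forall i in img k, inA E w i] = [forall i, inA E w (k i)] by case: ifP.
apply/forall_inP/forallP => [H i|H x /imgP[i <-]]; last exact: H.
by apply: H; exact: mem_img.
Qed.

Lemma ind_restr M (X : {set 'I_M}) A : ind R X (restr M A) = ind R X A.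
Proof. by rewrite !indE; apply: eq_bigr => i _; rewrite /restr ltn_ord. Qed.

Lemma expectation_rA n :
  (\int[P]_w ((rA h b E w n)%:R : R)%:E =
   (\sum_(k : {ffun 'I_h -> 'I_n.+1} | dot b k == n) \prod_(x in img k) p x)%:E)%E.
Proof.
pose S (k : {ffun 'I_h -> 'I_n.+1}) : set T :=
  [set w | [forall i in img k, inA E w i]].
have SP k : measurable (S k) /\ P (S k) = (\prod_(x in img k) p x)%:E.
  have [|mS PS] := @prob_evt_local n.+1 (fun A => [forall i in img k, A (nat_of_ord i)]).
    move=> A; apply/forall_inP/forall_inP => H i ik; have := H i ik.
      by move=> /andP[].
    by rewrite /restr ltn_ord.
  split=> //; rewrite PS; congr EFin; rewrite -[RHS](Ex_ind p (img k)).
  exact: eq_Ex.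
transitivity (\int[P]_w (\sum_(k <- index_enum {ffun 'I_h -> 'I_n.+1})
   (if dot b k == n then (\1_(S k) w)%:E else 0)))%E.
  apply: eq_integral => w _; rewrite rA_sum -sumEFin big_mkcond /=.
  apply: eq_bigr => k _; case: ifP => // _; congr EFin; rewrite indicE /ind.
  by congr (_%:R); congr nat_of_bool; apply/idP/idP; rewrite in_setE.
rewrite ge0_integral_sum //; last 2 first.
- move=> k; case: (dot b k == n); last exact: measurable_cst.
  by apply/measurable_EFinP; apply: measurable_indic; have [] := SP k.
- by move=> k w _; case: ifP => // _; rewrite lee_fin indicE.
rewrite -sumEFin [RHS]big_mkcond /=; apply: eq_bigr => k _; case: (dot b k == n).
  by have [mS PS] := SP k; rewrite integral_indic // setIT.
by rewrite integral0.
Qed.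

Lemma avoid_restr M n A : avoid R (fam h b M n) (restr M.+1 A) = avoid R (fam h b M n) A.
Proof. by apply: eq_bigr => X _; rewrite ind_restr. Qed.

(** The bound [M] is shared by all [n] of a dyadic interval, so the tuple is widened from entries up
    to [n] to entries up to [M]. *)
Lemma rA_neq0_avoid M n w : (n <= M)%N -> rA h b E w n != 0%N ->
  avoid R (fam h b M n) (inA E w) = 0.
Proof.
move=> nM; rewrite -lt0n /rA => /card_gt0P[k].
rewrite in_setE => /andP[/forallP kA /eqP kn].
pose k' : {ffun 'I_h -> 'I_M.+1} := [ffun i => inord (k i)].
have k'E i : nat_of_ord (k' i) = k i.
  by rewrite ffunE inordK // ltnS (leq_trans _ nM) // -ltnS.
have kf : img k' \in fam h b M n.
  apply/famP; exists k' => //; rewrite -[RHS]kn; apply: eq_bigr => i _.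
  by rewrite k'E.
rewrite /avoid (bigD1_seq _ kf (fam_uniq _ _ _ _)) /=.
suff -> : ind R (img k') (inA E w) = 1 by rewrite subrr mul0r.
rewrite /ind (_ : [forall i in img k', inA E w i]) //.
by apply/forall_inP => x /imgP[i <-]; rewrite k'E.
Qed.

Lemma measurable_rA0 n : measurable [set w | rA h b E w n = 0%N].
Proof.
have [|mS _] := @prob_evt_local n.+1 (fun A => [forall k : {ffun 'I_h -> 'I_n.+1},
    (dot b k == n) ==> ~~ [forall i in img k, A (nat_of_ord i)]]).
  move=> A; apply: eq_forallb => k; congr (_ ==> ~~ _).
  by apply: eq_forallb => i; rewrite /restr ltn_ord.
rewrite (_ : [set w | _] = [set w | [forall k : {ffun 'I_h -> 'I_n.+1},
    (dot b k == n) ==> ~~ [forall i in img k, inA E w i]]]) //.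
apply/seteqP; split=> w /= H.
  apply/forall_inP => k kn; apply/negP => kA.
  have : (rA h b E w n)%:R = 0 :> R by rewrite H.
  rewrite rA_sum (bigD1 k) //= /ind kA; apply/eqP; rewrite gt_eqF //.
  by rewrite ltr_pwDl // sumr_ge0 // => q _; case: [forall _ in _, _].
apply/eqP; rewrite -(@eqr_nat R) rA_sum big1 // => k kn; rewrite /ind.
by have /forall_inP/(_ k kn)/negbTE -> := H.
Qed.

End representations.
End random_set.

(** * Almost surely there are infinitely many gaps *)

Lemma infinite_natP (A : set nat) :
  infinite_set A <-> forall N, exists2 n, (N < n)%N & A n.
Proof.
split=> [infA N|unb /finite_seqP[s sE]].
  apply: contrapT => H; apply: infA; apply: (@sub_finite_set _ _ `I_N.+1); last exact: finite_II.
  move=> n An /=; rewrite ltnS leqNgt; apply/negP => Nn; apply: H; by exists n.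
have [n sn An] := unb (\max_(i <- s) i)%N.
move: An; rewrite sE /= => ns.
by move: sn; rewrite ltnNge leq_bigmax_seq.
Qed.

Section infinitely_many_gaps.
Variables (R : realType) (h : nat) (b : nat -> nat) (c C0 eps : R).
Hypothesis h2 : (2 <= h)%N.
Hypothesis b0 : forall i, (i < h)%N -> (0 < b i)%N.
Hypothesis c0 : 0 <= c.
Hypothesis eps01 : 0 < eps < 1.
Hypothesis cnt_lim : cnt R h b @ \oo --> C0.
Hypothesis cC0 : c ^+ h * C0 = 1 - eps.
Variables (dT : measure_display) (T : measurableType dT).
Variables (P : probability T R) (E : nat -> set T).
Hypothesis mE : forall n, (0 < n)%N -> measurable (E n).
Hypothesis PE : forall n, (0 < n)%N -> P (E n) = (@prob R h c n)%:E.
Hypothesis indepE : mutually_independent_pos P E.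

Let prob0 : @prob R h c 0%N = 1. Proof. by []. Qed.

Let tailzero (N : nat) : set T := [set w | exists2 n, (N < n)%N & rA h b E w n = 0%N].

Lemma measurable_tailzero N : measurable (tailzero N).
Proof.
have -> : tailzero N = \bigcup_(n in [set n | (N < n)%N]) [set w | rA h b E w n = 0%N].
  apply/seteqP; split => w /=; first by move=> [n Nn rn]; exists n.
  by move=> [n Nn rn]; exists n.
by apply: bigcup_measurable => n _; exact: (measurable_rA0 mE prob0 PE indepE).
Qed.

(** For every [e > 0] some dyadic interval beyond [N] contains no gap with probability at most
    [e]. *)
Lemma prob_tailzero N : P (tailzero N) = 1%E.
Proof.
apply/eqP; rewrite eq_le (probability_le1 P (measurable_tailzero N)) /=.
apply/lee_addgt0Pr => e e0.
have [N' [NN' small]] : exists N', (N <= N')%N /\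
  Ex (@prob R h c) (2 * N').+1
    (fun A => (\sum_(n <- iota N'.+1 N') avoid R (fam h b (2 * N') n) A == 0)%:R) <= e.
  have [N1 _ H1] := zero_prob_small h2 b0 c0 eps01 cnt_lim cC0 e0.
  by exists (maxn N N1); split; [exact: leq_maxl | apply: H1; rewrite /= leq_maxr].
set M := (2 * N')%N in small.
pose Q (A : nat -> bool) := \sum_(n <- iota N'.+1 N') avoid R (fam h b M n) A == 0.
have [|mQ PQ] := @prob_evt_local R dT T P E (@prob R h c) mE prob0 PE indepE M.+1 Q.
  by move=> A; rewrite /Q; under eq_bigr do rewrite avoid_restr.
have sub : ~` [set w | Q (inA E w)] `<=` tailzero N.
  move=> w /= nQ; apply: contrapT => H; apply: nQ; rewrite /Q big1_seq // => n /andP[_].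
  rewrite mem_iota => /andP[Nn nM]; apply: rA_neq0_avoid.
    by rewrite /M mul2n -addnn -ltnS -addSn.
  by apply/negP => /eqP rn; apply: H; exists n => //; exact: leq_ltn_trans Nn.
have H : (P (~` [set w | Q (inA E w)]) <= P (tailzero N))%E.
  by apply: le_measure => //; rewrite inE; [exact: measurableC | exact: measurable_tailzero].
rewrite (probability_setC P mQ) PQ in H.
apply: le_trans (leeD2r e%:E H).
rewrite -EFinB -EFinD lee_fin; move: small; rewrite -/Q; lra.
Qed.

(** Infinitely many gaps means a gap beyond every [N]: a countable intersection of events of
    probability 1. *)
Lemma infinitely_many_gaps :
  P [set w | infinite_set [set n | rA h b E w n = 0%N]] = 1%E.
Proof.
have -> : [set w | infinite_set [set n | rA h b E w n = 0%N]] = \bigcap_N tailzero N.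
  apply/seteqP; split => w /=.
    by move=> /infinite_natP H N _; have [n Nn rn] := H N; exists n.
  by move=> H; apply/infinite_natP => N; have [n Nn rn] := H N I; exists n.
have mI : measurable (\bigcap_N tailzero N).
  by apply: bigcap_measurable => // N _; exact: measurable_tailzero.
have neg : P.-negligible (\bigcup_N ~` tailzero N).
  apply: negligible_bigcup => N; apply/negligibleP.
    by apply: measurableC; exact: measurable_tailzero.
  rewrite /= probability_setC; last exact: measurable_tailzero.
  by rewrite prob_tailzero subee.
have PC : P (~` \bigcap_N tailzero N) = 0%E.
  apply: measure_negligible; first exact: measurableC.
  by rewrite setC_bigcap.
by have := probability_setC P (measurableC mI); rewrite setCK PC sube0.
Qed.

End infinitely_many_gaps.

(** * The normalizing constant and the conclusion *)

(** The constant [c] is chosen so that its [h]-th power times the limit of [cnt] is [1 - eps]; the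
    exponent [1/h^2] becomes [1/h] after taking the [h]-th power. *)
Lemma pow_const (R : realType) (h : nat) (b : nat -> nat) (eps : R) : (2 <= h)%N ->
  (forall i, (i < h)%N -> (0 < b i)%N) -> 0 <= 1 - eps ->
  ((1 - eps) `^ (h%:R^-1) * (\prod_(i < h) b i)%:R `^ ((h ^ 2)%:R^-1)
           / Gamma (h%:R^-1 : R)) ^+ h *
  (Gamma (h%:R^-1 : R) ^+ h / \prod_(i < h) hroot h (b i)%:R) = 1 - eps.
Proof.
move=> h2 b0 e0; have G0 := Gamma_gt0 R h2.
have h0 := hR_gt0 R h2.
rewrite !exprMn exprVn.
have -> : ((1 - eps) `^ h%:R^-1) ^+ h = 1 - eps by exact: (hroot_exp h2).
have -> : ((\prod_(i < h) b i)%:R `^ (h ^ 2)%:R^-1) ^+ h = \prod_(i < h) hroot h (b i)%:R :> R.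
  have -> : ((\prod_(i < h) b i)%:R `^ (h ^ 2)%:R^-1) ^+ h = hroot h (\prod_(i < h) b i)%:R :> R.
    rewrite -powR_mulrn ?powR_ge0 // -powRrM /hroot; congr (_ `^ _).
    by rewrite natrX expr2; field; rewrite gt_eqF.
  elim/big_rec2: _ => [|i y m _ <-]; first by rewrite hroot1.
  by rewrite natrM hrootM.
have pb0 : 0 < \prod_(i < h) hroot h (b i)%:R :> R.
  by apply: prodr_gt0 => i _; rewrite hroot_gt0 // ltr0n b0.
by field; rewrite !gt_eqF ?exprn_gt0.
Qed.

Theorem theorem5 (R : realType) (h : nat) (b : nat -> nat) (eps : R)
  (d : measure_display) (T : measurableType d) (P : probability T R)
  (E : nat -> set T) :
  (2 <= h)%N ->
  (forall i, (i < h)%N -> (0 < b i)%N) ->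
  (\big[gcdn/0]_(i < h) b i = 1)%N ->
  0 < eps < 2^-1 ->
  let c := (1 - eps) `^ (h%:R^-1) * (\prod_(i < h) b i)%:R `^ ((h ^ 2)%:R^-1)
           / Gamma (h%:R^-1 : R) in
  (forall n, (0 < n)%N -> measurable (E n)) ->
  (forall n, (0 < n)%N ->
     P (E n) = (Num.min (c * (n%:R * ln n%:R) `^ (h%:R^-1) / n%:R) 1)%:E) ->
  mutually_independent_pos P E ->
  ((fun n : nat => fine (\int[P]_w ((rA h b E w n)%:R : R)%:E)%E
                   / ((1 - eps) * ln (n%:R : R))) @ \oo --> (1 : R))
  /\ P [set w | infinite_set [set n | rA h b E w n = 0%N]] = 1%E.
Proof.
move=> h2 b0 g1 /andP[eps0 eps1] c mE PE indE.
have G0 := Gamma_gt0 R h2.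
have ep : 0 < 1 - eps by lra.
have c0 : 0 <= c by rewrite divr_ge0 ?(ltW G0) // mulr_ge0 ?powR_ge0.
have cC0 := pow_const h2 b0 (ltW ep); rewrite -/c in cC0.
have cl := @cnt_cvg_Gamma R h b h2 b0 g1.
have PE' n : (0 < n)%N -> P (E n) = (@prob R h c n)%:E.
  by move=> n0; rewrite PE // /prob gtn_eqF.
split; last first.
  apply: (infinitely_many_gaps h2 b0 c0 _ cl cC0 mE PE' indE).
  by rewrite eps0 /=; lra.
have prob0 : @prob R h c 0%N = 1 by [].
have H := Er_cvg h2 b0 c0 cl; rewrite cC0 in H.
have cv : (fun n : nat => Er h b c n n / ln n%:R * (1 - eps)^-1) @ \oo -->
    (1 - eps) * (1 - eps)^-1.
  by apply: cvgM => //; exact: cvg_cst.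
rewrite divff ?gt_eqF // in cv.
(* The identity holds for every [n], also where the logarithm vanishes, since the inverse of 0 is
   0. *)
rewrite [X in X @ _](_ : _ = fun n : nat => Er h b c n n / ln n%:R * (1 - eps)^-1) //.
apply/funext => n; rewrite (expectation_rA mE prob0 PE' indE) /=.
by rewrite invfM mulrA mulrAC.
Qed.
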